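(* Let $A$ be a finitely generated abelian group and let $A\wr\mathbb{Z}$ be the restricted wreath product of $A$ with the infinite cyclic group $\mathbb{Z}$. Then: (i) There is an algorithm that, given a finite system of coefficient-free equations, decides whether or not the system has a non-trivial solution in $A\wr\mathbb{Z}$. (ii) There is an algorithm that, given a quadratic equation with constants in $A\wr\mathbb{Z}$, decides whether or not the equation has a solution in $A\wr\mathbb{Z}$.
   Context: The restricted wreath product $G\wr\mathbb{Z}$ is the semidirect product $\bigoplus_{i\in\mathbb{Z}}G\rtimes\mathbb{Z}$, where $\mathbb{Z}$ acts by translation of indices; for abelian $G$ written additively, $(\{g_n\}_{n\in\mathbb{Z}},k)\cdot(\{h_n\}_{n\in\mathbb{Z}},l)=(\{g_n+h_{n+k}\}_{n\in\mathbb{Z}},k+l)$. An equation with constants (coefficients) in a group $H$ generated by a finite set $S$ is an expression $w(\bar x,S)=1$, where $w$ is a group word in finitely many variables $\bar x$ and the generators $S$. A solution in $H$ is an assignment of elements of $H$ to the variables which makes $w$ equal to $1$ in $H$. A system is solved by an assignment that solves all of its equations. An equation is quadratic if each variable occurring in it occurs exactly twice, counting occurrences as $x$ and as $x^{-1}$. An equation is coefficient-free if it has the form $w(\bar x)=1$ with $w$ a group word in the variables only. A solution of a coefficient-free system is non-trivial if at least one variable is assigned a non-identity element. *)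

(* Defs.v *)
From HB Require Import structures.
From mathcomp Require Import all_boot all_order all_algebra.
From mathcomp Require Import finmap.

Set Implicit Arguments.
Unset Strict Implicit.
Unset Printing Implicit Defensive.

Import GRing.Theory.

(** * Algorithms: mu-recursive functions *)

(* Descriptions of partial recursive functions. Arguments are passed as a list
   of naturals; arities are not tracked, and an argument missing from a list
   is read as 0. *)
Inductive recfun : Type :=
| RZero
| RSucc
| RProj of nat
| RComp of recfun & seq recfun
| RPrec of recfun & recfun
| RMu of recfun.

(* [computes f v r]: the partial function described by [f] is defined at the
   arguments [v] and its value is [r]. *)
Inductive computes : recfun -> seq nat -> nat -> Prop :=
| computes_zero v : computes RZero v 0
| computes_succ v : computes RSucc v (nth 0 v 0).+1
| computes_proj i v : computes (RProj i) v (nth 0 v i)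
| computes_comp f gs v u r :
    size u = size gs ->
    (forall i, i < size gs -> computes (nth RZero gs i) v (nth 0 u i)) ->
    computes f u r -> computes (RComp f gs) v r
| computes_prec0 f g v r :
    computes f v r -> computes (RPrec f g) (0 :: v) r
| computes_precS f g n v p r :
    computes (RPrec f g) (n :: v) p -> computes g [:: n, p & v] r ->
    computes (RPrec f g) (n.+1 :: v) r
| computes_mu f v n (p : nat -> nat) :
    (forall m, m < n -> computes f (m :: v) (p m).+1) ->
    computes f (n :: v) 0 -> computes (RMu f) v n.

Lemma computes_functional f v r r' :
  computes f v r -> computes f v r' -> r = r'.
Proof.
move=> c; elim: c r' => {f v r}
  [v|v|i v|f gs v u r su _ IHg _ IHf|f g v r _ IHf|f g n v p r _ IHp _ IHg
  |f v n p _ IHlt _ IHn] r' c'.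
- by inversion c'.
- by inversion c'.
- by inversion c'.
- inversion c' as [| | |f' gs' v' u' r'' su' Hg Hf| | |]; subst.
  apply: IHf; suff -> : u = u' by [].
  apply: (@eq_from_nth _ 0) => [|i]; first by rewrite su.
  by rewrite su => lti; apply: IHg => //; apply: Hg.
- by inversion c' as [| | | |f' g' v' r'' Hf| |]; subst; apply: IHf.
- inversion c' as [| | | | |f' g' n' v' p' r'' Hp Hg|]; subst.
  by apply: IHg; rewrite (IHp _ Hp).
- inversion c' as [| | | | | |f' v' n' p' Hlt Hn]; subst.
  case: (ltngtP n r') => // lt_n; first by have := IHn _ (Hlt _ lt_n).
  by have := IHlt _ lt_n _ Hn.
Qed.

(* The problem "given x in D, does P x hold?" on inputs presented through the
   Goedel numbering [enc] is algorithmically decidable. *)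
Definition decidable_on (T : Type) (enc : T -> nat) (D P : T -> Prop) : Prop :=
  exists f : recfun, forall x : T, D x ->
    exists2 b : bool, computes f [:: enc x] b & (b <-> P x).

(** * Restricted wreath products with the infinite cyclic group *)

Record wreathZ (A : zmodType) := WreathZ {
  lamps : {fsfun int -> A with 0%R};
  shift : int
}.

Section WreathGroup.

Variable A : zmodType.
Implicit Types x y z : wreathZ A.

Definition wreathZ_pair x := (lamps x, shift x).
Definition pair_wreathZ (p : {fsfun int -> A with 0%R} * int) :=
  WreathZ p.1 p.2.
Lemma wreathZ_pairK : cancel wreathZ_pair pair_wreathZ.
Proof. by case. Qed.

HB.instance Definition _ := Choice.copy (wreathZ A) (can_type wreathZ_pairK).

Local Open Scope ring_scope.

Definition wreathZ_one : wreathZ A := WreathZ [fsfun] 0.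

Definition wreathZ_mul x y : wreathZ A :=
  WreathZ
    [fsfun n in (finsupp (lamps x) `|`
                 [fset (m - shift x)%R | m in finsupp (lamps y)])%fset
       => lamps x n + lamps y (n + shift x)]
    (shift x + shift y).

Definition wreathZ_inv x : wreathZ A :=
  WreathZ
    [fsfun n in [fset (m + shift x)%R | m in finsupp (lamps x)]%fset
       => - lamps x (n - shift x)]
    (- shift x).

Lemma wreathZ_mulE x y n :
  lamps (wreathZ_mul x y) n = lamps x n + lamps y (n + shift x).
Proof.
rewrite fsfun_fun in_fsetU; case: ifPn => //; rewrite negb_or => /andP[nx ny].
rewrite (fsfun_dflt nx) add0r (fsfun_dflt (f := lamps y)) //.
apply: contra ny => ny; apply/imfsetP; exists (n + shift x) => //=.
by rewrite addrK.
Qed.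

Lemma wreathZ_invE x n : lamps (wreathZ_inv x) n = - lamps x (n - shift x).
Proof.
rewrite fsfun_fun; case: ifPn => // nx.
rewrite (fsfun_dflt (f := lamps x)) ?oppr0 //.
apply: contra nx => nx; apply/imfsetP; exists (n - shift x) => //=.
by rewrite subrK.
Qed.

Lemma wreathZ_eq x y :
  lamps x =1 lamps y -> shift x = shift y -> x = y.
Proof. by case: x y => [f k] [g l] /= /fsfunP -> ->. Qed.

Lemma wreathZ_mulA : associative wreathZ_mul.
Proof.
move=> x y z; apply: wreathZ_eq => [n|]; last by rewrite /= addrA.
by rewrite !wreathZ_mulE /= !addrA.
Qed.

Lemma wreathZ_mul1 : left_id wreathZ_one wreathZ_mul.
Proof.
move=> x; apply: wreathZ_eq => [n|]; last by rewrite /= add0r.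
by rewrite wreathZ_mulE /= fsfun0E add0r addr0.
Qed.

Lemma wreathZ_mulr1 : right_id wreathZ_one wreathZ_mul.
Proof.
move=> x; apply: wreathZ_eq => [n|]; last by rewrite /= addr0.
by rewrite wreathZ_mulE /= fsfun0E addr0.
Qed.

Lemma wreathZ_mulV : left_inverse wreathZ_one wreathZ_inv wreathZ_mul.
Proof.
move=> x; apply: wreathZ_eq => [n|]; last by rewrite /= addNr.
by rewrite wreathZ_mulE wreathZ_invE /= fsfun0E addNr.
Qed.

Lemma wreathZ_mulrV : right_inverse wreathZ_one wreathZ_inv wreathZ_mul.
Proof.
move=> x; apply: wreathZ_eq => [n|]; last by rewrite /= addrN.
by rewrite wreathZ_mulE wreathZ_invE /= fsfun0E addrK addrN.
Qed.

HB.instance Definition _ := isGroup.Build (wreathZ A)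
  wreathZ_mulA wreathZ_mul1 wreathZ_mulr1 wreathZ_mulV wreathZ_mulrV.

End WreathGroup.

Definition fg_abelian (A : zmodType) : Prop :=
  exists (m : nat) (a : 'I_m -> A), forall x : A,
    exists c : 'I_m -> int, x = (\sum_(i < m) a i *~ c i)%R.

(** * Words and equations *)

(* A letter (l, e) stands for l if e = false and for its inverse otherwise;
   words need not be reduced. *)
Definition word (L : Type) := seq (L * bool).

Definition word_val (L : Type) (H : groupType) (f : L -> H) (w : word L) : H :=
  (\prod_(l <- w) (if l.2 then (f l.1)^-1 else f l.1))%g.

Definition generates (H : groupType) (k : nat) (s : 'I_k -> H) : Prop :=
  forall h : H, exists w : word 'I_k, h = word_val s w.

(* Finite systems of coefficient-free equations w = 1 in the variables
   x_0, ..., x_(n-1), where n is part of the data. *)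
Record cf_system := CfSystem {
  cf_nvars : nat;
  cf_eqns : seq (word 'I_cf_nvars)
}.

Definition cf_solution (H : groupType) (E : cf_system)
    (x : 'I_(cf_nvars E) -> H) : Prop :=
  forall w, w \in cf_eqns E -> word_val x w = 1%g.

Definition has_nontrivial_solution (H : groupType) (E : cf_system) : Prop :=
  exists2 x : 'I_(cf_nvars E) -> H, cf_solution x & exists i, x i <> 1%g.

(* An equation w = 1 in variables x_0, ..., x_(n-1), with constants written as
   words in k fixed generators of the group. *)
Record equation (k : nat) := Equation {
  eq_nvars : nat;
  eq_word : word ('I_eq_nvars + 'I_k)
}.

Definition assignment (H : groupType) (n k : nat) (x : 'I_n -> H)
    (s : 'I_k -> H) (l : 'I_n + 'I_k) : H :=
  match l with inl i => x i | inr j => s j end.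

Definition has_solution (H : groupType) (k : nat) (s : 'I_k -> H)
    (E : equation k) : Prop :=
  exists x : 'I_(eq_nvars E) -> H,
    word_val (assignment x s) (eq_word E) = 1%g.

Definition quadratic (k : nat) (E : equation k) : Prop :=
  forall i : 'I_(eq_nvars E),
    let occ := count (fun l => l.1 == inl i) (eq_word E) in
    occ != 0 -> occ = 2.

(** * Goedel numberings *)

Definition cf_letter_code (n : nat) (l : 'I_n * bool) : nat :=
  CodeSeq.code [:: val l.1; nat_of_bool l.2].

Definition cf_word_code (n : nat) (w : word 'I_n) : nat :=
  CodeSeq.code (map (@cf_letter_code n) w).

Definition cf_system_code (E : cf_system) : nat :=
  CodeSeq.code (cf_nvars E :: map (@cf_word_code _) (cf_eqns E)).

Definition letter_code (n k : nat) (l : ('I_n + 'I_k) * bool) : nat :=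
  match l.1 with
  | inl i => CodeSeq.code [:: 0; val i; nat_of_bool l.2]
  | inr j => CodeSeq.code [:: 1; val j; nat_of_bool l.2]
  end.

Definition equation_code (k : nat) (E : equation k) : nat :=
  CodeSeq.code (eq_nvars E :: map (@letter_code _ k) (eq_word E)).

(* Main.v *)
(* Idea. A quotient of A wr Z by the lamps in mA and the m-th powers of the
   shift is a finite group (A/mA) wr (Z/m). A quadratic equation is solvable in
   A wr Z as soon as it is solvable in all these quotients, so one searches in
   parallel for a solution and for an m whose quotient contains none.
   To see this, rewrite the set of values of a quadratic word, up to
   conjugation, as a product of conjugacy classes, squares and commutators.
   Regarding lamp configurations as A[t,t^-1], the equation then asks for
   exponents r_j and k_i, the k_i having a prescribed sum, such that
   sum_j t^(r_j) c_j lies in the submodule generated by the images of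
   t^g - 1 (g among finitely many constants) and t^(k_i) + 1. Only the gcds of
   the exponents matter; when some t^D - 1 with D > 0 acts as zero the r_j
   range over a finite set and a solution modulo all m survives, and otherwise
   a solution modulo t^D - 1 for one large D can be unrolled to the line.
   For a coefficient-free system, the shifts of a solution solve a homogeneous
   linear system over Z; if they all vanish, the lamps at one position solve it
   in A, hence in some cyclic summand Z/d of A. A homogeneous system without
   non-trivial integer solution has none modulo some prime. *)
From HB Require Import structures.
Require Import Defs.
From mathcomp Require Import all_boot all_order all_algebra.
From mathcomp Require Import finmap zify ring.
From Stdlib Require Import Classical_Prop.

(** Passing from all moduli to the group is not plain compactness, as the r_j and k_i range over
    infinite sets. What decides is the number of squares. Modulo the span, t^g acts as 1 and t^k as
    -1, so an exponent with both properties makes 2 vanish; the submodules to be tested become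
    kernels of reduction modulo t^D - 1 or t^D + 1, with coefficients in A or A/2A. With no square
    only the g matter; with one square its exponent is forced by the sum; with two, the 2-adic
    valuation of the free exponent decides, and only finitely many valuations have to be told apart;
    with three or more, the exponents 0 and 1 can both be used, and only the sum of all lamps modulo
    2A remains. The quotients are never built as groups. They appear as the relation [congruent],
    and the finite search runs over words long enough to reach every class. For quadratic equations
    the moduli are multiples of the product of the orders of the finite cyclic summands, so that
    membership in mA is read coordinate by coordinate. Excluded middle enters the correctness
    proofs, never the programs. *)

Set Implicit Arguments.
Unset Strict Implicit.
Unset Printing Implicit Defensive.

Import Order.TTheory GRing.Theory Num.Theory.

(** * Identities in abelian groups, by reflection *)

Inductive zexpr :=
  | ZVar of nat | ZAdd of zexpr & zexpr | ZOpp of zexpr | ZZero | ZMul of zexpr & nat.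

Section ZmoduleReflection.

Local Open Scope ring_scope.

Fixpoint zexpr_val (V : zmodType) (env : seq V) (e : zexpr) : V :=
  match e with
  | ZVar i => env`_i
  | ZAdd e1 e2 => zexpr_val env e1 + zexpr_val env e2
  | ZOpp e1 => - zexpr_val env e1
  | ZZero => 0
  | ZMul e1 n => zexpr_val env e1 *+ n
  end.

Fixpoint zexpr_coef (e : zexpr) (i : nat) : int :=
  match e with
  | ZVar j => (i == j)%:Z
  | ZAdd e1 e2 => zexpr_coef e1 i + zexpr_coef e2 i
  | ZOpp e1 => - zexpr_coef e1 i
  | ZZero => 0
  | ZMul e1 n => zexpr_coef e1 i * n%:Z
  end.

Lemma zexpr_valE (V : zmodType) (env : seq V) e :
  zexpr_val env e = \sum_(i < size env) env`_i *~ zexpr_coef e i.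
Proof.
elim: e => /= [j|e1 -> e2 ->|e ->||e -> n].
- have [ltj|lej] := ltnP j (size env).
    rewrite (bigD1 (Ordinal ltj)) //= eqxx mulr1z big1 ?addr0 // => i.
    by rewrite -val_eqE /= => /negPf ->; rewrite mulr0z.
  rewrite nth_default // big1 // => i _; rewrite (_ : (i == j :> nat) = false) ?mulr0z //.
  by apply/negbTE; rewrite neq_ltn (leq_trans _ lej).
- by rewrite -big_split; apply: eq_bigr => i _; rewrite mulrzDr.
- by rewrite -sumrN; apply: eq_bigr => i _; rewrite mulrNz.
- by rewrite big1 // => i _; rewrite mulr0z.
- by rewrite -sumrMnl; apply: eq_bigr => i _; rewrite mulrzA pmulrn.
Qed.

(** The premise is a comparison of finitely many closed integers, which [zmod] settles by
    computation. *)
Lemma zexpr_eq (V : zmodType) (env : seq V) e1 e2 :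
  all (fun i => zexpr_coef e1 i == zexpr_coef e2 i) (iota 0 (size env)) ->
  zexpr_val env e1 = zexpr_val env e2.
Proof.
move=> /allP h; rewrite !zexpr_valE; apply: eq_bigr => i _.
by have := h (val i); rewrite mem_iota ltn_ord => /(_ isT)/eqP ->.
Qed.

End ZmoduleReflection.

(* Equal atoms may differ in the inferred algebraic structures, hence the
   comparison up to conversion below a common head symbol. *)
Ltac zmod_same x y :=
  first [constr_eq x y |
    lazymatch x with ?f ?u =>
      lazymatch y with ?g ?v => zmod_same f g; unify u v end
    end].
Ltac zmod_index x l :=
  match l with
  | ?y :: _ => let _ := match goal with _ => zmod_same x y end in constr:(0)
  | _ :: ?t => let n := zmod_index x t in constr:(S n)
  end.
Ltac zmod_insert x l :=
  match l with
  | _ => let n := zmod_index x l in l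
  | _ => constr:(x :: l)
  end.
Ltac zmod_atoms t l :=
  lazymatch t with
  | (?a + ?b)%R => let l' := zmod_atoms a l in zmod_atoms b l'
  | (- ?a)%R => zmod_atoms a l
  | 0%R => l
  | (?a *+ ?n)%R => zmod_atoms a l
  | _ => zmod_insert t l
  end.
Ltac zmod_reify t l :=
  lazymatch t with
  | (?a + ?b)%R =>
      let x := zmod_reify a l in let y := zmod_reify b l in constr:(ZAdd x y)
  | (- ?a)%R => let x := zmod_reify a l in constr:(ZOpp x)
  | 0%R => constr:(ZZero)
  | (?a *+ ?n)%R => let x := zmod_reify a l in constr:(ZMul x n)
  | _ => let i := zmod_index t l in constr:(ZVar i)
  end.
Ltac zmod :=
  lazymatch goal with
  | |- @eq ?V ?a ?b =>
      let l0 := zmod_atoms a (@nil V) in let l := zmod_atoms b l0 in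
      let x := zmod_reify a l in let y := zmod_reify b l in
      apply: (@zexpr_eq _ l x y); vm_compute; reflexivity
  end.

(** * Computable functions between encoded types *)

Class encoded (T : Type) := enc : T -> nat.

(** The step of [CodeSeq.code] at a cons. With the same function for pairs, a pair of a head and a
    list has the code of the list with that head, so the Goedel numbers of systems and equations are
    literally codes of pairs. *)
Definition cons_code (a b : nat) := 2 ^ a * b.*2.+1.

#[export] Instance enc_nat : encoded nat := id.
#[export] Instance enc_bool : encoded bool := nat_of_bool.
#[export] Instance enc_pair (X Y : Type) (eX : encoded X) (eY : encoded Y) :
  encoded (X * Y) := fun p => cons_code (enc p.1) (enc p.2).
#[export] Instance enc_seq (X : Type) (eX : encoded X) : encoded (seq X) :=
  fun s => CodeSeq.code (map enc s).

Definition computable (X Y : Type) {eX : encoded X} {eY : encoded Y}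
    (f : X -> Y) : Prop :=
  exists F, forall x, computes F [:: enc x] (enc (f x)).

Definition computes2 (F : recfun) (op : nat -> nat -> nat) :=
  forall a b, computes F [:: a; b] (op a b).

Lemma computes_comp1 f g v a r :
  computes g v a -> computes f [:: a] r -> computes (RComp f [:: g]) v r.
Proof. by move=> cg cf; apply: (@computes_comp _ _ _ [:: a]) => // -[]. Qed.

Lemma computes_comp2 f g h v a b r :
  computes g v a -> computes h v b -> computes f [:: a; b] r ->
  computes (RComp f [:: g; h]) v r.
Proof.
by move=> cg ch cf; apply: (@computes_comp _ _ _ [:: a; b]) => // -[|[|]].
Qed.

Lemma computes_projE i v r : r = nth 0 v i -> computes (RProj i) v r.
Proof. by move=> ->; apply: computes_proj. Qed.

Lemma computes_nat_rect (F G : recfun) (v : seq nat) (h : nat -> nat) n :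
  computes F v (h 0) ->
  (forall i, i < n -> computes G [:: i, h i & v] (h i.+1)) ->
  computes (RPrec F G) (n :: v) (h n).
Proof.
move=> cF; elim: n => [|n IH] cG; first exact: computes_prec0.
by apply: computes_precS (IH _) (cG _ _) => // i lti; apply: cG; lia.
Qed.

(** * Closure properties of computable functions *)

Section Closure.

Context {X Y Z W : Type} {eX : encoded X} {eY : encoded Y} {eZ : encoded Z}
  {eW : encoded W}.

Lemma computable_ext (f g : X -> Y) :
  f =1 g -> computable f -> computable g.
Proof. by move=> fg [F cF]; exists F => x; rewrite -fg. Qed.

Lemma computable_id : computable (fun x : X => x).
Proof. by exists (RProj 0) => x; apply: computes_projE. Qed.

Lemma computable_comp (g : Y -> Z) (f : X -> Y) :
  computable g -> computable f -> computable (fun x => g (f x)).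
Proof.
by move=> [G cG] [F cF]; exists (RComp G [:: F]) => x; apply: computes_comp1.
Qed.

Lemma computable_natconst (n : nat) : computable (fun _ : X => n).
Proof.
elim: n => [|n IH]; first by exists RZero => x; apply: computes_zero.
have [F cF] := IH; exists (RComp RSucc [:: F]) => x; apply: (computes_comp1 (cF x)).
exact: computes_succ.
Qed.

Lemma computable_const (y : Y) : computable (fun _ : X => y).
Proof. by have [F cF] := computable_natconst (enc y); exists F. Qed.

Lemma computable_op2 (op : nat -> nat -> nat) (f g : X -> nat) (F : recfun) :
  computes2 F op -> computable f -> computable g ->
  computable (fun x => op (f x) (g x)).
Proof.
move=> cop [G cG] [H cH]; exists (RComp F [:: G; H]) => x.
by apply: computes_comp2 (cop _ _).
Qed.

Lemma computable_succ (f : X -> nat) :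
  computable f -> computable (fun x => (f x).+1).
Proof.
move=> [F cF]; exists (RComp RSucc [:: F]) => x.
by apply: computes_comp1 (cF x) _; apply: computes_succ.
Qed.

End Closure.

(** * Arithmetic on codes *)

Lemma computes2_add : exists F, computes2 F addn.
Proof.
exists (RPrec (RProj 0) (RComp RSucc [:: RProj 1])) => a b.
apply: (@computes_nat_rect _ _ [:: b] (addn^~ b)).
  by apply: computes_projE.
move=> i _; apply: computes_comp1; first exact: computes_proj.
exact: computes_succ.
Qed.

Lemma computes2_mul : exists F, computes2 F muln.
Proof.
have [A cA] := computes2_add.
exists (RPrec RZero (RComp A [:: RProj 2; RProj 1])) => a b.
apply: (@computes_nat_rect _ _ [:: b] (muln^~ b)).
  exact: computes_zero.
move=> i _; apply: computes_comp2; [exact: computes_proj..|].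
exact: cA.
Qed.

Lemma computable_pred : computable predn.
Proof.
have cP a : computes (RPrec RZero (RProj 0)) [:: a] a.-1.
  apply: (@computes_nat_rect _ _ [::] predn); first exact: computes_zero.
  by move=> i _; apply: computes_projE.
by exists (RPrec RZero (RProj 0)) => a; apply: cP.
Qed.

Lemma computes2_sub : exists F, computes2 F subn.
Proof.
have [P cP] := computable_pred.
pose S := RPrec (RProj 0) (RComp P [:: RProj 1]).
have cS a b : computes S [:: a; b] (b - a).
  apply: (@computes_nat_rect _ _ [:: b] (subn b)).
    by apply: computes_projE; rewrite subn0.
  move=> i _; apply: computes_comp1; first exact: computes_proj.
  by rewrite /= subnS; apply: cP.
exists (RComp S [:: RProj 1; RProj 0]) => a b.
by apply: computes_comp2; [exact: computes_proj..|]; apply: cS.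
Qed.

Lemma computable_expn2 : computable (expn 2).
Proof.
have [A cA] := computes2_add.
exists (RPrec (RComp RSucc [:: RZero]) (RComp A [:: RProj 1; RProj 1])) => a.
apply: (@computes_nat_rect _ _ [::] (expn 2)).
  by apply: computes_comp1; [exact: computes_zero|exact: computes_succ].
move=> i _; apply: computes_comp2; [exact: computes_proj..|].
by rewrite expnS mul2n -addnn; apply: cA.
Qed.

Lemma computable_odd : computable odd.
Proof.
have [S cS] := computes2_sub.
exists (RPrec RZero (RComp S [:: RComp RSucc [:: RZero]; RProj 1])) => a.
apply: (@computes_nat_rect _ _ [::] (fun a => nat_of_bool (odd a))).
  exact: computes_zero.
move=> i _; apply: computes_comp2; last by rewrite /= -[nat_of_bool (~~ _)]
  (_ : 1 - odd i = _); [apply: cS|case: odd].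
  by apply: computes_comp1; [exact: computes_zero|exact: computes_succ].
exact: computes_proj.
Qed.

Lemma computable_half : computable half.
Proof.
have [A cA] := computes2_add; have [O cO] := computable_odd.
exists (RPrec RZero (RComp A [:: RComp O [:: RProj 0]; RProj 1])) => a.
apply: (@computes_nat_rect _ _ [::] half); first exact: computes_zero.
move=> i _; rewrite -uphalfE uphalf_half.
apply: computes_comp2 (cA _ _); last exact: computes_proj.
by apply: computes_comp1; [exact: computes_proj|apply: cO].
Qed.

Lemma computes2_cons_code : exists F, computes2 F cons_code.
Proof.
have [A cA] := computes2_add; have [M cM] := computes2_mul.
have [E cE] := computable_expn2.
exists (RComp M [:: RComp E [:: RProj 0];
  RComp RSucc [:: RComp A [:: RProj 1; RProj 1]]]) => a b.
apply: computes_comp2 (cM _ _).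
  by apply: computes_comp1; [exact: computes_proj|apply: cE].
rewrite -addnn; apply: computes_comp1; last exact: computes_succ.
by apply: computes_comp2 (cA _ _); apply: computes_proj.
Qed.

(** Second component of [cons_code]: the iterated halving removes the power of two, the last one
    removes the final binary digit 1. *)
Definition code_tl (n : nat) := (iter (logn 2 n) half n)./2.

Lemma iter_half_shift a k b : iter k half (2 ^ (k + a) * b) = 2 ^ a * b.
Proof.
elim: k => [|k IH] //; rewrite iterSr -IH; congr (iter _ _ _).
by rewrite addSn expnS -mulnA mul2n doubleK.
Qed.

Lemma logn_cons_code a b : logn 2 (cons_code a b) = a.
Proof.
rewrite /cons_code lognM ?expn_gt0 // pfactorK // [logn 2 _.+1]lognE /=.
by rewrite dvdn2 /= odd_double /= addn0.
Qed.

Lemma code_tl_cons a b : code_tl (cons_code a b) = b.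
Proof.
rewrite /code_tl logn_cons_code /cons_code -[in 2 ^ _](addn0 a).
by rewrite iter_half_shift mul1n /= uphalf_double.
Qed.

Lemma cons_code_gt0 a b : 0 < cons_code a b.
Proof. by rewrite muln_gt0 expn_gt0. Qed.

Lemma cons_code_surj n : 0 < n -> n = cons_code (logn 2 n) (code_tl n).
Proof.
move=> n0; have /= [a co eq] := @pfactor_coprime 2 n isT n0.
have oa : odd a by move: co; rewrite coprime2n.
have: n = cons_code (logn 2 n) a./2.
  rewrite [LHS]eq /cons_code mulnC; congr (_ * _).
  by rewrite -[LHS]odd_double_half oa.
by move=> e; have -> : code_tl n = a./2 by rewrite {1}e code_tl_cons.
Qed.

Lemma computable_logn2 : computable (logn 2).
Proof.
have [O cO] := computable_odd; have [H cH] := computable_half.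
have [S cS] := computes2_sub.
pose I := RPrec (RProj 0) (RComp H [:: RProj 1]).
have cI k n : computes I [:: k; n] (iter k half n).
  apply: (@computes_nat_rect _ _ [:: n] (fun k => iter k half n)).
    exact: computes_proj.
  move=> i _; apply: computes_comp1; first exact: computes_proj.
  exact: cH.
pose one := RComp RSucc [:: RZero].
have c1 v : computes one v 1.
  by apply: computes_comp1; [exact: computes_zero|exact: computes_succ].
(* The search looks for the first odd iterate of halving. The term 1 - n makes it stop at once for n
   = 0, where no iterate is odd and [logn] is 0. *)
pose T := RComp S [:: RComp S [:: one; RComp O [:: I]];
  RComp S [:: one; RProj 1]].
have cT k n : computes T [:: k; n] ((1 - odd (iter k half n)) - (1 - n)).
  apply: computes_comp2 (cS _ _); apply: computes_comp2 (cS _ _) => //.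
    by apply: computes_comp1 (cI _ _) _; apply: cO.
  exact: computes_proj.
exists (RMu T) => n; rewrite /enc /enc_nat /=.
have [->|n0] := posnP n.
  by rewrite logn0; apply: (@computes_mu _ _ _ id) => //; apply: cT.
have [a [b En]] : exists a b, n = cons_code a b.
  by exists (logn 2 n), (code_tl n); apply: cons_code_surj.
rewrite {2}En logn_cons_code; apply: (@computes_mu _ _ _ (fun=> 0)).
  move=> k ltka; suff E : (1 - odd (iter k half n)) - (1 - n) = 1.
    by have := cT k n; rewrite E.
  rewrite En /cons_code -(subnKC (ltnW ltka)) iter_half_shift oddM oddX.
  rewrite subn_eq0 leqNgt ltka /= (_ : 1 - _ * _ = 0) //.
  by apply/eqP; rewrite subn_eq0 muln_gt0 expn_gt0.
suff E : (1 - odd (iter a half n)) - (1 - n) = 0 by have := cT a n; rewrite E.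
rewrite En /cons_code -[in 2 ^ _](addn0 a) iter_half_shift mul1n.
by rewrite /= odd_double.
Qed.

Lemma computable_code_tl : computable code_tl.
Proof.
have [L cL] := computable_logn2; have [H cH] := computable_half.
pose I := RPrec (RProj 0) (RComp H [:: RProj 1]).
exists (RComp H [:: RComp I [:: L; RProj 0]]) => n.
apply: computes_comp1; last exact: cH.
apply: computes_comp2; [exact: cL|exact: computes_proj|].
apply: (@computes_nat_rect _ _ [:: n] (fun k => iter k half n)).
  exact: computes_proj.
move=> i _; apply: computes_comp1; first exact: computes_proj.
exact: cH.
Qed.

Section Pairs.

Context {X Y Z : Type} {eX : encoded X} {eY : encoded Y} {eZ : encoded Z}.

Lemma computable_pair (f : X -> Y) (g : X -> Z) :
  computable f -> computable g -> computable (fun x => (f x, g x)).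
Proof.
have [C cC] := computes2_cons_code.
move=> [F cF] [G cG]; exists (RComp C [:: F; G]) => x.
by apply: computes_comp2 (cC _ _).
Qed.

Lemma computable_fst (f : X -> Y * Z) :
  computable f -> computable (fun x => (f x).1).
Proof.
have [L cL] := computable_logn2; move=> [F cF].
exists (RComp L [:: F]) => x; apply: computes_comp1 (cF x) _.
have <- : logn 2 (enc (f x)) = enc (f x).1 by apply: logn_cons_code.
exact: cL.
Qed.

Lemma computable_snd (f : X -> Y * Z) :
  computable f -> computable (fun x => (f x).2).
Proof.
have [L cL] := computable_code_tl; move=> [F cF].
exists (RComp L [:: F]) => x; apply: computes_comp1 (cF x) _.
have <- : code_tl (enc (f x)) = enc (f x).2 by apply: code_tl_cons.
exact: cL.
Qed.

Lemma computable_nat_rect (n : X -> nat) (f : X -> Y) (g : X -> nat -> Y -> Y) :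
  computable n -> computable f ->
  computable (fun p : X * nat * Y => g p.1.1 p.1.2 p.2) ->
  computable (fun x => nat_rect (fun=> Y) (f x) (g x) (n x)).
Proof.
have [C cC] := computes2_cons_code.
move=> [N cN] [F cF] [G cG].
pose G' := RComp G [:: RComp C [:: RComp C [:: RProj 2; RProj 0]; RProj 1]].
exists (RComp (RPrec F G') [:: N; RProj 0]) => x.
apply: computes_comp2 (cN x) (computes_proj _ _) _.
apply: (@computes_nat_rect _ _ [:: enc x]
  (fun k => enc (nat_rect (fun=> Y) (f x) (g x) k))); first exact: cF.
move=> i _; apply: computes_comp1 (cG (x, i, _)).
apply: computes_comp2 (cC _ _); last exact: computes_proj.
by apply: computes_comp2 (cC _ _); apply: computes_proj.
Qed.

End Pairs.

Section Cases.

Context {X Y Z : Type} {eX : encoded X} {eY : encoded Y} {eZ : encoded Z}.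

Lemma computable_if (b : X -> bool) (f g : X -> Y) :
  computable b -> computable f -> computable g ->
  computable (fun x => if b x then f x else g x).
Proof.
move=> [B cB] cf cg.
have cn : computable (fun x => nat_of_bool (b x)) by exists B.
apply: (computable_ext (f := fun x =>
  nat_rect (fun=> Y) (g x) (fun _ _ => f x) (nat_of_bool (b x)))).
  by move=> x; case: (b x).
apply: computable_nat_rect => //.
apply: (computable_comp (f := fun p : X * nat * Y => p.1.1) cf).
by apply: computable_fst; apply: computable_fst; apply: computable_id.
Qed.

Lemma enc_cons (y : Y) (s : seq Y) : enc (y :: s) = cons_code (enc y) (enc s).
Proof. by []. Qed.

(** The empty list has code 0 and every other list a positive code, so primitive recursion on the
    code separates the cases. The step ignores the recursive value and reads head and tail from
    [s x] itself. *)
Lemma computable_seq_case (s : X -> seq Y) (f : X -> Z) (g : X -> Y -> seq Y -> Z) :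
  computable s -> computable f ->
  computable (fun p : X * Y * seq Y => g p.1.1 p.1.2 p.2) ->
  computable (fun x => match s x with [::] => f x | y :: l => g x y l end).
Proof.
have [C cC] := computes2_cons_code.
have [L cL] := computable_logn2; have [T cT] := computable_code_tl.
move=> [S cS] [F cF] [G cG].
pose G' := RComp G [:: RComp C [:: RComp C [:: RProj 2;
   RComp L [:: RComp S [:: RProj 2]]]; RComp T [:: RComp S [:: RProj 2]]]].
exists (RComp (RPrec F G') [:: S; RProj 0]) => x.
apply: computes_comp2 (cS x) (computes_proj _ _) _.
case Es: (s x) => [|y l]; first by apply: computes_prec0; apply: cF.
have : 0 < enc (y :: l) by apply: cons_code_gt0.
case En : (enc (y :: l)) => [//|n] _.
have cy i p : computes (RComp S [:: RProj 2]) [:: i; p; enc x] n.+1.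
  by rewrite -En -Es; apply: computes_comp1 (cS x); apply: computes_projE.
pose h (k : nat) := @enc Z eZ (if k is _.+1 then g x y l else f x).
rewrite /=.
apply: (@computes_nat_rect _ _ [:: enc x] h n.+1) => [|i _]; first exact: cF.
apply: computes_comp1 (cG (x, y, l)).
have Ly : logn 2 n.+1 = enc y by rewrite -En enc_cons logn_cons_code.
have Tl : code_tl n.+1 = enc l by rewrite -En enc_cons code_tl_cons.
apply: computes_comp2 (cC _ _).
  apply: computes_comp2 (cC _ _); first exact: computes_proj.
  by rewrite -Ly; apply: computes_comp1 (cy _ _) (cL n.+1).
by rewrite -Tl; apply: computes_comp1 (cy _ _) (cT n.+1).
Qed.

Lemma computable_cons (f : X -> Y) (g : X -> seq Y) :
  computable f -> computable g -> computable (fun x => f x :: g x).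
Proof.
move=> cf cg; have [F cF] := computable_pair cf cg.
by exists F => x; apply: cF.
Qed.

Lemma computable_enc (f : X -> Y) : computable f -> computable (fun x => enc (f x)).
Proof. by case=> F cF; exists F => x; apply: cF. Qed.

End Cases.

Lemma ltn_cons_code a b : b < cons_code a b.
Proof.
by rewrite /cons_code -addnn; have := expn_gt0 2 a; case: (2 ^ a) => //=; lia.
Qed.

Lemma size_le_enc (Y : Type) (eY : encoded Y) (s : seq Y) : size s <= enc s.
Proof.
by elim: s => //= y s IH; rewrite enc_cons (leq_ltn_trans IH) ?ltn_cons_code.
Qed.

Section Lists.

Context {X Y Z : Type} {eX : encoded X} {eY : encoded Y} {eZ : encoded Z}.

(** The state is the accumulator with the unread part of the list. The code of the list bounds its
    length, hence serves as the number of iterations; surplus steps do nothing. *)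
Lemma computable_foldl (s : X -> seq Z) (f : X -> Y) (g : X -> Y -> Z -> Y) :
  computable s -> computable f ->
  computable (fun p : X * Y * Z => g p.1.1 p.1.2 p.2) ->
  computable (fun x => foldl (g x) (f x) (s x)).
Proof.
move=> cs cf cg.
pose step x (i : nat) (p : Y * seq Z) :=
  match p.2 with [::] => p | z :: l => (g x p.1 z, l) end.
have stepE x n y l : size l <= n ->
    (nat_rect (fun=> (Y * seq Z)%type) (y, l) (step x) n).1 = foldl (g x) y l.
  suff E k y' l' : nat_rect (fun=> (Y * seq Z)%type) (y', l') (step x) k =
      (foldl (g x) y' (take k l'), drop k l').
    by move=> le; rewrite E take_oversize.
  elim: k y' l' => [|k IH] y' l'; first by rewrite take0 drop0.
  rewrite /= IH /step /=; case Ed: (drop k l') => [|z l1].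
    have le : size l' <= k by move/(congr1 size): Ed; rewrite size_drop /=; lia.
    by rewrite !take_oversize ?drop_oversize //; lia.
  rewrite -{2}[k.+1]add1n -drop_drop Ed -addn1 takeD Ed foldl_cat /= take0.
  by rewrite drop0.
apply: (computable_ext (f := fun x =>
  (nat_rect (fun=> (Y * seq Z)%type) (f x, s x) (step x) (enc (s x))).1)).
  by move=> x; rewrite stepE ?size_le_enc.
apply: computable_fst; apply: computable_nat_rect.
- exact: computable_enc.
- exact: computable_pair.
have c2 : computable (fun p : X * nat * (Y * seq Z) => p.2).
  exact: computable_snd computable_id.
have c1 : computable (fun p : X * nat * (Y * seq Z) => p.1.1).
  exact: computable_fst (computable_fst computable_id).
rewrite /step; apply: (computable_seq_case (s := fun p => p.2.2)
  (g := fun p z l => (g p.1.1 p.2.1 z, l))) => //.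
  exact: computable_snd.
apply: computable_pair; last exact: computable_snd computable_id.
set Q := (X * nat * (Y * seq Z) * Z * seq Z)%type.
have q1 : computable (fun q : Q => q.1.1).
  exact: computable_fst (computable_fst computable_id).
apply: (computable_comp (f := fun q : Q => (q.1.1.1.1, q.1.1.2.1, q.1.2)) cg).
apply: computable_pair.
  apply: computable_pair.
    by do 2 apply: computable_fst.
  by apply: computable_fst; apply: computable_snd.
by apply: computable_snd; apply: computable_fst; apply: computable_id.
Qed.

End Lists.

Section Arithmetic.

Context {X : Type} {eX : encoded X}.

Lemma computable_addn (f g : X -> nat) :
  computable f -> computable g -> computable (fun x => f x + g x).
Proof. by have [F cF] := computes2_add; apply: computable_op2 cF. Qed.

Lemma computable_muln (f g : X -> nat) :
  computable f -> computable g -> computable (fun x => f x * g x).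
Proof. by have [F cF] := computes2_mul; apply: computable_op2 cF. Qed.

Lemma computable_subn (f g : X -> nat) :
  computable f -> computable g -> computable (fun x => f x - g x).
Proof. by have [F cF] := computes2_sub; apply: computable_op2 cF. Qed.

Lemma computable_predn (f : X -> nat) :
  computable f -> computable (fun x => (f x).-1).
Proof. exact: computable_comp computable_pred. Qed.

Lemma computable_oddn (f : X -> nat) :
  computable f -> computable (fun x => odd (f x)).
Proof. exact: computable_comp computable_odd. Qed.

Lemma computable_andb (f g : X -> bool) :
  computable f -> computable g -> computable (fun x => f x && g x).
Proof. by move=> cf cg; apply: computable_if => //; apply: computable_const. Qed.

Lemma computable_orb (f g : X -> bool) :
  computable f -> computable g -> computable (fun x => f x || g x).
Proof. by move=> cf cg; apply: computable_if => //; apply: computable_const. Qed.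

Lemma computable_negb (f : X -> bool) :
  computable f -> computable (fun x => ~~ f x).
Proof. by move=> cf; apply: computable_if => //; apply: computable_const. Qed.

Lemma computable_eq0 (f : X -> nat) :
  computable f -> computable (fun x => f x == 0).
Proof.
move=> cf; apply: (computable_ext (f := fun x =>
  nat_rect (fun=> bool) true (fun _ _ => false) (f x))).
  by move=> x; case: (f x).
by apply: computable_nat_rect => //; apply: computable_const.
Qed.

Lemma computable_eqn (f g : X -> nat) :
  computable f -> computable g -> computable (fun x => f x == g x).
Proof.
move=> cf cg; apply: (computable_ext (f := fun x =>
  (f x - g x == 0) && (g x - f x == 0))) => [x|].
  by rewrite !subn_eq0 -eqn_leq.
by apply: computable_andb; apply: computable_eq0; apply: computable_subn.
Qed.

End Arithmetic.

(** A counter reset on reaching [g x]. For [g x = 0] it is never reset, in agreement with n %% 0 =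
    n; modulus 0 thus tests equality. *)
Lemma computable_modn (X : Type) (eX : encoded X) (f g : X -> nat) :
  computable f -> computable g -> computable (fun x => f x %% g x).
Proof.
move=> cf cg; apply: (computable_ext (f := fun x =>
  nat_rect (fun=> nat) 0 (fun _ r => if r.+1 == g x then 0 else r.+1) (f x))).
  move=> x; elim: (f x) => [|n /= ->]; first by rewrite mod0n.
  have [->|g0] := posnP (g x); first by rewrite !modn0.
  rewrite -[n.+1 in RHS]addn1 -modnDml addn1.
  have := ltn_pmod n g0; rewrite leq_eqVlt.
  by case: eqP => [->|_ /= lt]; rewrite ?modnn // [RHS]modn_small.
apply: computable_nat_rect => //; first exact: computable_const.
have cr : computable (fun p : X * nat * nat => p.2.+1).
  exact: computable_succ (computable_snd computable_id).
apply: computable_if => //; last exact: computable_const.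
apply: computable_eqn => //; apply: computable_comp cg _.
exact: computable_fst (computable_fst computable_id).
Qed.

Section MoreLists.

Context {X Y Z : Type} {eX : encoded X} {eY : encoded Y} {eZ : encoded Z}.

Lemma computable_rev (s : X -> seq Y) :
  computable s -> computable (fun x => rev (s x)).
Proof.
move=> cs; apply: (computable_ext (f := fun x =>
  foldl (fun acc y => y :: acc) [::] (s x))).
  move=> x; rewrite /rev; elim: (s x) [::] => //= y l IH acc; exact: IH.
apply: computable_foldl => //; first exact: computable_const.
apply: computable_cons; first exact: computable_snd computable_id.
exact: computable_snd (computable_fst computable_id).
Qed.

Lemma computable_map (s : X -> seq Y) (g : X -> Y -> Z) :
  computable s -> computable (fun p : X * Y => g p.1 p.2) ->
  computable (fun x => map (g x) (s x)).
Proof.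
move=> cs cg; apply: (computable_ext (f := fun x =>
  foldl (fun acc y => g x y :: acc) [::] (rev (s x)))).
  by move=> x; elim: (s x) => //= y l IH; rewrite rev_cons foldl_rcons IH.
apply: computable_foldl.
- exact: computable_rev.
- exact: computable_const.
apply: computable_cons; last exact: computable_snd (computable_fst computable_id).
apply: (computable_comp (f := fun p : X * seq Z * Y => (p.1.1, p.2)) cg).
apply: computable_pair; last exact: computable_snd computable_id.
exact: computable_fst (computable_fst computable_id).
Qed.

Lemma computable_cat (s t : X -> seq Y) :
  computable s -> computable t -> computable (fun x => s x ++ t x).
Proof.
move=> cs ct; apply: (computable_ext (f := fun x =>
  foldl (fun acc y => y :: acc) (t x) (rev (s x)))).
  by move=> x; elim: (s x) => //= y l IH; rewrite rev_cons foldl_rcons IH.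
apply: computable_foldl => //; first exact: computable_rev.
apply: computable_cons; first exact: computable_snd computable_id.
exact: computable_snd (computable_fst computable_id).
Qed.

Lemma computable_size (s : X -> seq Y) :
  computable s -> computable (fun x => size (s x)).
Proof.
move=> cs; apply: (computable_ext (f := fun x =>
  foldl (fun n _ => n.+1) 0 (s x))).
  move=> x; rewrite -[RHS]addn0; elim: (s x) 0 => //= y l IH n.
  by rewrite IH addnS.
apply: computable_foldl => //; first exact: computable_const.
exact: computable_succ (computable_snd (computable_fst computable_id)).
Qed.

Lemma computable_all (s : X -> seq Y) (g : X -> Y -> bool) :
  computable s -> computable (fun p : X * Y => g p.1 p.2) ->
  computable (fun x => all (g x) (s x)).
Proof.
move=> cs cg; apply: (computable_ext (f := fun x =>
  foldl (fun b y => b && g x y) true (s x))).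
  move=> x; rewrite -[RHS]andTb; elim: (s x) true => [|y l IH] b /=.
    by rewrite andbT.
  by rewrite IH andbA.
apply: computable_foldl => //; first exact: computable_const.
apply: computable_andb; first exact: computable_snd (computable_fst computable_id).
apply: (computable_comp (f := fun p : X * bool * Y => (p.1.1, p.2)) cg).
apply: computable_pair; last exact: computable_snd computable_id.
exact: computable_fst (computable_fst computable_id).
Qed.

Lemma computable_has (s : X -> seq Y) (g : X -> Y -> bool) :
  computable s -> computable (fun p : X * Y => g p.1 p.2) ->
  computable (fun x => has (g x) (s x)).
Proof.
move=> cs cg; apply: (computable_ext (f := fun x =>
  ~~ all (fun y => ~~ g x y) (s x))).
  by move=> x; rewrite -has_predC; apply: eq_has => y /=; rewrite negbK.
by apply: computable_negb; apply: computable_all => //; apply: computable_negb.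
Qed.

Lemma computable_nth (y0 : Y) (s : X -> seq Y) (i : X -> nat) :
  computable s -> computable i -> computable (fun x => nth y0 (s x) (i x)).
Proof.
move=> cs ci; apply: (computable_ext (f := fun x =>
  match nat_rect (fun=> seq Y) (s x)
    (fun _ l => match l with [::] => l | _ :: l' => l' end) (i x) with
  | [::] => y0 | y :: _ => y end)).
  move=> x; rewrite -[i x in RHS]addn0 -nth_drop.
  suff -> n : nat_rect (fun=> seq Y) (s x)
      (fun _ l => match l with [::] => l | _ :: l' => l' end) n = drop n (s x).
    by case: drop.
  elim: n => [|n /= ->]; first by rewrite drop0.
  by rewrite -[n.+1]add1n -drop_drop; case: drop => //= y l; rewrite drop0.
apply: (computable_seq_case (g := fun _ y _ => y)).
- apply: computable_nat_rect => //.
  have c2 : computable (fun p : X * nat * seq Y => p.2).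
    exact: computable_snd computable_id.
  apply: (computable_seq_case (g := fun _ _ l => l)) => //.
  exact: computable_snd computable_id.
- exact: computable_const.
- exact: computable_snd (computable_fst computable_id).
Qed.

End MoreLists.

Lemma computable_flatten (X Y : Type) (eX : encoded X) (eY : encoded Y)
    (s : X -> seq (seq Y)) :
  computable s -> computable (fun x => flatten (s x)).
Proof.
move=> cs; apply: (computable_ext (f := fun x =>
  foldl (fun acc l => acc ++ l) [::] (s x))).
  move=> x; rewrite -[RHS]cat0s; elim: (s x) [::] => [|y l IH] acc /=.
    by rewrite cats0.
  by rewrite IH catA.
apply: computable_foldl => //; first exact: computable_const.
apply: computable_cat; last exact: computable_snd computable_id.
exact: computable_snd (computable_fst computable_id).
Qed.

Lemma computable_iota (X : Type) (eX : encoded X) (n : X -> nat) :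
  computable n -> computable (fun x => iota 0 (n x)).
Proof.
move=> cn; apply: (computable_ext (f := fun x =>
  nat_rect (fun=> seq nat) [::] (fun i l => l ++ [:: i]) (n x))).
  move=> x; elim: (n x) => //= k ->.
  by rewrite -[0 :: _]/(iota 0 k.+1) -addn1 iotaD.
apply: computable_nat_rect => //; first exact: computable_const.
apply: computable_cat; first exact: computable_snd computable_id.
apply: computable_cons; last exact: computable_const.
exact: computable_snd (computable_fst computable_id).
Qed.

(** A list of naturals is presented by its code, so decoding is the identity on codes. *)
Lemma computable_decode (X : Type) (eX : encoded X) (n : X -> nat) :
  computable n -> computable (fun x => CodeSeq.decode (n x)).
Proof.
move=> [F cF]; exists F => x.
have -> : enc (CodeSeq.decode (n x)) = CodeSeq.code (map id (CodeSeq.decode (n x))).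
  by [].
by rewrite map_id CodeSeq.decodeK.
Qed.

(* Decomposes the goal along the syntax of the function, whose variables are
   projections of a nested pair. *)
Ltac computable_step :=
  lazymatch goal with
  | |- computable (fun x => x) => apply: computable_id
  | |- computable (fun _ => ?c) => apply: computable_const
  | |- computable fst => exact: (computable_fst computable_id)
  | |- computable snd => exact: (computable_snd computable_id)
  | |- computable (fun x => fst _) => apply: computable_fst
  | |- computable (fun x => snd _) => apply: computable_snd
  | |- computable (fun x => (_, _)) => apply: computable_pair
  | |- computable (fun x => S _) => apply: computable_succ
  | |- computable (fun x => predn _) => apply: computable_predn
  | |- computable (fun x => addn _ _) => apply: computable_addn
  | |- computable (fun x => muln _ _) => apply: computable_muln
  | |- computable (fun x => modn _ _) => apply: computable_modn
  | |- computable (fun x => odd _) => apply: computable_oddn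
  | |- computable (fun x => @eq_op Datatypes_nat__canonical__eqtype_Equality _ _) => apply: computable_eqn
  | |- computable (fun x => negb _) => apply: computable_negb
  | |- computable (fun x => andb _ _) => apply: computable_andb
  | |- computable (fun x => orb _ _) => apply: computable_orb
  | |- computable (fun x => if _ then _ else _) => apply: computable_if
  | |- computable (fun x => cons _ _) => apply: computable_cons
  | |- computable (fun x => cat _ _) => apply: computable_cat
  | |- computable (fun x => rev _) => apply: computable_rev
  | |- computable (fun x => size _) => apply: computable_size
  | |- computable (fun x => map _ _) => apply: computable_map
  | |- computable (fun x => all _ _) => apply: computable_all
  | |- computable (fun x => has _ _) => apply: computable_has
  | |- computable (fun x => nth _ _ _) => apply: computable_nth
  | |- computable (fun x => foldl _ _ _) => apply: computable_foldl
  | |- computable (fun x => nat_rect _ _ _ _) => apply: computable_nat_rect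
  | |- computable (fun x => flatten _) => apply: computable_flatten
  | |- computable (fun x => iota 0 _) => apply: computable_iota
  | |- computable (fun x => CodeSeq.decode _) => apply: computable_decode
  end.
Ltac computable_tac := repeat computable_step.

(** Two semi-decision procedures run in parallel: minimization finds the first stage at which one of
    the total tests [pos] and [neg] succeeds, and the value of [pos] at that stage is the answer. *)
Lemma decidable_by_search (T X : Type) (eX : encoded X) (raw : T -> X)
    (code : T -> nat) (D P : T -> Prop) (pos neg : X -> nat -> bool) :
  (forall E, code E = enc (raw E)) ->
  computable (fun p : X * nat => pos p.1 p.2) ->
  computable (fun p : X * nat => neg p.1 p.2) ->
  (forall E t, D E -> pos (raw E) t -> P E) ->
  (forall E t, D E -> neg (raw E) t -> ~ P E) ->
  (forall E, D E -> (exists t, pos (raw E) t) \/ (exists t, neg (raw E) t)) ->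
  decidable_on code D P.
Proof.
move=> codeE cpos cneg posP negP tot.
have [C cC] := computes2_cons_code.
have [F cF] := cpos.
have [G cG] : computable (fun p : X * nat => ~~ (pos p.1 p.2 || neg p.1 p.2)).
  exact: computable_negb (computable_orb cpos cneg).
pose M := RMu (RComp G [:: RComp C [:: RProj 1; RProj 0]]).
exists (RComp F [:: RComp C [:: RProj 0; M]]) => E DE.
have ex : exists t, pos (raw E) t || neg (raw E) t.
  by case: (tot E DE) => -[t ht]; exists t; rewrite ht ?orbT.
pose t := ex_minn ex; exists (pos (raw E) t).
  rewrite codeE; apply: (computes_comp1 _ (cF (raw E, t))).
  apply: computes_comp2 (cC _ _); first exact: computes_proj.
  have cT k : computes (RComp G [:: RComp C [:: RProj 1; RProj 0]])
      [:: k; enc (raw E)] (~~ (pos (raw E) k || neg (raw E) k)).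
    apply: computes_comp1 (cG (raw E, k)).
    by apply: computes_comp2 (cC _ _); apply: computes_proj.
  apply: (@computes_mu _ _ _ (fun=> 0)) => [k ltk|].
    have := cT k; suff -> : pos (raw E) k || neg (raw E) k = false by [].
    apply: contraTF ltk => hk; rewrite /t; case: ex_minnP => n _ /(_ k hk).
    by rewrite -leqNgt.
  have := cT t; suff -> : pos (raw E) t || neg (raw E) t by [].
  by rewrite /t; case: ex_minnP.
split=> [/(posP _ _ DE) //|PE].
have : pos (raw E) t || neg (raw E) t by rewrite /t; case: ex_minnP.
by case/orP=> // /(negP _ _ DE).
Qed.

(** * Straight-line evaluation of words in the standard generators *)

(* The letter 2i stands for the i-th generator and 2i+1 for its inverse;
   generator 0 is the shift, generator i+1 is the i-th generator of A at the
   origin, and letters beyond the generators of A are blanks. *)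
Definition inv_letter l := if odd l then l.-1 else l.+1.
Definition inv_letters (U : seq nat) := rev (map inv_letter U).

Definition signed_entry (tbl : seq (seq nat)) (i b : nat) :=
  if b == 0 then nth [::] tbl i else inv_letters (nth [::] tbl i).

Definition subst_cf tbl (w : seq (seq nat)) :=
  flatten (map (fun l => signed_entry tbl (nth 0 l 0) (nth 0 l 1)) w).

Definition subst_eqn tbl cst (w : seq (seq nat)) :=
  flatten (map (fun l => signed_entry (if nth 0 l 0 == 0 then tbl else cst)
    (nth 0 l 1) (nth 0 l 2)) w).

Definition eqmod m a b := a %% m == b %% m.

(** Integers are differences of naturals: [s.1] is the current position and [s.2] the coefficient of
    the i-th generator of A collected at positions divisible by m. A run started at c gives the lamp
    total of the residue class of c. *)
Definition count_step (m i : nat) (s : (nat * nat) * (nat * nat)) (l : nat) :=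
  if l == 0 then ((s.1.1.+1, s.1.2), s.2)
  else if l == 1 then ((s.1.1, s.1.2.+1), s.2)
  else if eqmod m s.1.1 s.1.2 then
    if l == i + i + 2 then (s.1, (s.2.1.+1, s.2.2))
    else if l == i + i + 3 then (s.1, (s.2.1, s.2.2.+1)) else s
  else s.

Definition count_run m i U c1 c2 := foldl (count_step m i) ((c1, c2), (0, 0)) U.

(* Used for m = 0 or m a multiple of d, when Z/d modulo m is Z/d unless d = 0. *)
Definition coef_ok m i d U c1 c2 :=
  let s := count_run m i U c1 c2 in
  eqmod (if d == 0 then m else d) s.2.1 s.2.2.

Definition shift_ok m U :=
  let s := count_run m 0 U 0 0 in eqmod m s.1.1 s.1.2.

(** Each letter moves by at most one place, so only residue classes of integers of absolute value at
    most [size U] can carry lamps; both signs of p are tested. *)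
Definition trivial_mod (ds : seq nat) m U :=
  shift_ok m U && all (fun i => all (fun p =>
    coef_ok m i (nth 0 ds i) U p 0 && coef_ok m i (nth 0 ds i) U 0 p)
    (iota 0 (size U).+1)) (iota 0 (size ds)).

Definition tuples (X : Type) (s : seq X) n : seq (seq X) :=
  nat_rect (fun=> seq (seq X)) [:: [::]]
    (fun _ acc => flatten (map (fun z => map (cons z) acc) s)) n.

(** Here t codes a table of words, one per variable, and modulus 0 makes the test exact. *)
Definition eqn_pos cst ds (E : nat * seq (seq nat)) t :=
  trivial_mod ds 0 (subst_eqn (map CodeSeq.decode (CodeSeq.decode t)) cst E.2).

(** A sweep over m positions, each with less than m copies of each of r generators and one shift,
    followed by less than m further shifts. *)
Definition word_bound r m := m * (r * m + 1) + m.

(** The alphabet consists of the shift, the generators of A and one blank, each with its inverse.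
    The blank allows all words to have the same length. *)
Definition eqn_neg cst ds e (E : nat * seq (seq nat)) t :=
  let m := e * t.+1 in
  all (fun tbl => ~~ trivial_mod ds m (subst_eqn tbl cst E.2))
    (tuples (tuples (iota 0 (size ds).+2.*2) (word_bound (size ds) m)) E.1).

(** With an empty list of orders [trivial_mod] sees only the shift, so a word here merely represents
    an integer and the system is tested in Z/m. *)
Definition cf_sol m (E : nat * seq (seq (seq nat))) tbl :=
  all (fun w => trivial_mod [::] m (subst_cf tbl w)) E.2
  && has (fun i => ~~ trivial_mod [::] m (nth [::] tbl i)) (iota 0 E.1).

Definition cf_pos ds (E : nat * seq (seq (seq nat))) t :=
  has (fun m => cf_sol m E (map CodeSeq.decode (CodeSeq.decode t))) (0 :: ds).

(** The modulus t + 2 refutes solvability over Z, which also covers the entries 0 of [ds]. The four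
    letters are the shift, a blank and their inverses; words of length m reach every residue. *)
Definition cf_neg ds (E : nat * seq (seq (seq nat))) t :=
  all (fun m => (m == 0) || all (fun tbl => ~~ cf_sol m E tbl)
    (tuples (tuples (iota 0 4) m) E.1)) (t.+2 :: ds).

(** * Computability of the test programs *)

Section Programs.

Context {X : Type} {eX : encoded X}.

Lemma computable_inv_letters (U : X -> seq nat) :
  computable U -> computable (fun x => inv_letters (U x)).
Proof.
move=> cU; apply: computable_rev; apply: computable_map => //.
by rewrite /inv_letter; computable_tac.
Qed.

Lemma computable_signed_entry (tbl : X -> seq (seq nat)) (i b : X -> nat) :
  computable tbl -> computable i -> computable b ->
  computable (fun x => signed_entry (tbl x) (i x) (b x)).
Proof.
move=> ct ci cb; rewrite /signed_entry.
have cn := computable_nth [::] ct ci.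
apply: computable_if => //; last exact: computable_inv_letters.
exact: computable_eq0.
Qed.

Lemma computable_eqmod (m a b : X -> nat) :
  computable m -> computable a -> computable b ->
  computable (fun x => eqmod (m x) (a x) (b x)).
Proof. by move=> *; apply: computable_eqn; apply: computable_modn. Qed.

Lemma computable_count_run (m i : X -> nat) (U : X -> seq nat) (c1 c2 : X -> nat) :
  computable m -> computable i -> computable U -> computable c1 ->
  computable c2 ->
  computable (fun x => count_run (m x) (i x) (U x) (c1 x) (c2 x)).
Proof.
move=> cm ci cU cc1 cc2; apply: computable_foldl => //.
  by apply: computable_pair; [apply: computable_pair|computable_tac].
rewrite /count_step.
set Q := (X * (nat * nat * (nat * nat)) * nat)%type.
have cx (f : X -> nat) : computable f -> computable (fun q : Q => f q.1.1).
  by move=> cf; apply: computable_comp cf _; computable_tac.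
do 2 (apply: computable_if; [by computable_tac|by computable_tac|]).
apply: computable_if; last by computable_tac.
  rewrite /eqmod; apply: computable_eqn; apply: computable_modn;
    by [apply: cx|computable_tac].
have ci' := cx _ ci.
apply: computable_if; [|by computable_tac|apply: computable_if];
  by computable_tac.
Qed.

End Programs.

Section MorePrograms.

Context {X Y : Type} {eX : encoded X} {eY : encoded Y}.

Lemma computable_trivial_mod (ds : seq nat) (m : X -> nat) (U : X -> seq nat) :
  computable m -> computable U ->
  computable (fun x => trivial_mod ds (m x) (U x)).
Proof.
move=> cm cU; apply: computable_andb.
  have cr : computable (fun x => count_run (m x) 0 (U x) 0 0).
    by apply: computable_count_run => //; computable_tac.
  by rewrite /shift_ok; apply: computable_eqmod => //; computable_tac.
apply: computable_all; first by computable_tac.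
apply: computable_all.
  apply: computable_iota; apply: computable_succ; apply: computable_size.
  by apply: computable_comp cU _; computable_tac.
set Q := (X * nat * nat)%type.
have cm' : computable (fun q : Q => m q.1.1).
  by apply: computable_comp cm _; computable_tac.
have cU' : computable (fun q : Q => U q.1.1).
  by apply: computable_comp cU _; computable_tac.
have ok (c1 c2 : Q -> nat) : computable c1 -> computable c2 ->
    computable (fun q : Q => coef_ok (m q.1.1) q.1.2 (nth 0 ds q.1.2) (U q.1.1)
      (c1 q) (c2 q)).
  move=> cc1 cc2; rewrite /coef_ok.
  have cr : computable (fun q : Q => count_run (m q.1.1) q.1.2 (U q.1.1) (c1 q) (c2 q)).
    by apply: computable_count_run => //; computable_tac.
  apply: computable_eqmod; [|by computable_tac..].
  by apply: computable_if => //; computable_tac.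
by apply: computable_andb; apply: ok; computable_tac.
Qed.

Lemma computable_tuples (s : X -> seq Y) (n : X -> nat) :
  computable s -> computable n -> computable (fun x => tuples (s x) (n x)).
Proof.
move=> cs cn; apply: computable_nat_rect => //; first by computable_tac.
apply: computable_flatten; apply: computable_map.
  by apply: computable_comp cs _; computable_tac.
by apply: computable_map; computable_tac.
Qed.

Lemma computable_subst_cf (tbl w : X -> seq (seq nat)) :
  computable tbl -> computable w -> computable (fun x => subst_cf (tbl x) (w x)).
Proof.
move=> ct cw; apply: computable_flatten; apply: computable_map => //.
apply: computable_signed_entry; [|by computable_tac..].
by apply: computable_comp ct _; computable_tac.
Qed.

Lemma computable_subst_eqn cst (tbl w : X -> seq (seq nat)) :
  computable tbl -> computable w ->
  computable (fun x => subst_eqn (tbl x) cst (w x)).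
Proof.
move=> ct cw; apply: computable_flatten; apply: computable_map => //.
apply: computable_signed_entry; [|by computable_tac..].
apply: computable_if; [by computable_tac| |by computable_tac].
by apply: computable_comp ct _; computable_tac.
Qed.

End MorePrograms.

Lemma computable_cf_sol (X : Type) (eX : encoded X) (m : X -> nat) (E : X -> nat * seq (seq (seq nat)))
    (tbl : X -> seq (seq nat)) :
  computable m -> computable E -> computable tbl ->
  computable (fun x => cf_sol (m x) (E x) (tbl x)).
Proof.
move=> cm cE ct; apply: computable_andb.
  apply: computable_all; first by computable_tac.
  apply: computable_trivial_mod.
    by apply: computable_comp cm _; computable_tac.
  apply: computable_subst_cf; last by computable_tac.
  by apply: computable_comp ct _; computable_tac.
apply: computable_has; first by computable_tac.
apply: computable_negb; apply: computable_trivial_mod.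
  by apply: computable_comp cm _; computable_tac.
apply: computable_nth; last by computable_tac.
by apply: computable_comp ct _; computable_tac.
Qed.

Lemma computable_decode_table (X : Type) (eX : encoded X) (t : X -> nat) :
  computable t ->
  computable (fun x => map CodeSeq.decode (CodeSeq.decode (t x))).
Proof.
move=> ct; apply: (computable_map (g := fun _ => CodeSeq.decode)).
  exact: computable_decode.
exact: computable_decode (computable_snd computable_id).
Qed.

Lemma computable_eqn_pos cst ds :
  computable (fun p : (nat * seq (seq nat)) * nat => eqn_pos cst ds p.1 p.2).
Proof.
apply: computable_trivial_mod; first by computable_tac.
apply: computable_subst_eqn; last by computable_tac.
by apply: computable_decode_table; computable_tac.
Qed.

Lemma computable_eqn_neg cst ds e :
  computable (fun p : (nat * seq (seq nat)) * nat => eqn_neg cst ds e p.1 p.2).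
Proof.
apply: computable_all.
  apply: computable_tuples; last by computable_tac.
  apply: computable_tuples; first by computable_tac.
  by rewrite /word_bound; computable_tac.
apply: computable_negb; apply: computable_trivial_mod; first by computable_tac.
by apply: computable_subst_eqn; computable_tac.
Qed.

Lemma computable_cf_pos ds :
  computable (fun p : (nat * seq (seq (seq nat))) * nat => cf_pos ds p.1 p.2).
Proof.
apply: computable_has; first by computable_tac.
apply: computable_cf_sol; [by computable_tac..|].
by apply: computable_decode_table; computable_tac.
Qed.

Lemma computable_cf_neg ds :
  computable (fun p : (nat * seq (seq (seq nat))) * nat => cf_neg ds p.1 p.2).
Proof.
apply: computable_all; first by computable_tac.
apply: computable_orb; first by computable_tac.
apply: computable_all.
  apply: computable_tuples; last by computable_tac.
  by apply: computable_tuples; computable_tac.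
by apply: computable_negb; apply: computable_cf_sol; computable_tac.
Qed.

(** * Finitely generated abelian groups *)

Section Abelian.

Local Open Scope ring_scope.

Definition subgroup (V : zmodType) (K : V -> Prop) :=
  K 0 /\ forall x y, K x -> K y -> K (x - y).

Lemma subgroupN (V : zmodType) (K : V -> Prop) x : subgroup K -> K x -> K (- x).
Proof. by move=> [K0 KB] Kx; rewrite -sub0r; apply: KB. Qed.

Lemma subgroupD (V : zmodType) (K : V -> Prop) x y :
  subgroup K -> K x -> K y -> K (x + y).
Proof. by move=> gK Kx /(subgroupN gK) Ky; rewrite -[y]opprK; apply: gK.2. Qed.

Lemma subgroupMz (V : zmodType) (K : V -> Prop) x (z : int) :
  subgroup K -> K x -> K (x *~ z).
Proof.
move=> gK Kx; have Kn n : K (x *+ n).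
  elim: n => [|n IH]; first exact: gK.1.
  by rewrite mulrS; apply: subgroupD.
case: z => n; first exact: Kn.
by rewrite NegzE mulrNz; apply: subgroupN => //; apply: (Kn n.+1).
Qed.

Lemma least_nat (P : nat -> Prop) n : P n ->
  exists2 m, P m & forall k, P k -> (m <= k)%N.
Proof.
elim/ltn_ind: n => n IH Pn.
have [[k [ltk Pk]]|none] := classic (exists k, (k < n)%N /\ P k).
  exact: IH Pk.
exists n => // k Pk; rewrite leqNgt; apply/negP => ltk.
by apply: none; exists k.
Qed.

Lemma subgroup_int (J : int -> Prop) : subgroup J ->
  exists d, J d /\ forall x, J x -> (d %| x)%Z.
Proof.
move=> gJ.
have [[x [Jx x0]]|none] := classic (exists x, J x /\ x != 0); last first.
  exists 0; split=> [|x Jx]; first exact: gJ.1.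
  rewrite dvd0z; apply/negP => /negP x0; apply: none; by exists x.
have Jabs y : J y -> J (`|y|%N%:Z).
  move=> Jy; rewrite abszE; case: (ger0P y) => _ //; exact: subgroupN.
have [|d [Jd d0] dmin] := @least_nat (fun n => J n%:Z /\ (0 < n)%N) `|x|%N.
  by split; [apply: Jabs|rewrite absz_gt0].
exists d; split=> // y Jy; apply/dvdz_mod0P.
have Jr : J (y %% d)%Z.
  rewrite /modz; apply: gJ.2 => //; rewrite mulrC -[_ * _]mulrzz.
  exact: subgroupMz.
have r0 : 0 <= (y %% d)%Z by rewrite modz_ge0 // lt0n_neq0.
have rd : (y %% d)%Z < d by rewrite ltz_pmod.
case E : (y %% d)%Z Jr r0 rd => [r|//] Jr _ rd.
case: r E Jr rd => // r E Jr rd.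
by have := dmin r.+1 (conj Jr isT); rewrite leqNgt -ltz_nat rd.
Qed.

(** The first coordinates of K form some dZ, and the vectors of K with first coordinate 0 are
    handled by induction; a vector of K over d is added as a new top row. *)
Lemma subgroup_rV_int m (K : 'rV[int]_m -> Prop) : subgroup K ->
  exists M : 'M[int]_m, forall c, K c <-> exists u, c = u *m M.
Proof.
elim: m K => [|m IH]; last rewrite -[m.+1]/(1 + m)%N; move=> K gK.
  exists 0 => c; split=> _; first by exists 0; apply/matrixP => ? [].
  by rewrite (_ : c = 0); [exact: gK.1|apply/matrixP => ? []].
have [|M' HM'] := IH (fun c' => K (row_mx (0 : 'rV_1) c')).
  split; first by rewrite row_mx0; apply: gK.1.
  move=> x y Kx Ky; have := gK.2 _ _ Kx Ky.
  by rewrite opp_row_mx add_row_mx subr0.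
have [|d [[c0 Kd] dvd]] := @subgroup_int (fun x => exists c', K (row_mx (x%:M : 'rV_1) c')).
  split; first by exists 0; rewrite raddf0 row_mx0; apply: gK.1.
  move=> x y [c1 K1] [c2 K2]; exists (c1 - c2).
  by have := gK.2 _ _ K1 K2; rewrite opp_row_mx add_row_mx raddfB.
exists (col_mx (row_mx (d%:M : 'rV_1) c0) (row_mx (0 : 'M_(m, 1)) M')) => c.
have KZ x z : K x -> K (z *: x).
  move=> Kx; have := subgroupMz z gK Kx.
  by rewrite -scaler_int intz.
split.
  rewrite -[c](@hsubmxK _ 1 1 m); set x := lsubmx _; set c' := rsubmx _.
  rewrite [x]mx11_scalar; move: (x 0 0) => {}x Kc.
  have /dvdzP[q Eq] : (d %| x)%Z by apply: dvd; exists c'.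
  have /HM'[u Eu] : K (row_mx 0 (c' - q *: c0)).
    have := gK.2 _ _ Kc (KZ _ q Kd).
    by rewrite scale_row_mx opp_row_mx add_row_mx scale_scalar_mx -Eq subrr.
  exists (row_mx (q%:M : 'rV_1) u).
  rewrite mul_row_col !mul_mx_row mulmx0 -Eu add_row_mx addr0.
  by rewrite !mul_scalar_mx scale_scalar_mx -Eq addrC subrK.
move=> [u ->]; rewrite -[u](@hsubmxK _ 1 1 m) mul_row_col.
apply: subgroupD => //.
  by rewrite [lsubmx _]mx11_scalar mul_scalar_mx; apply: KZ.
by rewrite mul_mx_row mulmx0; apply/HM'; exists (rsubmx (u : 'rV_(1 + m))).
Qed.

Variable A : zmodType.

Definition comb (a : nat -> A) (r : nat) (c : nat -> int) := \sum_(i < r) a i *~ c i.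

(* A is the direct sum of the cyclic groups Z/d, d in [ds], generated by the
   [a i]; here Z/0 = Z. *)
Definition diagonal (ds : seq nat) (a : nat -> A) :=
  (forall x, exists c, x = comb a (size ds) c) /\
  (forall c, comb a (size ds) c = 0 <->
    forall i, (i < size ds)%N -> ((nth 0%N ds i)%:Z %| c i)%Z).

(** The Smith normal form L D R of the relation matrix: R changes the generators, L the relations,
    and D leaves one relation for each new generator. *)
Lemma fg_abelian_diagonal : fg_abelian A -> exists ds a, diagonal ds a.
Proof.
move=> [m [a gen]].
pose ev (c : 'rV[int]_m) := \sum_(i < m) a i *~ c 0 i.
have [|M HM] := @subgroup_rV_int m (fun c => ev c = 0).
  split; first by rewrite /ev big1 // => i _; rewrite mxE mulr0z.
  move=> x y x0 y0; rewrite -[RHS]subr0 -{1}x0 -y0 /ev -sumrB.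
  by apply: eq_bigr => i _; rewrite !mxE mulrzBr.
have [L uL [R uR [d _ EM]]] := int_Smith_normal_form M.
set D := (X in L *m X) in EM.
pose ord_fun (f : 'I_m -> A) (i : nat) := if insub i is Some j then f j else 0.
pose b := ord_fun (fun i => \sum_(j < m) a j *~ R i j).
(* Entries beyond the end of [d] read as 0 and stand for free summands. *)
pose ds := mkseq (fun i => absz (d`_i)) m.
pose row c : 'rV[int]_m := \row_i (c (val i)).
have combE c : comb b (size ds) c = ev (row c *m R).
  rewrite /comb size_mkseq /ev; under [RHS]eq_bigr => j _ do
    rewrite mxE mulrz_sumr.
  rewrite exchange_big; apply: eq_bigr => i _.
  rewrite /b /ord_fun valK mulrz_suml; apply: eq_bigr => j _.
  by rewrite mxE mulrC mulrzA.
exists ds, b; split.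
  move=> x; have [c ->] := gen x.
  pose e := (\row_i c i) *m invmx R.
  exists (fun i => if insub i is Some j then e 0 j else 0); rewrite combE.
  have -> : row (fun i => if insub i is Some j then e 0 j else 0) = e.
    by apply/rowP => i; rewrite mxE valK.
  by rewrite mulmxKV //; apply: eq_bigr => i _; rewrite mxE.
move=> c; rewrite combE HM size_mkseq.
have DE (u : 'rV[int]_m) i : (u *m D) 0 i = u 0 i * d`_i.
  rewrite mxE (bigD1 i) //= big1 ?addr0 => [|j /negPf ji]; rewrite !mxE.
    by rewrite eqxx.
  by rewrite -val_eqE in ji; rewrite ji mulr0.
split.
  move=> [u Eu] i lti; rewrite nth_mkseq // dvdzE /= -dvdzE.
  have : row c = (u *m L) *m D.
    by rewrite -[row c](mulmxK uR) Eu EM !mulmxA mulmxK.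
  by move/rowP/(_ (Ordinal lti)); rewrite DE mxE /= => ->; apply: dvdz_mull.
move=> h; have h' i : exists q, row c 0 i == q * d`_i.
  have := h i (ltn_ord i); rewrite nth_mkseq // dvdzE /= -dvdzE => /dvdzP[q Eq].
  by exists q; rewrite mxE Eq.
pose u : 'rV[int]_m := \row_i xchoose (h' i).
exists (u *m invmx L); rewrite EM !mulmxA mulmxKV //; congr (_ *m _).
by apply/rowP => i; rewrite DE [u 0 i]mxE; apply/eqP; apply: (xchooseP (h' i)).
Qed.

Lemma combB a r c c' : comb a r c - comb a r c' = comb a r (fun i => c i - c' i).
Proof. by rewrite /comb -sumrB; apply: eq_bigr => i _; rewrite mulrzBr. Qed.

Lemma combMn a r c m : comb a r c *+ m = comb a r (fun i => c i * m%:Z).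
Proof.
by rewrite /comb -sumrMnl; apply: eq_bigr => i _; rewrite mulrzA pmulrn.
Qed.

(** Since m kills every finite summand Z/d, the coordinate there must vanish modulo d; in a free
    summand it must be divisible by m. *)
Lemma comb_multiple ds a m c : diagonal ds a ->
  (forall d, d \in ds -> d != 0%N -> (d %| m)%N) ->
  (exists y, comb a (size ds) c = y *+ m) <->
  forall i, (i < size ds)%N ->
    ((if nth 0%N ds i == 0%N then m else nth 0%N ds i)%:Z %| c i)%Z.
Proof.
move=> [gen rel] dm; split.
  move=> [y /eqP]; have [e ->] := gen y.
  rewrite combMn -subr_eq0 combB => /eqP/rel h i lti.
  have := h i lti; case: eqP => [->|/eqP d0] hd.
    by move: hd; rewrite dvd0z subr_eq0 => /eqP ->; apply: dvdz_mull.
  have : ((nth 0%N ds i)%:Z %| e i * m%:Z)%Z.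
    by apply: dvdz_mull; rewrite dvdzE /=; apply: dm => //; apply: mem_nth.
  by move=> h'; rewrite -[c i](subrK (e i * m%:Z)); apply: rpredD.
move=> h.
exists (comb a (size ds) (fun i => if nth 0%N ds i == 0%N then (c i %/ m%:Z)%Z else 0)).
apply/eqP; rewrite combMn -subr_eq0 combB; apply/eqP/rel => i lti.
have := h i lti; case: eqP => [->|_]; last by rewrite mul0r subr0.
by move/divzK => ->; rewrite subrr.
Qed.

Lemma diagonal_residual ds a (x : A) : diagonal ds a ->
  (forall m, (0 < m)%N -> exists y, x = y *+ m) -> x = 0.
Proof.
move=> diag h; have [c Ec] := diag.1 x.
pose e := (\prod_(d <- ds | d != 0) d)%N.
have e0 : (0 < e)%N by rewrite prodn_cond_gt0 // => d; rewrite lt0n.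
rewrite Ec; apply/diag.2 => i lti.
(* Too large to divide a non-zero [c i]. The modulus used is e n, so that the orders of all finite
   summands divide it. *)
have [n n0 small] : exists2 n, (0 < n)%N & (`|c i| < n)%N by exists `|c i|.+1.
have := h (e * n)%N; rewrite muln_gt0 e0 n0 Ec => /(_ isT) hy.
have := (comb_multiple _ diag _).1 hy i lti.
case: eqP => [->|_] H; last first.
  apply: H => d dds d0; apply: dvdn_mulr; rewrite /e (big_rem d) //= d0.
  exact: dvdn_mulr.
rewrite dvd0z -absz_eq0; have {}H : (e * n %| `|c i|)%N.
  have := H; rewrite dvdzE /=; apply=> d dds d0; apply: dvdn_mulr.
  by rewrite /e (big_rem d) //= d0; apply: dvdn_mulr.
apply: contraTT small; rewrite -lt0n => c0; rewrite -leqNgt.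
by apply: leq_trans (dvdn_leq c0 H); rewrite leq_pmull.
Qed.

End Abelian.

(** * Normal forms of quadratic words *)

Section Words.

Context {H : groupType}.

Local Open Scope group_scope.

Lemma word_val_cons (L : Type) (f : L -> H) l w :
  word_val f (l :: w) = (if l.2 then (f l.1)^-1 else f l.1) * word_val f w.
Proof. by rewrite /word_val big_cons. Qed.

Lemma word_val_cat (L : Type) (f : L -> H) w w' :
  word_val f (w ++ w') = word_val f w * word_val f w'.
Proof. by rewrite /word_val big_cat. Qed.

Lemma word_val_nil (L : Type) (f : L -> H) : word_val f [::] = 1.
Proof. by rewrite /word_val big_nil. Qed.

Definition inv_word (L : Type) (w : word L) : word L :=
  rev (map (fun l => (l.1, ~~ l.2)) w).

Lemma word_val_inv (L : Type) (f : L -> H) w :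
  word_val f (inv_word w) = (word_val f w)^-1.
Proof.
elim: w => [|l w IH]; first by rewrite word_val_nil invg1.
rewrite /inv_word /= rev_cons -cats1 word_val_cat IH !word_val_cons.
by rewrite word_val_nil mulg1 invgM /=; case: l.2; rewrite //= invgK.
Qed.

End Words.

Lemma count_split (T : Type) (p : pred T) (w : seq T) m :
  count p w = m.+1 -> exists a l b,
  [/\ w = a ++ l :: b, p l, count p a = 0 & count p b = m].
Proof.
elim: w => //= l w IH; case pl: (p l) => /=.
  by move=> [cw]; exists [::], l, w.
rewrite add0n => /IH[a [l' [b [-> pl' ca cb]]]]; exists (l :: a), l', b.
by rewrite /= pl.
Qed.

Inductive atom (H : Type) := Commutator | Square | Class of H.
Arguments Commutator {H}.
Arguments Square {H}.

Section NormalForm.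

Context {H : groupType}.
Local Open Scope group_scope.

Definition atom_set (a : atom H) (v : H) : Prop :=
  match a with
  | Commutator => exists x y, v = x * y * x^-1 * y^-1
  | Square => exists x, v = x * x
  | Class c => exists x, v = x^-1 * c * x
  end.

Fixpoint atoms_set (l : seq (atom H)) (v : H) : Prop :=
  match l with
  | [::] => v = 1
  | a :: l' => exists p q, [/\ atom_set a p, atoms_set l' q & v = p * q]
  end.

Ltac group_nf := rewrite ?(invgM, invgK, invg1, mulgA, mulgK, mulgVK, mulVg, mulgV, mul1g, mulg1).

Lemma atom_set_conj a v g : atom_set a v -> atom_set a (g^-1 * v * g).
Proof.
case: a => [|| c] /= [x].
- by case=> y ->; exists (g^-1 * x * g), (g^-1 * y * g); group_nf.
- by move=> ->; exists (g^-1 * x * g); group_nf.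
- by move=> ->; exists (x * g); group_nf.
Qed.

Lemma atoms_set_cat l1 l2 v :
  atoms_set (l1 ++ l2) v <->
  exists p q, [/\ atoms_set l1 p, atoms_set l2 q & v = p * q].
Proof.
elim: l1 v => [|a l IH] v /=.
  split=> [hv|[p [q [-> h ->]]]]; last by rewrite mul1g.
  by exists 1, v; rewrite mul1g.
split.
  move=> [p [q [ap /IH[q1 [q2 [h1 h2 ->]]] ->]]].
  by exists (p * q1), q2; split=> //; [exists p, q1|rewrite mulgA].
move=> [_ [q2 [[p [q1 [ap h1 ->]]] h2 ->]]].
exists p, (q1 * q2); split=> //; last by rewrite mulgA.
by apply/IH; exists q1, q2.
Qed.

Context {n k : nat} (s : 'I_k -> H).

Implicit Types (w a b c : word ('I_n + 'I_k)) (x y : 'I_n -> H).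

Definition wval x w := word_val (assignment x s) w.

Definition occ (i : 'I_n) w := count (fun l => l.1 == inl i) w.

(** Closing the values under conjugation allows cyclic rotation of the word, and does not affect
    whether 1 is a value. *)
Definition values w v := exists x g, v = g^-1 * wval x w * g.

Definition quadratic_word w := forall i, (occ i w == 0)%N || (occ i w == 2)%N.

Lemma wval_agree x y w :
  (forall i, occ i w != 0%N -> x i = y i) -> wval x w = wval y w.
Proof.
elim: w => [|[[i|j] e] w IH] h; first by rewrite /wval !word_val_nil.
  rewrite /wval !word_val_cons /= (h i) ?/occ /= ?eqxx //; congr (_ * _).
  by apply: IH => i' h'; apply: h; rewrite /occ /= -lt0n ltn_addl ?lt0n.
rewrite /wval !word_val_cons /=; congr (_ * _).
by apply: IH => i' h'; apply: h; rewrite /occ /= -lt0n ltn_addl ?lt0n.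
Qed.

Lemma set_letter x i (e : bool) (X : H) : exists y,
  (if e then (y i)^-1 else y i) = X /\ forall j, j != i -> y j = x j.
Proof.
exists (fun j => if j == i then if e then X^-1 else X else x j).
by rewrite eqxx; split=> [|j /negPf->] //; case: e; rewrite ?invgK.
Qed.

Lemma wval_agree_off x y i w :
  occ i w = 0%N -> (forall j, j != i -> y j = x j) -> wval y w = wval x w.
Proof.
move=> oi h; apply: wval_agree => j oj; apply: h.
by apply: contraNneq oj => ->; rewrite oi.
Qed.

Lemma wval_cat x w w' : wval x (w ++ w') = wval x w * wval x w'.
Proof. exact: word_val_cat. Qed.

Lemma wval_inv x w : wval x (inv_word w) = (wval x w)^-1.
Proof. exact: word_val_inv. Qed.

Lemma wval_var x i e w :
  wval x ((inl i, e) :: w) = (if e then (x i)^-1 else x i) * wval x w.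
Proof. exact: word_val_cons. Qed.

Lemma occ_inv i w : occ i (inv_word w) = occ i w.
Proof. by rewrite /occ /inv_word count_rev count_map. Qed.

Lemma occ_cat i w w' : occ i (w ++ w') = (occ i w + occ i w')%N.
Proof. exact: count_cat. Qed.

Lemma occ_cons i l w : occ i (l :: w) = ((l.1 == inl i) + occ i w)%N.
Proof. by []. Qed.

(** Up to conjugation a X b X c is X b X c a, which equals (X b)(X b) b^-1 c a; as X is free, so is
    X b. *)
Lemma values_square a b c i e v :
  occ i a = 0%N -> occ i b = 0%N -> occ i c = 0%N ->
  values (a ++ (inl i, e) :: b ++ (inl i, e) :: c) v <->
  exists p q, [/\ atom_set Square p, values (inv_word b ++ c ++ a) q & v = p * q].
Proof.
move=> oa ob oc; split.
  move=> [x [g ->]]; rewrite wval_cat wval_var wval_cat wval_var.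
  set X := (if e then _ else _); set h := (wval x a)^-1 * g.
  exists (h^-1 * (X * wval x b) * h * (h^-1 * (X * wval x b) * h)).
  exists (h^-1 * wval x (inv_word b ++ c ++ a) * h); split.
  - by exists (h^-1 * (X * wval x b) * h).
  - by exists x, h.
  by rewrite !wval_cat wval_inv /h; group_nf.
move=> [_ [_ [[p ->] [x [h ->]] ->]]].
have [y [yi yx]] := set_letter x i e (h * p * h^-1 * (wval x b)^-1).
exists y, (wval x a * h).
rewrite [in RHS]wval_cat [in RHS]wval_var [in RHS]wval_cat [in RHS]wval_var yi.
rewrite !(wval_agree_off _ yx) // !wval_cat wval_inv.
by group_nf.
Qed.

(** Up to conjugation the word is (X b X^-1)(c a). The two factors share no variable and X is free,
    so they can be conjugated independently. *)
Lemma values_split a b c i e v :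
  occ i a = 0%N -> occ i b = 0%N -> occ i c = 0%N ->
  (forall j, occ j b = 0%N \/ occ j (c ++ a) = 0%N) ->
  values (a ++ (inl i, e) :: b ++ (inl i, ~~ e) :: c) v <->
  exists p q, [/\ values b p, values (c ++ a) q & v = p * q].
Proof.
move=> oa ob oc disj.
have lett y : (if ~~ e then (y i)^-1 else y i) =
    (if e then (y i)^-1 else y i)^-1 by case: e; rewrite /= ?invgK.
split.
  move=> [x [g ->]]; rewrite wval_cat wval_var wval_cat wval_var lett.
  set X := (if e then _ else _); set h := (wval x a)^-1 * g.
  exists ((X^-1 * h)^-1 * wval x b * (X^-1 * h)), (h^-1 * wval x (c ++ a) * h).
  by split; [exists x, (X^-1 * h)|exists x, h|rewrite wval_cat /h; group_nf].
move=> [_ [_ [[x1 [g1 ->]] [x2 [h ->]] ->]]].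
pose x j := if occ j b == 0%N then x2 j else x1 j.
have xb : wval x b = wval x1 b.
  by apply: wval_agree => j; rewrite /x => /negPf->.
have xca : wval x (c ++ a) = wval x2 (c ++ a).
  apply: wval_agree => j oj; rewrite /x; case: (disj j) oj => -> //.
have [y [yi yx]] := set_letter x i e (h * g1^-1).
exists y, (wval x a * h).
rewrite [in RHS]wval_cat [in RHS]wval_var [in RHS]wval_cat [in RHS]wval_var lett yi.
rewrite !(wval_agree_off _ yx) // -xb -xca wval_cat.
by group_nf.
Qed.

(** For interleaved pairs put m = u1 v2 v1, x = m^-1 X v1 and y = Y v2 v1. Then u2 m [x, y] = u2 X
    v1 Y v2 X^-1 u1 Y^-1, a conjugate of the given word. The variables X, Y and x, y determine each
    other. *)
Lemma values_commutator a b c i e v1 v2 u1 u2 j d v :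
  i != j -> b = v1 ++ (inl j, d) :: v2 -> c ++ a = u1 ++ (inl j, ~~ d) :: u2 ->
  occ i a = 0%N -> occ i b = 0%N -> occ i c = 0%N ->
  occ j v1 = 0%N -> occ j v2 = 0%N -> occ j u1 = 0%N -> occ j u2 = 0%N ->
  values (a ++ (inl i, e) :: b ++ (inl i, ~~ e) :: c) v <->
  exists p q, [/\ values (u2 ++ u1 ++ v2 ++ v1) p, atom_set Commutator q & v = p * q].
Proof.
move=> ij Eb Eca oa ob oc ov1 ov2 ou1 ou2.
have lett (f : bool) (z : H) : (if ~~ f then z^-1 else z) =
    (if f then z^-1 else z)^-1 by case: f; rewrite /= ?invgK.
have rot x g : g^-1 * wval x (a ++ (inl i, e) :: b ++ (inl i, ~~ e) :: c) * g =
    ((wval x a)^-1 * g)^-1 * ((if e then (x i)^-1 else x i) * wval x b *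
     (if e then (x i)^-1 else x i)^-1 * wval x (c ++ a)) * ((wval x a)^-1 * g).
  by rewrite !wval_cat !wval_var wval_cat wval_var lett; group_nf.
split.
  move=> [x [g ->]]; rewrite rot Eb Eca !wval_cat !wval_var lett.
  set X := (if e then _ else _); set Y := (if d then _ else _).
  set h := (wval x a)^-1 * g; set m := wval x u1 * wval x v2 * wval x v1.
  set h2 := wval x u2 * h.
  pose x1 := m^-1 * X * wval x v1; pose y1 := Y * wval x v2 * wval x v1.
  exists (h2^-1 * wval x (u2 ++ u1 ++ v2 ++ v1) * h2).
  exists (h2^-1 * (x1 * y1 * x1^-1 * y1^-1) * h2); split.
  - by exists x, h2.
  - by apply: (@atom_set_conj Commutator); exists x1, y1.
  by rewrite !wval_cat /x1 /y1 /h2 /m; group_nf.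
move=> [_ [_ [[x [h2 ->]] [x0 [y0 ->]] ->]]].
set m := wval x u1 * wval x v2 * wval x v1.
pose x1 := h2 * x0 * h2^-1; pose y1 := h2 * y0 * h2^-1.
have [y [yi yx]] := set_letter x i e (m * x1 * (wval x v1)^-1).
have [z [zj zy]] := set_letter y j d (y1 * (wval x v2 * wval x v1)^-1).
have oi w : (occ i w <= occ i (b ++ c ++ a))%N -> occ i w = 0%N.
  by rewrite !occ_cat oa ob oc; case: occ.
have zx w : occ j w = 0%N -> (occ i w <= occ i (b ++ c ++ a))%N -> wval z w = wval x w.
  by move=> oj /oi o; rewrite (wval_agree_off oj zy) (wval_agree_off o yx).
exists z, (wval z a * (wval x u2)^-1 * h2); rewrite rot Eb Eca !wval_cat !wval_var lett.
rewrite (zy i ij) yi zj (zx v1) // ?(zx v2) // ?(zx u1) // ?(zx u2) //;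
  first by rewrite /x1 /y1 /m; group_nf.
all: rewrite occ_cat Eca Eb !occ_cat !occ_cons; lia.
Qed.

(** Induction on the length, along the lines of the classification of surfaces: a variable with two
    equal signs splits off a square, an interleaved pair a commutator, a pair that interleaves with
    no other cuts the word in two, and a word without variables is a single class. *)
Lemma quadratic_normal_form w :
  quadratic_word w -> exists l, forall v, values w v <-> atoms_set l v.
Proof.
have [N] := ubnP (size w); elim: N w => // N IH w lew qw.
(* Once no letter occurs twice with the same sign, every remaining variable occurs once with each
   sign. *)
have [[i [e ci]]|noN] :=
    classic (exists i e, count (pred1 (inl i, e)) w = 2%N).
  have [a [l1 [w' [Ew /eqP E1 _ cw']]]] := count_split ci.
  have [b [l2 [c [Ew' /eqP E2 _ _]]]] := count_split cw'.
  subst l1 l2 w' w; have := qw i; rewrite !(occ_cat, occ_cons) /= eqxx => o.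
  have oa : occ i a = 0%N by lia.
  have ob : occ i b = 0%N by lia.
  have oc : occ i c = 0%N by lia.
  have [|j|l Hl] := IH (inv_word b ++ c ++ a).
  - move: lew; rewrite !size_cat /= size_cat /= /inv_word size_rev size_map; lia.
  - rewrite !occ_cat occ_inv; have [<-|ij] := eqVneq i j; first by rewrite oa ob oc.
    have := qw j; rewrite !(occ_cat, occ_cons) /=.
    rewrite -[inl i == inl j]/(i == j) (negPf ij); lia.
  exists (Square :: l) => v; rewrite (values_square _ _ oa ob oc) /=.
  by split=> -[p [q [h1 h2 ->]]]; exists p, q; split=> //; apply/Hl.
have [[i oi]|novar] := classic (exists i, occ i w <> 0%N); last first.
  exists [:: Class (wval (fun=> 1) w)] => v.
  have Ev x : wval x w = wval (fun=> 1) w.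
    by apply: wval_agree => i /eqP oi; case: novar; exists i.
  split=> [[x [g ->]]|[_ [_ [[x ->] -> ->]]]]; last first.
    by exists (fun=> 1), x; rewrite mulg1.
  by exists (g^-1 * wval x w * g), 1; split=> //; rewrite ?mulg1 // Ev; exists g.
have {}oi : occ i w = 2%N by have := qw i; lia.
have [a [[l1 e] [w' [Ew /eqP/= E1 oa ow']]]] := count_split oi.
have [b [[l2 e'] [c [Ew' /eqP/= E2 ob oc]]]] := count_split ow'.
subst l1 l2.
have Ee : e' = ~~ e.
  have [Ee|] := eqVneq e' e; last by case: (e); case: (e').
  case: noN; exists i, e; rewrite Ew Ew' Ee count_cat /= count_cat /= eqxx.
  have z u : occ i u = 0%N -> count (pred1 (inl i, e)) u = 0%N.
    move=> ou; apply/eqP; rewrite -leqn0 -ou; apply: sub_count => l /eqP ->.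
    exact: eqxx.
  by rewrite !z.
subst w' w e'.
have qs j : i != j -> (occ j a + occ j b + occ j c == 0)%N || (occ j a + occ j b + occ j c == 2)%N.
  move=> ij; have := qw j; rewrite !(occ_cat, occ_cons) /=.
  by rewrite -[inl i == inl j]/(i == j) (negPf ij) !add0n !addnA.
move: lew; rewrite size_cat /= size_cat /= => lew.
(* Either some variable lies both inside and outside the pair of i, or the two sides are
   independent. *)
have [[j [jb jca]]|disj] :=
    classic (exists j, occ j b <> 0%N /\ occ j (c ++ a) <> 0%N); last first.
  have {}disj j : occ j b = 0%N \/ occ j (c ++ a) = 0%N.
    by case E: (occ j b); [left|right; apply: NNPP => h; case: disj; exists j; rewrite E].
  have [||lb Hb] := IH b.
  - lia.
  - move=> j; case: (eqVneq i j) => [<-|/qs]; first by rewrite /occ ob.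
    by case: (disj j); rewrite ?occ_cat; lia.
  have [||lc Hc] := IH (c ++ a).
  - rewrite size_cat; lia.
  - move=> j; case: (eqVneq i j) => [<-|/qs].
      by rewrite occ_cat /occ oa oc.
    by case: (disj j); rewrite ?occ_cat; lia.
  exists (lb ++ lc) => v; rewrite (values_split _ _ oa ob oc disj) atoms_set_cat.
  by split=> -[p [q [h1 h2 ->]]]; exists p, q; split=> //; (apply/Hb||apply/Hc).
have ij : i != j by apply: contra_notN jb => /eqP <-; apply: ob.
have [jb1 jca1] : occ j b = 1%N /\ occ j (c ++ a) = 1%N.
  by have := qs _ ij; move: jb jca; rewrite occ_cat; lia.
have [v1 [[l1 d] [v2 [Eb /eqP/= E1 ov1 ov2]]]] := count_split jb1.
have [u1 [[l2 d'] [u2 [Eca /eqP/= E2 ou1 ou2]]]] := count_split jca1.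
subst l1 l2.
have Ed : d' = ~~ d.
  have [Ed|] := eqVneq d' d; last by case: (d); case: (d').
  case: noN; exists j, d; have := qs _ ij.
  have le u : (count (pred1 (inl j, d)) u <= occ j u)%N.
    by apply: sub_count => l /eqP ->; apply: eqxx.
  have := le a; have := le b; have := le c.
  have : (0 < count (pred1 (inl j, d)) b)%N by rewrite Eb count_cat /= eqxx; lia.
  have : (0 < count (pred1 (inl j, d)) c + count (pred1 (inl j, d)) a)%N.
    by rewrite -count_cat Eca Ed count_cat /= eqxx; lia.
  rewrite count_cat /= count_cat /=.
  have -> : ((inl i, e) == (inl j, d) :> ('I_n + 'I_k) * bool) = false.
    by apply/negP => /eqP[ij' _]; rewrite ij' eqxx in ij.
  have -> : ((inl i, ~~ e) == (inl j, d) :> ('I_n + 'I_k) * bool) = false.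
    by apply/negP => /eqP[ij' _]; rewrite ij' eqxx in ij.
  move: jb1 jca1; rewrite occ_cat; lia.
subst d'.
have os l : occ l (u2 ++ u1 ++ v2 ++ v1) = (occ l a + occ l b + occ l c - (j == l).*2)%N.
  have : occ l (c ++ a) = (occ l u1 + (j == l) + occ l u2)%N.
    by rewrite Eca occ_cat occ_cons addnA.
  have : occ l b = (occ l v1 + (j == l) + occ l v2)%N.
    by rewrite Eb occ_cat occ_cons addnA.
  rewrite !occ_cat; lia.
have [||l Hl] := IH (u2 ++ u1 ++ v2 ++ v1).
- have := congr1 size Eca; have := congr1 size Eb; rewrite !size_cat /=; lia.
- move=> l; rewrite os; have [<-|jl] := eqVneq j l.
    by have := qs _ ij; lia.
  have [<-|/qs] := eqVneq i l; last by rewrite subn0.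
  by rewrite /occ oa ob oc.
exists (l ++ [:: Commutator]) => v.
rewrite (values_commutator _ _ ij Eb Eca oa ob oc ov1 ov2 ou1 ou2) atoms_set_cat.
split=> -[p [q [h1 h2 ->]]]; exists p, q; split=> //; try by apply/Hl.
  by exists q, 1; rewrite mulg1.
by case: h2 => p' [q' [h -> ->]]; rewrite mulg1.
Qed.

End NormalForm.

(** * Lamp configurations as a module over Laurent polynomials *)

Notation lampsType A := {fsfun int -> A with 0%R}.

Section LampsZmodule.

Local Open Scope ring_scope.

Variable A : zmodType.
Implicit Types f g : lampsType A.

(** Configurations are the group elements of shift 0; borrowing the group operations provides the
    finite supports. *)
Definition lamps_add f g : lampsType A :=
  lamps (wreathZ_mul (WreathZ f 0) (WreathZ g 0)).
Definition lamps_opp f : lampsType A := lamps (wreathZ_inv (WreathZ f 0)).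

Lemma lamps_addE f g n : lamps_add f g n = f n + g n.
Proof. by rewrite wreathZ_mulE /= addr0. Qed.

Lemma lamps_oppE f n : lamps_opp f n = - f n.
Proof. by rewrite wreathZ_invE /= subr0. Qed.

Lemma lamps_addA : associative lamps_add.
Proof. by move=> f g h; apply/fsfunP => n; rewrite !lamps_addE addrA. Qed.

Lemma lamps_addC : commutative lamps_add.
Proof. by move=> f g; apply/fsfunP => n; rewrite !lamps_addE addrC. Qed.

Lemma lamps_add0 : left_id ([fsfun] : lampsType A) lamps_add.
Proof. by move=> f; apply/fsfunP => n; rewrite !lamps_addE fsfun0E add0r. Qed.

Lemma lamps_addN : left_inverse ([fsfun] : lampsType A) lamps_opp lamps_add.
Proof.
by move=> f; apply/fsfunP => n; rewrite lamps_addE lamps_oppE fsfun0E addNr.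
Qed.

HB.instance Definition _ := GRing.isZmodule.Build (lampsType A)
  lamps_addA lamps_addC lamps_add0 lamps_addN.

End LampsZmodule.

Section Lamps.

Local Open Scope ring_scope.

Variable A : zmodType.
Implicit Types f g : lampsType A.

Lemma lampsD f g n : (f + g) n = f n + g n. Proof. exact: lamps_addE. Qed.
Lemma lampsN f n : (- f) n = - f n. Proof. exact: lamps_oppE. Qed.
Lemma lampsB f g n : (f - g) n = f n - g n. Proof. by rewrite lampsD lampsN. Qed.
Lemma lamps0 n : (0 : lampsType A) n = 0. Proof. exact: fsfun0E. Qed.
Definition translate (k : int) f : lampsType A :=
  lamps (wreathZ_mul (WreathZ [fsfun] k) (WreathZ f 0)).

Lemma translateE k f n : translate k f n = f (n + k).
Proof. by rewrite wreathZ_mulE /= fsfun0E add0r. Qed.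



Lemma translateD k f g : translate k (f + g) = translate k f + translate k g.
Proof. by apply/fsfunP => n; rewrite !(lampsD, translateE). Qed.

Lemma translateN k f : translate k (- f) = - translate k f.
Proof. by apply/fsfunP => n; rewrite !(lampsN, translateE). Qed.

Lemma translateB k f g : translate k (f - g) = translate k f - translate k g.
Proof. by rewrite translateD translateN. Qed.

Lemma translate0 k : translate k 0 = 0.
Proof. by apply/fsfunP => n; rewrite translateE !lamps0. Qed.

Lemma translate_id f : translate 0 f = f.
Proof. by apply/fsfunP => n; rewrite translateE addr0. Qed.

Lemma translateT j k f : translate j (translate k f) = translate (j + k) f.
Proof. by apply/fsfunP => n; rewrite !translateE addrA. Qed.

Definition delta (n : int) (a : A) : lampsType A := [fsfun x in [fset n]%fset => a].

Lemma deltaE n a x : delta n a x = if x == n then a else 0.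
Proof. by rewrite fsfun_fun in_fset1. Qed.

Lemma deltaD n a b : delta n (a + b) = delta n a + delta n b.
Proof. by apply/fsfunP => x; rewrite lampsD !deltaE; case: eqP; rewrite ?addr0. Qed.

Lemma delta0 n : delta n 0 = 0.
Proof. by apply/fsfunP => x; rewrite lamps0 deltaE if_same. Qed.

Lemma deltaN n a : delta n (- a) = - delta n a.
Proof. by apply/eqP; rewrite -addr_eq0 -deltaD addNr delta0. Qed.

Lemma translate_delta k n a : translate k (delta n a) = delta (n - k) a.
Proof.
by apply/fsfunP => x; rewrite translateE !deltaE [x == _]eq_sym subr_eq eq_sym.
Qed.

Lemma lamps_ind (P : lampsType A -> Prop) :
  P 0 -> (forall f n a, P f -> P (f + delta n a)) -> forall f, P f.
Proof.
move=> P0 PD f; have [N] := ubnP #|` finsupp f|.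
elim: N f => // N IH f; have [E _|[n nf] ltN] := fset_0Vmem (finsupp f).
  rewrite (_ : f = 0) //; apply/fsfunP => n; rewrite lamps0.
  by apply: fsfun_dflt; rewrite E.
rewrite -(subrK (delta n (f n)) f); apply: PD; apply: IH.
suff sub : (finsupp (f - delta n (f n)) `<=` finsupp f `\ n)%fset.
  apply: leq_ltn_trans (fsubset_leq_card sub) _.
  by move: ltN; rewrite (cardfsD1 n) nf.
apply/fsubsetP => x; rewrite !in_fsetD1 !mem_finsupp lampsB deltaE.
by have [->|_] := eqVneq x n; rewrite ?subrr ?eqxx // subr0.
Qed.

(** * Weighted sums of lamps over residue classes *)

Definition weigh (chi : int -> int) f : A := \sum_(n <- finsupp f) f n *~ chi n.

Lemma weigh_sub chi f (S : {fset int}) : (finsupp f `<=` S)%fset ->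
  weigh chi f = \sum_(n <- S) f n *~ chi n.
Proof.
move=> sub; apply: big_fset_incl => // n _ nf.
by rewrite (fsfun_dflt nf) mul0rz.
Qed.

Lemma weighD chi f g : weigh chi (f + g) = weigh chi f + weigh chi g.
Proof.
set S := (finsupp f `|` finsupp g)%fset.
rewrite (@weigh_sub _ _ S) ?(@weigh_sub _ f S) ?(@weigh_sub _ g S)
  ?fsubsetUl ?fsubsetUr //.
  by rewrite -big_split; apply: eq_bigr => n _; rewrite lampsD mulrzDl.
apply/fsubsetP => n; rewrite in_fsetU !mem_finsupp lampsD; apply: contraNT.
by rewrite negb_or !negbK => /andP[/eqP-> /eqP->]; rewrite addr0.
Qed.

Lemma weigh0 chi : weigh chi 0 = 0.
Proof. by apply: (addrI (weigh chi 0)); rewrite -weighD !addr0. Qed.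

Lemma weighN chi f : weigh chi (- f) = - weigh chi f.
Proof. by apply/eqP; rewrite -addr_eq0 -weighD addNr weigh0. Qed.

Lemma weighB chi f g : weigh chi (f - g) = weigh chi f - weigh chi g.
Proof. by rewrite weighD weighN. Qed.

Lemma weighMn chi f m : weigh chi (f *+ m) = weigh chi f *+ m.
Proof. by elim: m => [|m IH]; rewrite ?weigh0 // !mulrS weighD IH. Qed.

Lemma eq_weigh chi chi' f : chi =1 chi' -> weigh chi f = weigh chi' f.
Proof. by move=> E; apply: eq_bigr => n _; rewrite E. Qed.

Lemma weigh_delta chi n a : weigh chi (delta n a) = a *~ chi n.
Proof.
rewrite (@weigh_sub _ _ [fset n]%fset) ?big_seq_fset1 ?deltaE ?eqxx //.
by apply/fsubsetP => x; rewrite in_fset1 mem_finsupp deltaE; case: ifP; rewrite ?eqxx.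
Qed.

Lemma weigh_translate chi k f :
  weigh chi (translate k f) = weigh (fun n => chi (n - k)) f.
Proof.
elim/lamps_ind: f => [|f n a IH]; first by rewrite translate0 !weigh0.
by rewrite translateD !weighD IH translate_delta !weigh_delta.
Qed.

Lemma weigh_supp chi f : (forall n, f n != 0 -> chi n = 0) -> weigh chi f = 0.
Proof.
move=> h; rewrite /weigh big_seq big1 // => n; rewrite mem_finsupp => /h ->.
by rewrite mulr0z.
Qed.

(* Weights of the residue class of c modulo D, alternating along the class when
   b is set. For D = 0 the class is reduced to c. *)
Definition chi (D : nat) (b : bool) (c n : int) : int :=
  if (D%:Z %| n - c)%Z then if b && odd `|((n - c) %/ D%:Z)%Z|%N then -1 else 1
  else 0.

(** Coordinates of f modulo t^D - 1, or modulo t^D + 1 when b is set; for D = 0 these are the lamps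
    themselves. *)
Definition fold D b c f := weigh (chi D b c) f.

Lemma fold_translate D b c k f : fold D b c (translate k f) = fold D b (c + k) f.
Proof.
rewrite /fold weigh_translate; apply: eq_weigh => n.
by rewrite /chi (_ : n - k - c = n - (c + k)) // opprD addrAC addrA.
Qed.

Lemma fold_class m c c' f : (m%:Z %| c - c')%Z -> fold m false c f = fold m false c' f.
Proof.
move=> mc; apply: eq_weigh => n; rewrite /chi /=.
have -> : n - c' = n - c + (c - c') by rewrite addrA subrK.
by rewrite (rpredDr _ mc).
Qed.

Lemma fold0 b c f : fold 0 b c f = f c.
Proof.
elim/lamps_ind: f => [|f n a IH]; first by rewrite /fold weigh0 lamps0.
rewrite /fold weighD weigh_delta -/(fold _ _ _ _) IH lampsD deltaE /chi.
rewrite dvd0z subr_eq0 [c == n]eq_sym; case: eqP => [->|_]; last by rewrite mulr0z.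
by rewrite subrr divz0 andbF.
Qed.

Lemma foldD D b c f g : fold D b c (f + g) = fold D b c f + fold D b c g.
Proof. exact: weighD. Qed.
Lemma foldN D b c f : fold D b c (- f) = - fold D b c f.
Proof. exact: weighN. Qed.
Lemma foldB D b c f g : fold D b c (f - g) = fold D b c f - fold D b c g.
Proof. exact: weighB. Qed.
Lemma foldMn D b c f m : fold D b c (f *+ m) = fold D b c f *+ m.
Proof. exact: weighMn. Qed.

Lemma fold_delta m c n a :
  fold m false c (delta n a) = if (m%:Z %| n - c)%Z then a else 0.
Proof. by rewrite /fold weigh_delta /chi; case: ifP; rewrite ?mulr1z ?mulr0z. Qed.

(** * Congruence of group elements modulo m *)

Implicit Types x y z : wreathZ A.

Lemma lampsM x y : lamps (x * y)%g = lamps x + translate (shift x) (lamps y).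
Proof. by apply/fsfunP => n; rewrite wreathZ_mulE lampsD translateE. Qed.

Lemma lampsV x : lamps (x^-1)%g = - translate (- shift x) (lamps x).
Proof. by apply/fsfunP => n; rewrite wreathZ_invE lampsN translateE. Qed.

Lemma lamps1 : lamps (1 : wreathZ A)%g = 0. Proof. by []. Qed.
Lemma shiftM x y : shift (x * y)%g = shift x + shift y. Proof. by []. Qed.
Lemma shiftV x : shift (x^-1)%g = - shift x. Proof. by []. Qed.
Lemma shift1 : shift (1 : wreathZ A)%g = 0. Proof. by []. Qed.

Definition multiple (m : nat) (a : A) := exists b : A, a = b *+ m.

Lemma multiple0 m : multiple m 0. Proof. by exists 0; rewrite mul0rn. Qed.
Lemma multipleD m a b : multiple m a -> multiple m b -> multiple m (a + b).
Proof. by move=> [y ->] [z ->]; exists (y + z); rewrite mulrnDl. Qed.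
Lemma multipleN m a : multiple m a -> multiple m (- a).
Proof. by move=> [y ->]; exists (- y); rewrite mulNrn. Qed.
Lemma multipleB m a b : multiple m a -> multiple m b -> multiple m (a - b).
Proof. by move=> ha hb; apply: multipleD => //; apply: multipleN. Qed.

(* x and y have the same image in the wreath product of A/mA and Z/m; for m = 0
   this is equality. *)
Definition congruent m x y :=
  (m%:Z %| shift x - shift y)%Z /\
  forall c, multiple m (fold m false c (lamps x) - fold m false c (lamps y)).

Lemma congruent_refl m x : congruent m x x.
Proof. by split=> [|c]; rewrite subrr ?dvdz0 //; apply: multiple0. Qed.

Lemma congruentM m x x' y y' :
  congruent m x x' -> congruent m y y' -> congruent m (x * y)%g (x' * y')%g.
Proof.
move=> [s1 l1] [s2 l2]; split=> [|c].
  by rewrite !shiftM opprD addrACA rpredD.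
rewrite !lampsM !foldD !fold_translate opprD addrACA; apply: multipleD => //.
rewrite (@fold_class _ (c + shift x) (c + shift x')) //.
by rewrite opprD addrACA subrr add0r.
Qed.

Lemma congruentV m x y : congruent m x y -> congruent m (x^-1)%g (y^-1)%g.
Proof.
move=> [s l]; split=> [|c]; first by rewrite !shiftV -opprD rpredN.
rewrite !lampsV !foldN !fold_translate -opprD; apply: multipleN.
rewrite (@fold_class _ (c - shift x) (c - shift y)) //.
by rewrite opprB addrC addrA subrK -opprB rpredN.
Qed.

Lemma congruent0 x y : congruent 0 x y -> x = y.
Proof.
move=> [s l]; apply: wreathZ_eq => [n|].
  by have [z] := l n; rewrite !fold0 mulr0n => /eqP; rewrite subr_eq0 => /eqP.
by apply/eqP; rewrite -subr_eq0 -dvd0z.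
Qed.

Lemma congruent_word m (L : Type) (f g : L -> wreathZ A) w :
  (forall l, congruent m (f l) (g l)) -> congruent m (word_val f w) (word_val g w).
Proof.
move=> h; elim: w => [|[l e] w IH]; first by rewrite !word_val_nil; apply: congruent_refl.
by rewrite !word_val_cons; apply: congruentM => //=; case: e => //; apply: congruentV.
Qed.

End Lamps.

(** * Words in the standard generators and their evaluation *)

Section StandardGenerators.

Local Open Scope ring_scope.

Variables (A : zmodType) (a : nat -> A) (r : nat).

Definition generator (i : nat) : wreathZ A :=
  if i is j.+1 then
    if (j < r)%N then WreathZ (delta 0 (a j)) 0 else 1%g
  else WreathZ 0 1.

Definition letters_val (U : seq nat) : wreathZ A :=
  word_val generator (map (fun l => (l./2, odd l)) U).

Lemma letters_val_cat U V : letters_val (U ++ V) = (letters_val U * letters_val V)%g.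
Proof. by rewrite /letters_val map_cat word_val_cat. Qed.

Lemma letters_val_nil : letters_val [::] = 1%g.
Proof. exact: word_val_nil. Qed.

Lemma letters_val_cons l U : letters_val (l :: U) =
  ((if odd l then (generator l./2)^-1 else generator l./2) * letters_val U)%g.
Proof. exact: word_val_cons. Qed.

Lemma letters_val_inv U : letters_val (inv_letters U) = ((letters_val U)^-1)%g.
Proof.
rewrite /letters_val -word_val_inv /inv_letters /inv_word map_rev -!map_comp.
congr (word_val _ (rev _)); apply: eq_map => l /=; rewrite /inv_letter.
case ol: (odd l) => /=; last by rewrite ol uphalf_half ol.
by case: l ol => //= l; case ol: (odd l) => //= _; rewrite uphalf_half ol.
Qed.

Definition count_val m i U c1 c2 : int :=
  (count_run m i U c1 c2).2.1%:Z - (count_run m i U c1 c2).2.2%:Z.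

Lemma count_step_add m i s u v l :
  count_step m i (s, (u, v)) l =
  ((count_step m i (s, (0, 0)%N) l).1,
   ((u + (count_step m i (s, (0, 0)%N) l).2.1)%N,
    (v + (count_step m i (s, (0, 0)%N) l).2.2)%N)).
Proof.
rewrite /count_step; do !case: ifP => _; rewrite /= ?addn0 ?addn1 //.
Qed.

Lemma foldl_count_step m i s u v U :
  foldl (count_step m i) (s, (u, v)) U =
  ((foldl (count_step m i) (s, (0, 0)%N) U).1,
   ((u + (foldl (count_step m i) (s, (0, 0)%N) U).2.1)%N,
    (v + (foldl (count_step m i) (s, (0, 0)%N) U).2.2)%N)).
Proof.
elim: U s u v => [|l U IH] s u v /=; first by rewrite !addn0.
rewrite count_step_add; case: (count_step _ _ _ _) => [s' [u' v']] /=.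
by rewrite IH (IH s' u') /= !addnA.
Qed.

Lemma count_val_cons m i l U c1 c2 :
  let s := count_step m i ((c1, c2), (0, 0)%N) l in
  count_val m i (l :: U) c1 c2 =
  s.2.1%:Z - s.2.2%:Z + count_val m i U s.1.1 s.1.2.
Proof.
rewrite /count_val /count_run /=.
case: (count_step _ _ _ _) => [[d1 d2] [u v]] /=; rewrite foldl_count_step /=.
by rewrite !PoszD opprD addrACA.
Qed.

Lemma eqmod_dvdz m p q : eqmod m p q = (m%:Z %| p%:Z - q%:Z)%Z.
Proof. by rewrite /eqmod -eqz_mod_dvd !modz_nat. Qed.

(** The lamp of x y at c is that of x at c plus that of y at c + shift x, so a run started at c
    follows its class through the word from left to right. *)
Lemma fold_letters m U c1 c2 :
  fold m false (c1%:Z - c2%:Z) (lamps (letters_val U)) =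
  comb a r (fun i => count_val m i U c1 c2).
Proof.
elim: U c1 c2 => [|l U IH] c1 c2.
  by rewrite letters_val_nil lamps1 /fold weigh0 /comb big1.
rewrite letters_val_cons lampsM foldD fold_translate.
under [RHS]eq_bigr => i _ do rewrite count_val_cons.
set g := (if _ then _ else _).
have fg0 c : (l < 2)%N -> fold m false c (lamps g) = 0.
  rewrite /g; case: (l) => [|[|]] // _; first exact: weigh0.
  by rewrite [X in lamps X]/= lampsV foldN fold_translate /fold weigh0 oppr0.
case: l @g fg0 => [|[|l]] g fg0.
- rewrite fg0 // add0r (_ : c1%:Z - c2%:Z + shift g = c1.+1%:Z - c2%:Z); last by rewrite /g /=; lia.
  by rewrite IH; apply: eq_bigr => i _; rewrite subrr add0r.
- rewrite fg0 // add0r (_ : c1%:Z - c2%:Z + shift g = c1%:Z - c2.+1%:Z); last by rewrite /g /=; lia.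
  by rewrite IH; apply: eq_bigr => i _; rewrite subrr add0r.
move=> {fg0}.
have sg : shift g = 0 by rewrite /g /generator /=; do 2 case: ifP => _.
have fg c : fold m false c (lamps g) = if (l./2 < r)%N && (m%:Z %| c)%Z then
   (if odd l then - a l./2 else a l./2) else 0.
  rewrite /g [odd _]/= [_./2]/= negbK /=; case: ltnP => _ /=; last first.
    by rewrite invg1 if_same lamps1 /fold weigh0.
  case: ifP => _; rewrite /= ?lampsV /= ?foldN ?fold_translate /= fold_delta;
    rewrite ?oppr0 ?addr0 sub0r rpredN //.
  by case: ifP => _; rewrite ?oppr0.
rewrite fg sg addr0 IH /comb.
have cnt i : let s := count_step m i ((c1, c2), (0, 0)%N) l.+2 in
    s.2.1%:Z - s.2.2%:Z = (if (m%:Z %| c1%:Z - c2%:Z)%Z && (i == l./2) then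
      if odd l then - 1 else 1 else 0) /\ s.1 = (c1, c2).
  rewrite /count_step /= eqmod_dvdz; case: ifP => //= _.
  have -> : (l.+2 == i + i + 2)%N = ~~ odd l && (i == l./2).
    by have := odd_double_half l; case: (odd l) => /=; lia.
  have -> : (l.+2 == i + i + 3)%N = odd l && (i == l./2).
    by have := odd_double_half l; case: (odd l) => /=; lia.
  by case: (odd l) => /=; case: eqP.
case: ltnP => [ltr|ler] /=; last first.
  rewrite add0r; apply: eq_bigr => i _; have [-> ->] := cnt i.
  rewrite (_ : (i == l./2 :> nat) = false) ?andbF ?add0r //.
  by apply/negP => /eqP E; move: ler; rewrite -E leqNgt ltn_ord.
under [RHS]eq_bigr => i _ do
  (have [-> ->] := cnt i; rewrite mulrzDr /=).
rewrite big_split /=; congr (_ + _).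
rewrite (bigD1 (Ordinal ltr)) //= eqxx andbT big1 ?addr0 => [|i].
  by do ?[case: ifP => _]; rewrite ?mulr0z ?mulr1z ?mulrN1z.
by rewrite -val_eqE /= => /negPf ->; rewrite andbF mulr0z.
Qed.

Lemma shift_letters m i U c1 c2 :
  (count_run m i U c1 c2).1.1%:Z - (count_run m i U c1 c2).1.2%:Z =
  c1%:Z - c2%:Z + shift (letters_val U).
Proof.
rewrite /count_run.
elim: U c1 c2 => [|l U IH] c1 c2; first by rewrite letters_val_nil shift1 addr0.
rewrite letters_val_cons shiftM /=; set s := count_step _ _ _ _.
rewrite (surjective_pairing s) (surjective_pairing s.2) foldl_count_step /=.
rewrite (surjective_pairing s.1) IH addrA; congr (_ + _).
rewrite /s; case: l {s} => [|[|l]] /=; try lia.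
rewrite (_ : shift _ = 0) ?addr0 /count_step /=; last by do 2 case: ifP.
by do ?case: ifP.
Qed.

Lemma letters_support U n : lamps (letters_val U) n != 0 -> (`|n| <= size U)%N.
Proof.
elim: U n => [|l U IH] n; first by rewrite letters_val_nil lamps1 lamps0 eqxx.
rewrite letters_val_cons lampsM lampsD translateE /=.
set g := (if _ then _ else _).
have [sg lg] : (`|shift g| <= 1)%N /\ (lamps g n != 0 -> n = 0).
  have gen i : (`|shift (generator i)| <= 1)%N /\
      (forall k, lamps (generator i) k != 0 -> k = 0 /\ shift (generator i) = 0).
    case: i => [|i] /=; first by split=> // k; rewrite fsfun0E eqxx.
    case: ifP => _ /=; split=> // k; last by rewrite fsfun0E eqxx.
    by rewrite deltaE; case: ifP => [/eqP //|_]; rewrite eqxx.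
  rewrite /g; have [s1 s2] := gen l./2; case: ifP => _.
    rewrite shiftV lampsV lampsN translateE oppr_eq0; split; first by lia.
    by move=> /s2[E0 s0]; move: E0; rewrite s0; lia.
  by split=> // /s2[].
have [ln0|ln0 _] := eqVneq (lamps g n) 0; last by rewrite lg.
rewrite ln0 add0r => /IH; lia.
Qed.

Variable ds : seq nat.
Hypothesis diag : diagonal ds a.
Hypothesis size_ds : size ds = r.

Lemma trivial_modP m U : (forall d, d \in ds -> d != 0%N -> (d %| m)%N) ->
  reflect (congruent m (letters_val U) 1%g) (trivial_mod ds m U).
Proof.
move=> dm; apply: (iffP andP).
  move=> [sh /allP h]; split.
    have := shift_letters m 0 U 0 0; rewrite subrr add0r => <-.
    by rewrite shift1 subr0 -eqmod_dvdz.
  have ok c : (`|c| <= size U)%N -> multiple m (fold m false c (lamps (letters_val U))).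
    move=> lec; have [c1 [c2 [Ec pq]]] : exists c1 c2 : nat, c = c1%:Z - c2%:Z /\
        ((c1 = 0%N /\ c2 < (size U).+1) \/ (c2 = 0%N /\ c1 < (size U).+1))%N.
      case: c lec => c lec; first by exists c, 0%N; rewrite subr0; split=> //; right.
      by exists 0%N, c.+1; rewrite sub0r NegzE; split=> //; left.
    rewrite Ec fold_letters -size_ds; apply/(comb_multiple _ diag dm) => i lti.
    have := h i; rewrite mem_iota => /(_ lti)/allP hi.
    rewrite -eqmod_dvdz.
    by case: pq => -[-> ltp]; [have := hi c2|have := hi c1];
      rewrite mem_iota => /(_ ltp)/andP[].
  move=> c; rewrite lamps1 [X in _ - X]weigh0 subr0.
  (* A class without such a representative misses the support. *)
  have [[c' [lec' mc]]|none] := classic (exists c' : int, (`|c'| <= size U)%N /\ (m%:Z %| c - c')%Z).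
    by rewrite (fold_class _ mc); apply: ok.
  rewrite /fold weigh_supp; first exact: multiple0.
  move=> n /letters_support le; rewrite /chi; case: ifP => // d.
  by case: none; exists n; rewrite -opprB rpredN.
move=> [sh h]; split.
  rewrite /shift_ok /= eqmod_dvdz (shift_letters m 0 U 0 0) subrr add0r.
  by move: sh; rewrite shift1 subr0.
have ok c1 c2 i : (i < size ds)%N -> coef_ok m i (nth 0%N ds i) U c1 c2.
  move=> lti; have := h (c1%:Z - c2%:Z); rewrite lamps1 [X in _ - X]weigh0 subr0.
  rewrite fold_letters -size_ds => /(comb_multiple _ diag dm)/(_ i lti).
  by rewrite -eqmod_dvdz.
apply/allP => i; rewrite mem_iota => lti; apply/allP => p _.
by rewrite !ok.
Qed.

End StandardGenerators.

(** * Words representing every element, and bounded words representing every class modulo m *)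

Section Representation.

Local Open Scope ring_scope.

Variables (A : zmodType) (a : nat -> A) (r : nat).

Notation lval := (letters_val a r).

Lemma generator_lamp i : (i < r)%N -> generator a r i.+1 = WreathZ (delta 0 (a i)) 0.
Proof. by move=> lti; rewrite /generator lti. Qed.

Lemma lval_letter i : lval [:: i.*2] = generator a r i.
Proof. by rewrite letters_val_cons letters_val_nil mulg1 odd_double doubleK. Qed.

Lemma shift_mul (j k : int) : (WreathZ (0 : lampsType A) j * WreathZ 0 k)%g = WreathZ 0 (j + k).
Proof. by apply: wreathZ_eq => // n; rewrite lampsM /= translate0 addr0. Qed.

Lemma lamp_mul (f g : lampsType A) : (WreathZ f 0 * WreathZ g 0)%g = WreathZ (f + g) 0.
Proof. by apply: wreathZ_eq => // n; rewrite lampsM translate_id. Qed.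

Lemma letters_val_surj : (forall y, exists c, y = comb a r c) ->
  forall x, exists U, lval U = x.
Proof.
move=> gen; pose R x := exists U, lval U = x.
have RM x y : R x -> R y -> R (x * y)%g.
  by move=> [U <-] [V <-]; exists (U ++ V); rewrite letters_val_cat.
have RV x : R x -> R (x^-1)%g.
  by move=> [U <-]; exists (inv_letters U); rewrite letters_val_inv.
have R1 : R 1%g by exists [::]; rewrite letters_val_nil.
have Rt k : R (WreathZ 0 k).
  have pos (n : nat) : R (WreathZ 0 n%:Z).
    elim: n => [//|n IH]; rewrite -addn1 PoszD -shift_mul; apply: RM => //.
    by exists [:: 0.*2]; rewrite lval_letter.
  case: k => n; first exact: pos.
  have := RV _ (pos n.+1); congr R; apply: wreathZ_eq => [p|]; last by rewrite NegzE.
  by rewrite lampsV translate0 oppr0.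
have R0 y : R (WreathZ (delta 0 y) 0).
  have gK : subgroup (fun y => R (WreathZ (delta 0 y) 0)).
    split=> [|y1 y2 h1 /RV h2]; first by rewrite delta0.
    have := RM _ _ h1 h2; congr R; apply: wreathZ_eq => // n.
    by rewrite lampsM lampsV !translate_id deltaD deltaN.
  have [c ->] := gen y; rewrite /comb; elim/big_ind: _ => [|y1 y2|i _].
  - exact: gK.1.
  - by move=> h1 h2; apply: (subgroupD gK h1 h2).
  apply: (subgroupMz (c i) gK); exists [:: i.+1.*2].
  by rewrite lval_letter generator_lamp.
have Rd n y : R (WreathZ (delta n y) 0).
  have := RM _ _ (RM _ _ (Rt (- n)) (R0 y)) (Rt n); congr R; apply: wreathZ_eq.
    move=> p; rewrite !lampsM /= translate0 addr0 add0r translate_delta.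
    by rewrite opprK add0r.
  by rewrite !shiftM /= addr0 addNr.
have Rf f : R (WreathZ f 0).
  elim/lamps_ind: f => [//|f n y IH]; rewrite -lamp_mul; exact: RM.
case=> f k; have := RM _ _ (Rf f) (Rt k); congr R.
by apply: wreathZ_eq => [p|]; rewrite ?lampsM ?translate0 /= ?addr0 ?add0r.
Qed.

Variable m : nat.
Hypothesis m_gt0 : (0 < m)%N.

Definition small U := all (fun l => l < r.+2.*2)%N U.

Lemma block_exists c : exists U y,
  [/\ (size U <= r * m)%N, small U, lval U = WreathZ (delta 0 y) 0 &
      multiple m (y - comb a r c)].
Proof.
suff [U [hs hU hv]] : exists U, [/\ (size U <= r * m)%N, small U &
    lval U = WreathZ (delta 0 (comb a r (fun i => (c i %% m%:Z)%Z))) 0].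
  exists U, (comb a r (fun i => (c i %% m%:Z)%Z)); split=> //.
  exists (comb a r (fun i => - (c i %/ m%:Z)%Z)); rewrite combB combMn.
  apply: eq_bigr => i _; congr (_ *~ _).
  by rewrite {2}(divz_eq (c i) m) mulNr opprD addrC -addrA addNr addr0.
rewrite /comb; suff: forall k, (k <= r)%N -> exists U, [/\ (size U <= k * m)%N, small U &
    lval U = WreathZ (delta 0 (\sum_(i < k) a i *~ (c i %% m%:Z)%Z)) 0].
  exact.
elim=> [|k IH] lek.
  by exists [::]; split=> //; rewrite letters_val_nil big_ord0 delta0.
have [U [sU lU vU]] := IH (ltnW lek).
have [n En] : exists n : nat, (c k %% m%:Z)%Z = n by exists `|(c k %% m)%Z|%N; lia.
have ltn : (n < m)%N by rewrite -ltz_nat -En ltz_pmod.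
exists (U ++ nseq n k.+1.*2); split.
- by rewrite size_cat size_nseq mulSn addnC leq_add // ltnW.
- rewrite /small all_cat all_nseq -/(small U) lU; apply/orP; right; lia.
rewrite letters_val_cat vU big_ord_recr /= En deltaD -lamp_mul; congr (_ * _)%g.
elim: n {En ltn} => [|n IHn]; first by rewrite letters_val_nil mulr0z delta0.
rewrite -[nseq _ _]/([:: _] ++ nseq n _) letters_val_cat IHn lval_letter.
by rewrite generator_lamp // lamp_mul -deltaD -addn1 PoszD mulrzDr addrC.
Qed.

Hypothesis gen : forall y, exists c, y = comb a r c.

(** The word alternates writing a lamp and shifting by one. What is written after p shifts lands at
    position -p. *)
Lemma blocks_exist (g : int -> A) q : exists U,
  [/\ (size U <= q * (r * m + 1))%N, small U, shift (lval U) = q &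
   forall c, multiple m (fold m false c (lamps (lval U)) -
     \sum_(p < q) (if (m%:Z %| - p%:Z - c)%Z then g (- p%:Z) else 0))].
Proof.
elim: q => [|q [U [sU lU hU fU]]].
  exists [::]; split=> // [|c]; rewrite letters_val_nil ?lamps1 // /fold weigh0 big_ord0 subr0.
  exact: multiple0.
have [c Ec] := gen (g (- q%:Z)).
have [V [y [sV lV vV my]]] := block_exists c.
exists (U ++ V ++ [:: 0.*2]); split.
- by rewrite !size_cat /= mulSn; lia.
- by rewrite /small !all_cat -/(small U) -/(small V) lU lV.
- by rewrite !letters_val_cat vV lval_letter !shiftM hU /= add0r; lia.
move=> d; rewrite !letters_val_cat vV lval_letter !lampsM hU /= translate_id addr0.
rewrite foldD fold_translate fold_delta (_ : 0 - (d + q) = - q%:Z - d); last by lia.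
rewrite big_ord_recr /= [- (\sum_(i < q) _ + _)]opprD addrACA; apply: multipleD => //.
by case: ifP => _; rewrite ?subrr ?Ec //; apply: multiple0.
Qed.

(** A full sweep of m positions writes one lamp per residue class and contributes a shift of m,
    which is 0 modulo m; the residue of [shift x] is appended. *)
Lemma bounded_word x : exists U,
  [/\ size U = word_bound r m, small U & congruent m (lval U) x].
Proof.
have [U [sU lU hU fU]] := blocks_exist (fun c => fold m false c (lamps x)) m.
have [n En] : exists n : nat, (shift x %% m%:Z)%Z = n.
  by exists `|(shift x %% m)%Z|%N; lia.
have ltn : (n < m)%N by rewrite -ltz_nat -En ltz_pmod.
(* Number of blanks, letter 2(r + 1), that bring the word to the exact length. *)
pose k := (word_bound r m - size U - n)%N.
exists (U ++ nseq n 0.*2 ++ nseq k r.+1.*2); split.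
- rewrite !size_cat !size_nseq /k /word_bound; lia.
- rewrite /small !all_cat -/(small U) lU !all_nseq /=; apply/andP; split; lia.
have -> : lval (U ++ nseq n 0.*2 ++ nseq k r.+1.*2) = (lval U * WreathZ 0 n%:Z)%g.
  rewrite letters_val_cat; congr (_ * _)%g; rewrite letters_val_cat.
  have -> : lval (nseq k r.+1.*2) = 1%g.
    elim: k => [|k IH]; first exact: letters_val_nil.
    rewrite -[nseq _ _]/([:: _] ++ nseq k _) letters_val_cat IH lval_letter.
    by rewrite /generator ltnn mulg1.
  rewrite mulg1; elim: (n) => [|j IH]; first exact: letters_val_nil.
  rewrite -[nseq _ _]/([:: _] ++ nseq j _) letters_val_cat IH lval_letter shift_mul.
  by rewrite -PoszD add1n.
split=> [|c].
  rewrite shiftM hU /= (divz_eq (shift x) m) En.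
  set k' := (_ %/ _)%Z; rewrite (_ : _ - _ = (1 - k') * m%:Z); last by ring.
  exact: dvdz_mull.
rewrite lampsM /= translate0 addr0.
suff <- : \sum_(p < m) (if (m%:Z %| - p%:Z - c)%Z then fold m false (- p%:Z) (lamps x) else 0)
    = fold m false c (lamps x) by [].
have [p Ep] : exists p : nat, (- c %% m%:Z)%Z = p by exists `|(- c %% m)%Z|%N; lia.
have ltp : (p < m)%N by rewrite -ltz_nat -Ep ltz_pmod.
have dvp : (m%:Z %| - p%:Z - c)%Z.
  rewrite (divz_eq (- c) m) Ep addrC addrK; exact: dvdz_mull.
rewrite (bigD1 (Ordinal ltp)) //= dvp big1 ?addr0 => [|i].
  exact: fold_class.
rewrite -val_eqE /= => ip; case: ifP => // dvi; case/negP: ip.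
have : (m%:Z %| p%:Z - i%:Z)%Z.
  have := rpredB dvi dvp; congr (_ %| _)%Z; lia.
rewrite -eqz_mod_dvd !modz_nat !modn_small // => /eqP[->].
exact: eqxx.
Qed.

End Representation.

(** * Submodules of lamp configurations *)

Section Submodules.

Local Open Scope ring_scope.

Variable A : zmodType.
Implicit Types (f h : lampsType A) (M : lampsType A -> Prop).

Definition submodule M := subgroup M /\ forall k f, M f -> M (translate k f).
(** t^s acts as 1 on the quotient by M; for [antiperiod] it acts as -1. *)
Definition period M s := forall f, M (translate s f - f).
Definition antiperiod M s := forall f, M (translate s f + f).
Definition contains_multiples M (m : nat) := forall f, M (f *+ m).

(* The submodule generated by the images of t^g - 1 and t^k + 1. *)
Definition lamp_span (gs ks : seq int) f := forall M, submodule M ->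
  (forall g, g \in gs -> period M g) ->
  (forall k, k \in ks -> antiperiod M k) -> M f.

Lemma lamp_span_submodule gs ks : submodule (lamp_span gs ks).
Proof.
split; first split=> [M sM _ _|f h Hf Hh M sM hg hk]; first exact: sM.1.1.
  by apply: sM.1.2; [apply: Hf|apply: Hh].
by move=> k f Hf M sM hg hk; apply: sM.2; apply: Hf.
Qed.

Lemma lamp_span_period gs ks g : g \in gs -> period (lamp_span gs ks) g.
Proof. by move=> hg f M _ H _; apply: H. Qed.

Lemma lamp_span_antiperiod gs ks k : k \in ks -> antiperiod (lamp_span gs ks) k.
Proof. by move=> hk f M _ _; apply. Qed.

Lemma lamp_span_nil f : lamp_span [::] [::] f -> f = 0.
Proof.
move=> sf; apply: (sf (fun f => f = 0)) => //; split; last first.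
  by move=> k _ ->; apply: translate0.
by split=> // x y -> ->; rewrite subrr.
Qed.

Lemma lamp_span_cons_period g gs ks f : lamp_span (g :: gs) ks f ->
  exists h, lamp_span gs ks (f - (translate g h - h)).
Proof.
have sS := lamp_span_submodule gs ks.
move=> sf; apply: (sf (fun f => exists h, lamp_span gs ks (f - (translate g h - h)))).
- split; first split.
  + by exists 0; rewrite translate0 !subr0; apply: sS.1.1.
  + move=> x y [h1 H1] [h2 H2]; exists (h1 - h2).
    have := sS.1.2 _ _ H1 H2; congr lamp_span; rewrite translateB; zmod.
  + move=> k x [h Hh]; exists (translate k h); have := sS.2 k _ Hh; congr lamp_span.
    by rewrite !translateB !translateT (addrC k).
- move=> x; rewrite inE => /orP[/eqP ->|hx] h; last exists 0.
    by exists h; rewrite subrr; apply: sS.1.1.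
  by rewrite translate0 !subr0; apply: lamp_span_period.
- by move=> k hk h; exists 0; rewrite translate0 !subr0; apply: lamp_span_antiperiod.
Qed.

Lemma lamp_span_cons_antiperiod gs k ks f : lamp_span gs (k :: ks) f ->
  exists h, lamp_span gs ks (f - (translate k h + h)).
Proof.
have sS := lamp_span_submodule gs ks.
move=> sf; apply: (sf (fun f => exists h, lamp_span gs ks (f - (translate k h + h)))).
- split; first split.
  + by exists 0; rewrite translate0 addr0 subr0; apply: sS.1.1.
  + move=> x y [h1 H1] [h2 H2]; exists (h1 - h2).
    have := sS.1.2 _ _ H1 H2; congr lamp_span; rewrite translateB; zmod.
  + move=> j x [h Hh]; exists (translate j h); have := sS.2 j _ Hh; congr lamp_span.
    by rewrite !translateB !translateD !translateT (addrC k).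
- by move=> x hx h; exists 0; rewrite translate0 addr0 subr0; apply: lamp_span_period.
- move=> x; rewrite inE => /orP[/eqP ->|hx] h; last exists 0.
    by exists h; rewrite subrr; apply: sS.1.1.
  by rewrite translate0 addr0 subr0; apply: lamp_span_antiperiod.
Qed.

(** * Arithmetic of exponents acting as 1 or as -1 *)

Section Periods.

Variable M : lampsType A -> Prop.
Hypothesis sM : submodule M.

Lemma periodB (s t : int) : period M s -> period M t -> period M (s - t).
Proof.
move=> ps pt f.
have := sM.1.2 _ _ (ps (translate (- t) f)) (pt (translate (- t) f)).
by rewrite !translateT subrr translate_id; congr M; zmod.
Qed.

Lemma period_subgroup : subgroup (period M).
Proof.
split=> [f|s t]; last exact: periodB.
by rewrite translate_id subrr; apply: sM.1.1.
Qed.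

Lemma period0 : period M 0. Proof. exact: period_subgroup.1. Qed.

Lemma periodD s t : period M s -> period M t -> period M (s + t).
Proof. exact: subgroupD period_subgroup. Qed.

Lemma period_dvd g s : (g %| s)%Z -> period M g -> period M s.
Proof.
move=> /dvdzP[q ->] pg; rewrite mulrC -mulrzz.
exact: (subgroupMz q period_subgroup pg).
Qed.

Lemma period_gcd s t : period M s -> period M t -> period M (gcdz s t).
Proof.
move=> ps pt; have [u [v <-]] := Bezoutz s t.
by apply: periodD; [apply: (period_dvd _ ps)|apply: (period_dvd _ pt)];
  apply: dvdz_mull.
Qed.

Lemma antiperiodD s t : antiperiod M s -> antiperiod M t -> period M (s + t).
Proof.
move=> ps pt f; have := sM.1.2 _ _ (ps (translate t f)) (pt f).
by rewrite translateT; congr M; zmod.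
Qed.

Lemma antiperiod_add s t : antiperiod M s -> period M t -> antiperiod M (s + t).
Proof.
move=> ps pt f; have := subgroupD sM.1 (ps f) (pt (translate s f)).
by rewrite translateT (addrC t); congr M; zmod.
Qed.

Lemma antiperiodN s : antiperiod M s -> antiperiod M (- s).
Proof.
move=> ps; rewrite (_ : - s = s + - (s + s)); last by ring.
apply: antiperiod_add => //; apply: (subgroupN period_subgroup).
exact: antiperiodD.
Qed.

Lemma antiperiod_double s : antiperiod M s -> period M s -> contains_multiples M 2.
Proof.
move=> as_ ps f; have := sM.1.2 _ _ (as_ f) (ps f); congr M; zmod.
Qed.

Lemma double_antiperiod s : contains_multiples M 2 -> period M s -> antiperiod M s.
Proof.
move=> d ps f; have := subgroupD sM.1 (ps f) (d f); congr M; zmod.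
Qed.

Lemma antiperiod_odd s t : antiperiod M s -> period M (s + s) ->
  antiperiod M (s * (2 * t + 1)).
Proof.
move=> as_ ps; rewrite (_ : _ * _ = s + (s + s) * t); last by ring.
by apply: antiperiod_add => //; apply: period_dvd ps; apply: dvdz_mulr.
Qed.

End Periods.

Definition list_gcd (gs : seq int) := foldr gcdz 0 gs.

Lemma list_gcd_dvd gs g : g \in gs -> (list_gcd gs %| g)%Z.
Proof.
elim: gs => //= x gs IH; rewrite inE => /orP[/eqP ->|/IH]; first exact: dvdz_gcdl.
exact: dvdz_trans (dvdz_gcdr _ _).
Qed.

Lemma period_list_gcd M gs : submodule M -> (forall g, g \in gs -> period M g) ->
  period M (list_gcd gs).
Proof.
move=> sM; elim: gs => [_|g gs IH h]; first exact: period0.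
apply: period_gcd => //; first by apply: h; rewrite mem_head.
by apply: IH => x hx; apply: h; rewrite inE hx orbT.
Qed.

(** * Residue sums *)

(** The kernel of reduction to A/NA coefficients modulo t^D - 1, or t^D + 1 when b is set. These
    submodules are the test objects of the local-global argument. *)
Definition fold_multiple D b N f := forall c, multiple N (fold D b c f).

Lemma fold_multiple_submodule D b N : submodule (fold_multiple D b N).
Proof.
split; first split=> [c|f h Hf Hh c].
- by rewrite /fold weigh0; apply: multiple0.
- by rewrite foldB; apply: multipleB.
by move=> k f Hf c; rewrite fold_translate.
Qed.

Lemma fold_multiple_period D N s : (D%:Z %| s)%Z -> period (fold_multiple D false N) s.
Proof.
move=> Ds f c; rewrite foldB fold_translate (@fold_class _ _ (c + s) c) ?subrr.
  exact: multiple0.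
by rewrite addrAC subrr add0r.
Qed.

Lemma fold_multiple_antiperiod D N : (0 < D)%N -> antiperiod (fold_multiple D true N) D%:Z.
Proof.
move=> D0 f c; suff -> : fold D true c (translate D f + f) = 0 by apply: multiple0.
rewrite foldD fold_translate; elim/lamps_ind: f => [|f n x IH].
  by rewrite /fold !weigh0 addr0.
rewrite !foldD addrACA IH add0r /fold !weigh_delta -mulrzDr /chi.
rewrite (_ : n - (c + D) = n - c + -1 * D%:Z); last by ring.
rewrite (rpredDr _ (dvdz_mull _ _)) ?dvdzz //; case: ifP => [dv|]; last by rewrite mulr0z.
rewrite divzDr ?dvdz_mull // mulzK; last by rewrite eqz_nat -lt0n.
rewrite (_ : odd `|_ + -1| = ~~ odd `|((n - c) %/ D)%Z|%N); last by lia.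
by case: odd => /=; rewrite ?addrN ?addNr mulr0z.
Qed.

Lemma fold_multiple_contains D b N m : (N %| m)%N -> contains_multiples (fold_multiple D b N) m.
Proof.
move=> /dvdnP[q ->] f c; rewrite foldMn mulrnA.
by exists (fold D b c f *+ q).
Qed.

Lemma fold_multiple_weaken D b N N' f : (N' %| N)%N ->
  fold_multiple D b N f -> fold_multiple D b N' f.
Proof.
move=> /dvdnP[q ->] h c; have [y ->] := h c.
by exists (y *+ q); rewrite mulrnA.
Qed.

Definition signed_period (b : bool) M s := if b then antiperiod M s else period M s.

Lemma sum_closed (V : zmodType) (K : V -> Prop) (I : Type) (r : seq I) (P : pred I) (F : I -> V) :
  subgroup K -> (forall i, P i -> K (F i)) -> K (\sum_(i <- r | P i) F i).
Proof.
move=> gK h; elim/big_ind: _ => // [|x y]; first exact: gK.1.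
exact: subgroupD.
Qed.

(** Modulo M each lamp can be moved, up to sign, into the window from 0 to D - 1. *)
Lemma unfold_closed M D b f : submodule M -> (0 < D)%N -> signed_period b M D%:Z ->
  M (f - \sum_(c < D) delta c (fold D b c f)).
Proof.
move=> sM D0 pD; elim/lamps_ind: f => [|f n x IH].
  rewrite big1 ?subrr; first exact: sM.1.1.
  by move=> c _; rewrite /fold weigh0 delta0.
under eq_bigr => c _ do rewrite foldD deltaD.
rewrite big_split /= opprD addrACA; apply: (subgroupD sM.1) => //.
have D0' : D%:Z != 0 by rewrite eqz_nat -lt0n.
have [c Ec] : exists c : nat, (n %% D%:Z)%Z = c.
  by exists `|(n %% D)%Z|%N; have := modz_ge0 n D0'; lia.
have ltc : (c < D)%N by rewrite -ltz_nat -Ec ltz_pmod.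
set q := (n %/ D%:Z)%Z; have En : n = q * D%:Z + c by rewrite /q -Ec -divz_eq.
have nc : n - c%:Z = q * D%:Z by rewrite En addrK.
rewrite (bigD1 (Ordinal ltc)) //= big1 ?addr0 => [|i]; last first.
  rewrite -val_eqE /= => /negbTE ic; rewrite /fold weigh_delta /chi ifN ?mulr0z ?delta0 //.
  apply/negP => dv; have : (D%:Z %| i%:Z - c%:Z)%Z.
    have : (D%:Z %| q * D%:Z)%Z by rewrite dvdz_mull.
    move=> d2; have := rpredB d2 dv; rewrite -nc; congr (_ %| _)%Z; lia.
  by rewrite -eqz_mod_dvd !modz_nat !modn_small // => /eqP[/eqP]; rewrite ic.
rewrite /fold weigh_delta /chi nc dvdz_mull // mulzK //.
have Ed : delta n x = translate (- (q * D%:Z)) (delta c x).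
  by rewrite translate_delta -nc opprK addrC subrK.
case: b {IH} pD => /= pD; last first.
  rewrite mulr1z Ed; apply: (period_dvd sM _ pD); rewrite rpredN; exact: dvdz_mull.
(* Odd multiples of D are again antiperiods and even ones are periods, which matches the sign in
   [chi]. *)
case: ifP => oq; rewrite ?mulrN1z ?mulr1z ?deltaN ?opprK Ed.
  have -> : - (q * D%:Z) = D%:Z * (2 * ((- q - 1) %/ 2)%Z + 1).
    set w := (_ %/ 2)%Z; have -> : q = - (2 * w + 1) by rewrite /w; lia.
    by ring.
  by apply: antiperiod_odd => //; apply: antiperiodD.
have -> : - (q * D%:Z) = (- q %/ 2)%Z * (D%:Z + D%:Z).
  set w := (_ %/ 2)%Z; have -> : q = - (2 * w) by rewrite /w; lia.
  by ring.
by apply: (period_dvd sM (dvdz_mull _ (dvdzz _))); apply: antiperiodD.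
Qed.

(** Minimality of the test submodule among those with the given sign behaviour at D and containing
    all multiples of N: this turns finitely many residue sums into membership. *)
Lemma fold_multiple_sub M D b N f : submodule M -> (0 < D)%N ->
  signed_period b M D%:Z -> contains_multiples M N -> fold_multiple D b N f -> M f.
Proof.
move=> sM D0 pD cN hf.
rewrite -(subrK (\sum_(c < D) delta c (fold D b c f)) f).
apply: (subgroupD sM.1); first exact: unfold_closed.
apply: sum_closed => // [|c _]; first exact: sM.1.
have [y ->] := hf c; suff -> : delta c (y *+ N) = delta c y *+ N by apply: cN.
by elim: (N) => [|n IH]; rewrite ?delta0 // !mulrS deltaD IH.
Qed.

Lemma pointwise_multiple_sub M b N f : submodule M -> contains_multiples M N ->
  fold_multiple 0 b N f -> M f.
Proof.
move=> sM cN hf; suff -> : f = \sum_(n <- finsupp f) delta n (f n).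
  apply: sum_closed => // [|c _]; first exact: sM.1.
  have := hf c; rewrite fold0 => -[y ->].
  suff -> : delta c (y *+ N) = delta c y *+ N by apply: cN.
  by elim: (N) => [|n IH]; rewrite ?delta0 // !mulrS deltaD IH.
apply/fsfunP => x; transitivity (\sum_(n <- finsupp f) delta n (f n) x); last first.
  symmetry; apply: (big_morph (fun g : lampsType A => g x)).
    by move=> g h; apply: lampsD.
  exact: lamps0.
have [xf|xf] := boolP (x \in finsupp f); last first.
  rewrite (fsfun_dflt xf) big_seq big1 // => n nf; rewrite deltaE.
  by case: eqP nf xf => // -> ->.
rewrite (big_fsetD1 x) //= deltaE eqxx big_seq big1 ?addr0 // => n.
by rewrite in_fsetD1 deltaE eq_sym => /andP[/negbTE ->].
Qed.

Lemma congruent1_closed m (v : wreathZ A) M : submodule M -> (0 < m)%N ->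
  period M m%:Z -> contains_multiples M m -> congruent m v 1%g -> M (lamps v).
Proof.
move=> sM m0 pm cm [_ h]; apply: (@fold_multiple_sub M m false m) => // c.
by have := h c; rewrite lamps1 [X in _ - X]weigh0 subr0.
Qed.

End Submodules.

(** * Products of conjugacy classes, squares and commutators *)

Section Products.

Local Open Scope ring_scope.

Variable A : zmodType.
Implicit Types (f h : lampsType A) (v x y c : wreathZ A) (l : seq (atom (wreathZ A))).

Fixpoint atoms_consts l : seq (wreathZ A) :=
  match l with
  | [::] => [::]
  | Class c :: l' => c :: atoms_consts l'
  | _ :: l' => atoms_consts l'
  end.

(** A commutator can be any (t - 1) h, hence the exponent 1; conjugating c by lamps changes it by
    multiples of t^(shift c) - 1. *)
Fixpoint atoms_periods l : seq int :=
  match l with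
  | [::] => [::]
  | Commutator :: l' => 1 :: atoms_periods l'
  | Square :: l' => atoms_periods l'
  | Class c :: l' => shift c :: atoms_periods l'
  end.

Fixpoint atoms_squares l : nat :=
  match l with
  | [::] => 0
  | Square :: l' => (atoms_squares l').+1
  | _ :: l' => atoms_squares l'
  end.

Definition sumz (ks : seq int) : int := foldr +%R 0 ks.

Definition config (cs : seq (wreathZ A)) (rs : seq int) : lampsType A :=
  \sum_(p <- zip cs rs) translate p.2 (lamps p.1).

Lemma config_cons c cs r rs :
  config (c :: cs) (r :: rs) = translate r (lamps c) + config cs rs.
Proof. by rewrite /config big_cons. Qed.

Lemma config_nil rs : config [::] rs = 0.
Proof. by case: rs => [|r rs]; rewrite /config big_nil. Qed.

Lemma translate_config k cs rs :
  translate k (config cs rs) = config cs (map (fun r => k + r) rs).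
Proof.
elim: cs rs => [|c cs IH] [|r rs]; rewrite ?config_nil ?translate0 //.
  by rewrite /config !big_nil translate0.
by rewrite config_cons translateD translateT IH -config_cons.
Qed.

(** [ks] are the shifts of the elements being squared and [rs] the places of the conjugated
    constants; the rest of the freedom in the unknowns is absorbed by the span. *)
Definition solves_atoms l v := exists ks rs,
  [/\ size ks = atoms_squares l, size rs = size (atoms_consts l),
    shift v = 2 * sumz ks + sumz (map (@shift A) (atoms_consts l)) &
    lamp_span (atoms_periods l) ks (lamps v - config (atoms_consts l) rs)].

(** The lamps of [x, y] are (t^(shift x) - 1) y - (t^(shift y) - 1) x, a multiple of t - 1;
    conversely the generating shift and h have commutator (t - 1) h. *)
Lemma solves_commutator l v : (exists p q, [/\ atom_set Commutator p,
    solves_atoms l q & v = (p * q)%g]) <-> solves_atoms (Commutator :: l) v.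
Proof.
split.
  move=> [_ [q [[x [y ->]] [ks [rs [sk sr sh sp]]] ->]]]; exists ks, rs; split=> //.
    by rewrite !(shiftM, shiftV) sh; ring.
  move=> M sM pM aM; have p1 : period M 1 by apply: pM; rewrite mem_head.
  have pa s : period M s by apply: (period_dvd sM _ p1); apply: dvd1z.
  have hq : M (lamps q - config (atoms_consts l) rs).
    by apply: sp => // g hg; apply: pM; rewrite inE hg orbT.
  have := subgroupD sM.1 (subgroupD sM.1 hq (pa (shift x) (lamps y)))
    (subgroupN sM.1 (pa (shift y) (lamps x))).
  congr M; rewrite !lampsM !lampsV !translateN !translateT !shiftM !shiftV.
  rewrite (_ : shift x + shift y - shift x = shift y); last by ring.
  rewrite (_ : shift y + - shift y = 0); last by ring.
  by rewrite ?translate_id; zmod.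
move=> [ks [rs [sk sr sh /lamp_span_cons_period[h sp]]]].
pose p := (WreathZ 0 1 * WreathZ h 0 * (WreathZ 0 1)^-1 * (WreathZ h 0)^-1)%g.
have lp : lamps p = translate 1 h - h.
  rewrite !lampsM !lampsV !shiftM !shiftV /= !translateN !translate0.
  by rewrite !translateT ?subrr ?addr0 ?add0r ?translate_id; zmod.
have sp0 : shift p = 0 by [].
exists p, (p^-1 * v)%g; split; last by rewrite mulgA mulgV mul1g.
  by exists (WreathZ 0 1), (WreathZ h 0).
exists ks, rs; split=> //; first by rewrite shiftM shiftV sp0 sh; ring.
move: sp; congr lamp_span.
by rewrite lampsM lampsV !shiftV sp0 oppr0 !translate_id lp /=; zmod.
Qed.

(** The square of (h, k) has lamps (t^k + 1) h and shift 2k, which displaces the constants of the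
    remaining factors. *)
Lemma solves_square l v : (exists p q, [/\ atom_set Square p,
    solves_atoms l q & v = (p * q)%g]) <-> solves_atoms (Square :: l) v.
Proof.
split.
  move=> [_ [q [[x ->] [ks [rs [sk sr sh sp]]] ->]]].
  exists (shift x :: ks), (map (fun r => shift x + shift x + r) rs); split.
  - by rewrite /= sk.
  - by rewrite size_map.
  - by rewrite !shiftM sh /=; ring.
  move=> M sM pM aM.
  have hq : M (translate (shift x + shift x) (lamps q - config (atoms_consts l) rs)).
    by apply: sM.2; apply: sp => // k hk; apply: aM; rewrite inE hk orbT.
  have ax : antiperiod M (shift x) by apply: aM; rewrite mem_head.
  have := subgroupD sM.1 hq (ax (lamps x)); congr M.
  by rewrite -translate_config translateB !lampsM !shiftM; zmod.
move=> [[|k ks] [rs [//= [sk] sr sh /lamp_span_cons_antiperiod[h sp]]]].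
pose p := (WreathZ h k * WreathZ h k)%g.
have lp : lamps p = translate k h + h by rewrite lampsM /= addrC.
have sp0 : shift p = k + k by [].
exists p, (p^-1 * v)%g; split; [by exists (WreathZ h k)| |by rewrite mulgA mulgV mul1g].
exists ks, (map (fun r => - (k + k) + r) rs); split=> //.
- by rewrite size_map.
- by rewrite shiftM shiftV sp0 sh; ring.
rewrite -translate_config lampsM lampsV shiftV sp0 lp.
have := (@lamp_span_submodule _ _ _).2 (- (k + k)) _ sp; congr lamp_span.
by rewrite !(translateB, translateD); zmod.
Qed.

(** The shift of the conjugator chooses the place of c, its lamps add a multiple of t^(shift c) -
    1. *)
Lemma solves_class c l v : (exists p q, [/\ atom_set (Class c) p,
    solves_atoms l q & v = (p * q)%g]) <-> solves_atoms (Class c :: l) v.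
Proof.
split.
  move=> [_ [q [[x ->] [ks [rs [sk sr sh sp]]] ->]]].
  exists ks, (- shift x :: map (fun r => shift c + r) rs); split=> //.
  - by rewrite /= size_map sr.
  - by rewrite !(shiftM, shiftV) sh /=; ring.
  move=> M sM pM aM.
  have hq : M (translate (shift c) (lamps q - config (atoms_consts l) rs)).
    by apply: sM.2; apply: sp => // k hk; apply: pM; rewrite inE hk orbT.
  have pc : period M (shift c) by apply: pM; rewrite mem_head.
  have := subgroupD sM.1 hq (pc (translate (- shift x) (lamps x))); congr M.
  rewrite config_cons -translate_config translateB !lampsM !shiftM !shiftV lampsV.
  rewrite !translateT (addrC (- shift x) (shift c)).
  rewrite (_ : shift c - shift x + shift x = shift c); last by ring.
  zmod.
move=> [ks [[|r rs] [//= sk [sr] sh /lamp_span_cons_period[h sp]]]].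
pose x := WreathZ (translate (- r) h) (- r); pose p := (x^-1 * c * x)%g.
have sp0 : shift p = shift c by rewrite !(shiftM, shiftV); ring.
have lp : lamps p = translate r (lamps c) + (translate (shift c) h - h).
  rewrite /p !lampsM !shiftM lampsV shiftV /x /= !translateT opprK.
  rewrite (_ : r - r = 0); last by ring.
  rewrite (_ : r + shift c + 0 - r = shift c); last by ring.
  by rewrite translate_id; zmod.
exists p, (p^-1 * v)%g; split; [by exists x| |by rewrite mulgA mulgV mul1g].
exists ks, (map (fun r => - shift c + r) rs); split=> //.
- by rewrite size_map.
- by rewrite shiftM shiftV sp0 sh; ring.
rewrite -translate_config lampsM lampsV shiftV sp0 lp.
have := (@lamp_span_submodule _ _ _).2 (- shift c) _ sp; congr lamp_span.
rewrite config_cons !(translateB, translateD); zmod.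
Qed.

Lemma atoms_setE l v : atoms_set l v <-> solves_atoms l v.
Proof.
elim: l v => [|a l IH] v /=.
  split=> [->|].
    exists [::], [::]; split=> //; rewrite lamps1 config_nil subr0.
    exact: (@lamp_span_submodule _ _ _).1.1.
  move=> [[|k ks] [[|r rs] [// _ _ sh sp]]]; apply: wreathZ_eq => [n|]; last by rewrite sh.
  by have := lamp_span_nil sp; rewrite config_nil subr0 => ->.
have E : (exists p q, [/\ atom_set a p, atoms_set l q & v = (p * q)%g]) <->
    (exists p q, [/\ atom_set a p, solves_atoms l q & v = (p * q)%g]).
  by split=> -[p [q [h1 h2 ->]]]; exists p, q; split=> //; apply/IH.
by rewrite E; case: a {E} => [||c];
  [apply: solves_commutator|apply: solves_square|apply: solves_class].
Qed.

End Products.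

(** * Solvability modulo every m implies solvability *)

(** If every x failed at some modulus, all would fail at the product of these moduli. *)
Lemma divisibility_pigeonhole (X : finType) (P : X -> nat -> Prop) :
  (forall x m m', m %| m' -> P x m' -> P x m) ->
  (forall m, 0 < m -> exists x, P x m) ->
  exists x, forall m, 0 < m -> P x m.
Proof.
move=> anti ex; apply: NNPP => none.
have /fin_all_exists[u hu] : forall x, exists m, 0 < m /\ ~ P x m.
  move=> x; apply: NNPP => h; apply: none; exists x => m m0.
  by apply: NNPP => nP; apply: h; exists m.
have [|x Px] := ex (\prod_x u x); first by apply: prodn_gt0 => x; case: (hu x).
by case: (hu x) => _; apply; apply: anti Px; rewrite (bigD1 x) //= dvdn_mulr.
Qed.

Section LocalGlobal.

Local Open Scope ring_scope.

Variable A : zmodType.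
Hypothesis residual : forall x : A,
  (forall m, (0 < m)%N -> multiple m x) -> x = 0.

Variable cs : seq (wreathZ A).
Implicit Types (M : lampsType A -> Prop) (rs ks : seq int).

Lemma config_mod M (g : int -> int) D rs : submodule M -> period M D ->
  (forall r, (D %| g r - r)%Z) -> M (config cs (map g rs) - config cs rs).
Proof.
move=> sM pD hg; elim: cs rs => [|c l IH] [|r rs] /=.
- by rewrite subrr; apply: sM.1.1.
- by rewrite !config_nil subrr; apply: sM.1.1.
- by rewrite subrr; apply: sM.1.1.
rewrite !config_cons; have pr : period M (g r - r) by apply: period_dvd pD.
have := subgroupD sM.1 (IH rs) (pr (translate r (lamps c))).
by rewrite translateT subrK; congr M; zmod.
Qed.

Lemma bounded_support : exists B : nat, forall c, c \in cs ->
  forall n, lamps c n != 0 -> (`|n| <= B)%N.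
Proof.
elim: cs => [|c l [B HB]]; first by exists 0%N.
exists (maxn B (\max_(n <- finsupp (lamps c)) `|n|%N)) => c'.
rewrite inE => /orP[/eqP->|/HB h] n nz; last by rewrite leq_max h.
rewrite leq_max; apply/orP; right.
by apply: (@leq_bigmax_seq _ _ _ (fun n : int => absz n)); rewrite ?mem_finsupp.
Qed.

Lemma config_support (B : nat) : (forall c, c \in cs ->
    forall n, lamps c n != 0 -> (`|n| <= B)%N) ->
  forall rs n, config cs rs n != 0 ->
  exists r b, [/\ r \in rs, (`|b| <= B)%N & n = b - r].
Proof.
elim: cs => [|c l IH] HB [|r rs] n; rewrite ?config_nil ?lamps0 ?eqxx //.
  by rewrite /config /= big_nil lamps0 eqxx.
rewrite config_cons lampsD translateE.
have [->|nz _] := eqVneq (lamps c (n + r)) 0.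
  rewrite add0r => /IH[c' hc'|r' [b [h1 h2 ->]]].
    by apply: HB; rewrite inE hc' orbT.
  by exists r', b; rewrite inE h1 orbT.
exists r, (n + r); rewrite mem_head addrK; split=> //.
by apply: HB nz; rewrite mem_head.
Qed.

(* A configuration of few short intervals on a long enough circle misses a
   point, hence can be cut open there and laid out on the line. *)
Lemma unroll : exists2 D0, (0 < D0)%N & forall D N rs, (D0 <= D)%N ->
  size rs = size cs -> fold_multiple D false N (config cs rs) ->
  exists rs', size rs' = size cs /\ fold_multiple 0 false N (config cs rs').
Proof.
have [B HB] := bounded_support.
(* Each translated constant meets at most 2B + 1 residues, so a circle of this length has a free
   one. *)
exists ((size cs * (B.*2.+1)).+1) => // D N rs ltD srs hN.
have D0 : (0 < D)%N by lia.
have D0' : D%:Z != 0 by rewrite eqz_nat -lt0n.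
pose bad := [seq `|((b - r) %% D%:Z)%Z|%N | r <- rs,
   b <- [seq i%:Z - B%:Z | i <- iota 0 B.*2.+1]].
have [x0 ltx0 xbad] : exists2 x, (x < D)%N & x \notin bad.
  apply: NNPP => none.
  have sub : {subset iota 0 D <= bad}.
    move=> x; rewrite mem_iota => /= ltx; apply: contraT => xb.
    by case: none; exists x.
  have := uniq_leq_size (iota_uniq 0 D) sub.
  by rewrite size_iota size_allpairs size_map size_iota srs leqNgt ltD.
have free r b : r \in rs -> (`|b| <= B)%N -> ~~ (D%:Z %| b - r - x0%:Z)%Z.
  move=> hr hb; apply: contra xbad => dv.
  have -> : x0 = `|((b - r) %% D%:Z)%Z|%N.
    move: dv; rewrite -eqz_mod_dvd => /eqP ->; rewrite modz_nat modn_small //.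
  apply: allpairs_f => //; apply/mapP; exists (absz (b + B%:Z)); last by lia.
  by rewrite mem_iota; lia.
(* Translation by r centres the interval at -r. Its distance from the free point x0 along the circle
   is [u r], and [g r] places the centre at x0 + u r. *)
pose u r := ((- r - x0%:Z) %% D%:Z)%Z.
pose g r := - (x0%:Z + u r).
have gD r : (D%:Z %| g r - r)%Z.
  have := divz_eq (- r - x0%:Z) D%:Z; rewrite -/(u r); set k := (_ %/ _)%Z => E.
  rewrite (_ : g r - r = k * D%:Z) ?dvdz_mull // /g; lia.
exists (map g rs); rewrite size_map; split=> //; set f := config cs (map g rs).
have sF := fold_multiple_submodule A D false N.
have hf : fold_multiple D false N f.
  rewrite -(subrK (config cs rs) f); apply: (subgroupD sF.1) => //.
  by apply: config_mod gD => //; apply: fold_multiple_period; apply: dvdzz.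
have window n : f n != 0 -> x0%:Z < n /\ n < x0%:Z + D%:Z.
  move=> /(config_support HB)[_ [b [/mapP[r hr ->] hb ->]]].
  have u0 : 0 <= u r by apply: modz_ge0.
  have uD : u r < D%:Z by apply: ltz_pmod.
  have free' b' : (`|b'| <= B)%N -> ~~ (D%:Z %| b' + u r)%Z.
    move=> /(free r _ hr); apply: contra => dv; have := rpredD dv (gD r).
    by congr (_ %| _)%Z; rewrite /g; lia.
  have uB : (B%:Z < u r).
    rewrite ltNge; apply/negP => le; have := free' (- u r).
    by rewrite addNr dvdz0; lia.
  have uB' : (u r < D%:Z - B%:Z).
    rewrite ltNge; apply/negP => le; have := free' (D%:Z - u r).
    by rewrite subrK dvdzz; lia.
  rewrite /g; lia.
move=> c; have [fc|fc] := eqVneq (f c) 0; first by rewrite fold0 fc; apply: multiple0.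
(* All lamps lie strictly between x0 and x0 + D, so a residue class contains at most one of them. *)
suff -> : fold 0 false c f = fold D false c f by apply: hf.
rewrite /fold /weigh big_seq [RHS]big_seq; apply: eq_bigr => n.
rewrite mem_finsupp => nf; rewrite /chi /= dvd0z; congr (_ *~ (if _ then _ else _)).
have [w1 w2] := window _ nf; have [w3 w4] := window _ fc.
apply/eqP/idP => [->|/dvdzP[k Ek]]; first exact: dvdz0.
have k0 : k = 0 by nia.
by move: Ek; rewrite k0 mul0r; lia.
Qed.

Lemma fold_multiple_period_double D b N : (0 < D)%N ->
  period (@fold_multiple A D b N) (D%:Z + D%:Z).
Proof.
move=> D0; case: b.
  apply: antiperiodD; [exact: fold_multiple_submodule|exact: fold_multiple_antiperiod..].
by apply: fold_multiple_period; rewrite rpredD ?dvdzz.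
Qed.

(** 2D is a period in both cases, so the places can be reduced modulo 2D to a finite set of tuples.
    One tuple works for all m, and then the residual property of A forces its residue sums to
    vanish. *)
Lemma config_residual D b : (0 < D)%N ->
  (forall m, (0 < m)%N -> exists rs,
     size rs = size cs /\ fold_multiple D b m (config cs rs)) ->
  exists rs, size rs = size cs /\ fold_multiple D b 0 (config cs rs).
Proof.
move=> D0 h; pose E := D.*2; have E0 : (0 < E)%N by rewrite double_gt0.
pose P (t : (size cs).-tuple 'I_E) m :=
  fold_multiple D b m (config cs [seq (nat_of_ord i)%:Z | i <- t]).
have [||t ht] := @divisibility_pigeonhole _ P.
- by move=> t m m'; apply: fold_multiple_weaken.
- move=> m m0; have [rs [srs hrs]] := h m m0.
  have sF := fold_multiple_submodule A D b m.
  have lt r : (`|(r %% E%:Z)%Z| < E)%N.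
    have : E%:Z != 0 by rewrite eqz_nat -lt0n.
    by move=> /(modz_ge0 r); have := @ltz_pmod r E%:Z; rewrite ltz_nat => /(_ E0); lia.
  have st : size [seq Ordinal (lt r) | r <- rs] == size cs by rewrite size_map srs.
  exists (Tuple st); rewrite /P /= -map_comp.
  rewrite -(subrK (config cs rs) (config _ _)); apply: (subgroupD sF.1) => //.
  apply: (@config_mod _ _ E%:Z) => // [|r /=].
    by rewrite /E -addnn PoszD; apply: fold_multiple_period_double.
  have := divz_eq r E%:Z; set k := (_ %/ _)%Z => Er.
  have : E%:Z != 0 by rewrite eqz_nat -lt0n.
  move=> /(modz_ge0 r) r0; rewrite (_ : _ - r = - k * E%:Z) ?dvdz_mull //; lia.
exists [seq (nat_of_ord i)%:Z | i <- t]; rewrite size_map size_tuple; split=> // c.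
set x := fold _ _ _ _; have -> : x = 0 by apply: residual => m m0; exact: ht.
exact: multiple0.
Qed.

(* The last clause is membership in the sum of the span of gs and ks, the image
   of t^m - 1 and the multiples of m. *)
Definition locally_solvable (gs : seq int) (q : nat) (S : int) (m : nat) :=
  exists ks rs, [/\ size ks = q, size rs = size cs,
    (m%:Z %| 2 * sumz ks + S)%Z &
    forall M, submodule M -> (forall g, g \in gs -> period M g) ->
      (forall k, k \in ks -> antiperiod M k) -> period M m%:Z ->
      contains_multiples M m -> M (config cs rs)].

Definition solvable_config (gs : seq int) (q : nat) (S : int) :=
  exists ks rs, [/\ size ks = q, size rs = size cs, 2 * sumz ks + S = 0 &
    lamp_span gs ks (config cs rs)].

Lemma contains_multiples0 M : submodule M -> contains_multiples M 0.
Proof. by move=> sM f; rewrite mulr0n; apply: sM.1.1. Qed.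

Lemma contains_multiples_dvd M m m' : (m %| m')%N ->
  contains_multiples M m -> contains_multiples M m'.
Proof. by move=> /dvdnP[q ->] h f; rewrite mulrnA; apply: h. Qed.

Lemma fold_multiple_periods gs D N : (D%:Z %| list_gcd gs)%Z ->
  forall g, g \in gs -> period (@fold_multiple A D false N) g.
Proof.
move=> Dg g hg; apply: fold_multiple_period; apply: dvdz_trans Dg _.
exact: list_gcd_dvd.
Qed.

Lemma local_global0 gs S :
  (forall m, (0 < m)%N -> locally_solvable gs 0 S m) -> solvable_config gs 0 S.
Proof.
move=> H.
have S0 : S = 0.
  have [[|k ks] [rs [// _ _ dv _]]] := H (absz S).+1 isT.
  move: dv; rewrite mulr0 add0r dvdzE /= => dv.
  by apply/eqP; rewrite -absz_eq0; apply: contraLR dv => /eqP S0; rewrite gtnNdvd // lt0n; apply/eqP.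
have key D : (0 < D)%N -> (D%:Z %| list_gcd gs)%Z ->
    exists rs, size rs = size cs /\ fold_multiple D false 0 (config cs rs).
  move=> D0 Dg; apply: config_residual => // m m0.
  (* D and m both divide this modulus, so the test submodule meets both local conditions. *)
  have [|[|k ks] [rs [// _ srs _ h]]] := H (m * D)%N; first by rewrite muln_gt0 m0.
  exists rs; split=> //; apply: h => //.
  - exact: fold_multiple_submodule.
  - exact: fold_multiple_periods.
  - by apply: fold_multiple_period; rewrite dvdzE /= dvdn_mull.
  - by apply: fold_multiple_contains; rewrite dvdn_mulr.
pose I := @lamp_span A gs [::]; have sI : submodule I by apply: lamp_span_submodule.
have pI : period I (list_gcd gs).
  by apply: period_list_gcd => // g hg; apply: lamp_span_period.
suff [rs [srs hrs]] : exists rs, size rs = size cs /\ I (config cs rs).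
  by exists [::], rs; split=> //; rewrite S0.
have [g0|g0] := eqVneq (list_gcd gs) 0.
  have [D D0 un] := unroll.
  have [|rs [srs hrs]] := key D D0; first by rewrite g0 dvdz0.
  have [rs' [srs' hrs']] := un D 0%N rs (leqnn _) srs hrs.
  exists rs'; split=> //; apply: pointwise_multiple_sub hrs' => //.
  exact: contains_multiples0.
have [|| rs [srs hrs]] := key `|list_gcd gs|%N; first by rewrite absz_gt0.
  by rewrite dvdzE /=.
exists rs; split=> //; apply: fold_multiple_sub hrs => //.
- by rewrite absz_gt0.
- by apply: (period_dvd sI _ pI); rewrite dvdzE /=.
exact: contains_multiples0.
Qed.

Lemma locally_solvable_even gs q S : locally_solvable gs q S 2 ->
  exists Q, S = - (2 * Q).
Proof.
move=> [ks [rs [_ _ /dvdzP[t Et] _]]]; exists (sumz ks - t); lia.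
Qed.

(** The only exponent is congruent to Q, so it may be taken equal to Q. With D the gcd of gs and 2Q,
    there are three cases: D = 0, where Q = 0 and only 2 is killed; D dividing Q, where t^D - 1 and
    2 are; and Q an odd multiple of h = D/2, where t^h + 1 is. *)
Lemma local_global1 gs (Q : int) :
  (forall m, (0 < m)%N -> locally_solvable gs 1 (- (2 * Q)) m) ->
  solvable_config gs 1 (- (2 * Q)).
Proof.
move=> H.
have H1 m : (0 < m)%N -> exists rs, size rs = size cs /\
    forall M, submodule M -> (forall g, g \in gs -> period M g) ->
      antiperiod M Q -> period M m%:Z -> contains_multiples M m -> M (config cs rs).
  (* The sum condition concerns 2k; doubling the modulus yields k modulo m. *)
  move=> m0; have [|[|k [|k' ks]] [rs [// _ srs /dvdzP[t Et] h]]] := H (2 * m)%N.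
    by rewrite muln_gt0.
  exists rs; split=> // M sM pM aM pm cm; apply: h => //.
  - move=> x; rewrite inE => /eqP ->.
    have -> : k = Q + t * m%:Z by move: Et; rewrite /= PoszM; lia.
    apply: antiperiod_add => //; apply: (period_dvd sM _ pm); exact: dvdz_mull.
  - by apply: (period_dvd sM _ pm); rewrite dvdzE /= dvdn_mull.
  - exact: contains_multiples_dvd (dvdn_mull _ _) cm.
pose I := @lamp_span A gs [:: Q]; have sI : submodule I by apply: lamp_span_submodule.
have pI : period I (list_gcd gs).
  by apply: period_list_gcd => // g hg; apply: lamp_span_period.
have aI : antiperiod I Q by apply: lamp_span_antiperiod; rewrite mem_head.
suff [rs [srs hrs]] : exists rs, size rs = size cs /\ I (config cs rs).
  by exists [:: Q], rs; split=> //=; rewrite addr0 addrN.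
set D := gcdz (list_gcd gs) (Q + Q).
have pD : period I D by apply: period_gcd => //; apply: antiperiodD.
have Dg : (D %| list_gcd gs)%Z by apply: dvdz_gcdl.
have [d Ed] : exists d : nat, D = d by exists `|D|%N.
have [d0|d0] := posnP d.
  have [D0 D0_gt0 un] := unroll.
  have g0 : list_gcd gs = 0 by move: Dg; rewrite Ed d0 dvd0z => /eqP.
  have Q0 : Q = 0.
    have : (D %| Q + Q)%Z by apply: dvdz_gcdr.
    by rewrite Ed d0 dvd0z => /eqP; lia.
  have [|rs [srs hrs]] := H1 (2 * D0)%N; first by rewrite muln_gt0.
  have sF := fold_multiple_submodule A D0 false 2.
  have [|rs' [srs' hrs']] := un D0 2%N rs (leqnn _) srs.
    apply: hrs => //.
    - by apply: fold_multiple_periods; rewrite g0 dvdz0.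
    - rewrite Q0; apply: double_antiperiod => //; last exact: period0.
      exact: fold_multiple_contains.
    - by apply: fold_multiple_period; rewrite dvdzE /= dvdn_mull.
    - by apply: fold_multiple_contains; rewrite dvdn_mulr.
  exists rs'; split=> //; apply: pointwise_multiple_sub hrs' => //.
  apply: antiperiod_double aI _ => //; rewrite Q0; exact: period0.
have [DQ|DQ] := boolP (D %| Q)%Z.
  have [|rs [srs hrs]] := H1 (2 * d)%N; first by rewrite muln_gt0.
  have sF := fold_multiple_submodule A d false 2.
  exists rs; split=> //; apply: (@fold_multiple_sub _ _ d false 2) => //.
  - by rewrite /= -Ed.
  - by apply: antiperiod_double aI _ => //; apply: period_dvd pD.
  apply: hrs => //.
  - by apply: fold_multiple_periods; rewrite -Ed.
  - apply: double_antiperiod; first exact: sF.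
      exact: fold_multiple_contains.
    by apply: fold_multiple_period; rewrite -Ed.
  - by apply: fold_multiple_period; rewrite dvdzE /= dvdn_mull.
  - by apply: fold_multiple_contains; rewrite dvdn_mulr.
have /dvdzP[w Ew] : (D %| Q + Q)%Z by apply: dvdz_gcdr.
have [t Et] : exists t, w = 2 * t + 1.
  exists (w %/ 2)%Z; apply/eqP; apply: contraNT DQ => /eqP w2.
  have {}w2 : w = 2 * (w %/ 2)%Z by lia.
  by apply/dvdzP; exists (w %/ 2)%Z; nia.
have [h [Eh EQ]] : exists h : nat, D = h%:Z + h%:Z /\ Q = h%:Z * (2 * t + 1).
  have [z [E1 E2]] : exists z, D = 2 * z /\ Q = z + t * D.
    by exists (Q - t * D); split; [rewrite Et in Ew; lia|ring].
  exists (absz z); have -> : (absz z)%:Z = z by lia.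
  by split; [lia|rewrite {1}E2 E1; ring].
have h0 : (0 < h)%N by lia.
have [m m0|rs [srs hrs]] := @config_residual h true h0.
  have [|rs [srs hrs]] := H1 (m * d)%N; first by rewrite muln_gt0 m0.
  have sF := fold_multiple_submodule A h true m.
  have pF := @fold_multiple_period_double h true m h0.
  exists rs; split=> //; apply: hrs => //.
  - move=> g hg; apply: period_dvd pF => //; rewrite -Eh.
    by apply: dvdz_trans Dg _; apply: list_gcd_dvd.
  - by rewrite EQ; apply: antiperiod_odd => //; apply: fold_multiple_antiperiod.
  - by apply: period_dvd pF => //; rewrite -Eh Ed dvdzE /= dvdn_mull.
  - by apply: fold_multiple_contains; rewrite dvdn_mulr.
exists rs; split=> //; apply: fold_multiple_sub hrs => //; last exact: contains_multiples0.
rewrite /= (_ : h%:Z = Q + (- t) * D); last by rewrite EQ Eh; ring.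
by apply: antiperiod_add => //; apply: (period_dvd sI _ pD); apply: dvdz_mull.
Qed.

Lemma odd_part (k : int) : k != 0 -> exists (j : nat) (t : int),
  k = (2 ^ j)%N%:Z * (2 * t + 1).
Proof.
move=> k0; have k0' : (0 < absz k)%N by rewrite absz_gt0.
have [a co Ea] := @pfactor_coprime 2 (absz k) isT k0'.
have oa : odd a by move: co; rewrite coprime2n.
set e := (2 ^ _)%N in Ea; exists (logn 2 (absz k)); rewrite -/e.
have Ez : a%:Z = 2 * a./2%:Z + 1 by have := odd_double_half a; rewrite oa; lia.
have [kp|kn] := ger0P k.
  by exists a./2%:Z; rewrite (_ : k = (absz k)%:Z) ?Ea ?PoszM ?Ez; [ring|lia].
exists (- a./2%:Z - 1).
by rewrite (_ : k = - (absz k)%:Z) ?Ea ?PoszM ?Ez; [ring|lia].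
Qed.

(** The exponents are k and Q - k, so Q is a period and k is free. With E the power of two in G =
    gcd(gs, Q), a local solution with E dividing k gives one modulo t^E - 1 and 2; otherwise k is an
    odd multiple of some 2^j properly dividing E, and t^(2^j) + 1 is the relevant modulus. *)
Lemma local_global2 gs (Q : int) :
  (forall m, (0 < m)%N -> locally_solvable gs 2 (- (2 * Q)) m) ->
  solvable_config gs 2 (- (2 * Q)).
Proof.
move=> H.
pose good m k rs := size rs = size cs /\
    forall M, submodule M -> (forall g, g \in gs -> period M g) ->
      antiperiod M k -> antiperiod M (Q - k) -> period M m%:Z ->
      contains_multiples M m -> M (config cs rs).
have H2 m : (0 < m)%N -> exists k rs, good m k rs.
  move=> m0; have [|[|k [|k' [|k'' ks]]] [rs [// _ srs /dvdzP[t Et] h]]] := H (2 * m)%N.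
    by rewrite muln_gt0.
  exists k, rs; split=> // M sM pM aM aM' pm cm; apply: h => //.
  - move=> x; rewrite !inE => /orP[] /eqP -> //.
    have -> : k' = Q - k + t * m%:Z by move: Et; rewrite /= PoszM; lia.
    apply: antiperiod_add => //; apply: (period_dvd sM _ pm); exact: dvdz_mull.
  - by apply: (period_dvd sM _ pm); rewrite dvdzE /= dvdn_mull.
  - exact: contains_multiples_dvd (dvdn_mull _ _) cm.
pose I k := @lamp_span A gs [:: k; Q - k].
have sI k : submodule (I k) by apply: lamp_span_submodule.
have pI k : period (I k) (list_gcd gs).
  by apply: period_list_gcd => // g hg; apply: lamp_span_period.
have aI k : antiperiod (I k) k by apply: lamp_span_antiperiod; rewrite mem_head.
have aI' k : antiperiod (I k) (Q - k).
  by apply: lamp_span_antiperiod; rewrite !inE eqxx orbT.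
have pQ k : period (I k) Q.
  by rewrite (_ : Q = k + (Q - k)); [apply: antiperiodD|ring].
suff [k [rs [srs hrs]]] : exists k rs, size rs = size cs /\ I k (config cs rs).
  by exists [:: k; Q - k], rs; split=> //=; ring.
set G := gcdz (list_gcd gs) Q.
have Gg : (G %| list_gcd gs)%Z by apply: dvdz_gcdl.
have GQ : (G %| Q)%Z by apply: dvdz_gcdr.
have pG k : period (I k) G by apply: period_gcd.
have [D0 D0_gt0 un] := unroll.
(* When G = 0 every power of two divides it, and one long enough for unrolling is chosen. *)
have [nu [nuG nuN nuD]] : exists nu, [/\ ((2 ^ nu)%N %| G)%Z,
    G != 0 -> ~~ ((2 ^ nu.+1)%N %| G)%Z & G = 0 -> (D0 <= 2 ^ nu)%N].
  have [->|G0] := eqVneq G 0.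
    exists D0; split; [exact: dvdz0|by case/eqP|by move=> _; apply/ltnW/ltn_expl].
  exists (logn 2 (absz G)); split=> [|_|E]; last by rewrite E eqxx in G0.
    by rewrite dvdzE /= pfactor_dvdnn.
  have G0' : (0 < gcdn (absz (list_gcd gs)) (absz Q))%N.
    by rewrite -[gcdn _ _]/(absz G) absz_gt0.
  by rewrite dvdzE /= pfactor_dvdn // ltnn.
set E := (2 ^ nu)%N in nuG nuD; have E0 : (0 < E)%N by rewrite expn_gt0.
have Eg : (E%:Z %| list_gcd gs)%Z by apply: dvdz_trans Gg.
have EQ : (E%:Z %| Q)%Z by apply: dvdz_trans GQ.
have [[m [k [rs [m0 Em Ek [srs hrs]]]]]|none] := classic (exists m k rs,
    [/\ (0 < m)%N, (2 * E %| m)%N, (E%:Z %| k)%Z & good m k rs]).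
  have sF := fold_multiple_submodule A E false 2.
  have cF : contains_multiples (@fold_multiple A E false 2) 2.
    exact: fold_multiple_contains.
  have Fc : fold_multiple E false 2 (config cs rs).
    apply: hrs => //.
    - exact: fold_multiple_periods.
    - by apply: double_antiperiod => //; apply: fold_multiple_period.
    - by apply: double_antiperiod => //; apply: fold_multiple_period; rewrite rpredB.
    - apply: fold_multiple_period; rewrite dvdzE /=.
      exact: dvdn_trans (dvdn_mull _ _) Em.
    - by apply: fold_multiple_contains; apply: dvdn_trans (dvdn_mulr _ _) Em.
  have [G0|G0] := eqVneq G 0.
    have [rs' [srs' hrs']] := un E 2%N rs (nuD G0) srs Fc.
    exists 0, rs'; split=> //; apply: pointwise_multiple_sub hrs' => //.
    by apply: antiperiod_double (aI 0) _ => //; apply: period0.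
  exists E%:Z, rs; split=> //.
  (* G and 2E are periods and 2E does not divide G, so their gcd is E; with the antiperiod E this
     puts 2 in the span. *)
  have pE : period (I E%:Z) E%:Z.
    have : period (I E%:Z) (gcdz G (E%:Z + E%:Z)).
      by apply: period_gcd => //; apply: antiperiodD.
    apply: period_dvd => //; rewrite (_ : E%:Z + E%:Z = (2 ^ nu.+1)%N); last first.
      by rewrite expnS mul2n -addnn.
    have : (gcdn (absz G) (2 ^ nu.+1) %| 2 ^ nu.+1)%N by apply: dvdn_gcdr.
    move=> /(dvdn_pfactor _ _ (isT : prime 2))[i lei Ei].
    rewrite /gcdz /= Ei dvdzE /= /E dvdn_exp2l //.
    move: lei; rewrite leq_eqVlt ltnS => /orP[/eqP Ei'|//].
    have /negP[] := nuN G0; rewrite dvdzE /= -Ei' -Ei; exact: dvdn_gcdl.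
  apply: fold_multiple_sub Fc => //; apply: antiperiod_double (aI _) _ => //.
(* Only the valuation j of k matters, and it is below nu; hence one j serves all moduli, and 2^j can
   be taken as the global exponent. *)
pose P (j : 'I_nu) m := exists rs, size rs = size cs /\
  fold_multiple (2 ^ j)%N true m (config cs rs).
have [||j hj] := @divisibility_pigeonhole _ P.
- move=> j m m' dm [rs [srs hrs]]; exists rs; split=> //.
  exact: fold_multiple_weaken dm hrs.
- move=> m m0; have m2 : (0 < m * (2 * E))%N by rewrite !muln_gt0 m0.
  have [k [rs gk]] := H2 _ m2.
  have nEk : ~~ (E%:Z %| k)%Z.
    apply/negP => Ek; apply: none; exists (m * (2 * E))%N, k, rs; split=> //.
    exact: dvdn_mull.
  have k0 : k != 0 by apply: contraNneq nEk => ->; apply: dvdz0.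
  have [j [t Et]] := odd_part k0.
  have ltj : (j < nu)%N.
    rewrite ltnNge; apply: contra nEk => le; rewrite Et dvdz_mulr //.
    by rewrite dvdzE /= dvdn_exp2l.
  exists (Ordinal ltj), rs; have [srs hrs] := gk; split=> //=.
  set F := fold_multiple _ _ _.
  have j0 : (0 < 2 ^ j)%N by rewrite expn_gt0.
  have sF : submodule F by apply: fold_multiple_submodule.
  have pF : period F ((2 ^ j)%N%:Z + (2 ^ j)%N%:Z) by apply: fold_multiple_period_double.
  have jE : ((2 ^ j)%N%:Z + (2 ^ j)%N%:Z %| E%:Z)%Z.
    by rewrite -PoszD addnn -mul2n -expnS dvdzE /= dvdn_exp2l.
  have ak : antiperiod F k.
    by rewrite Et; apply: antiperiod_odd => //; apply: fold_multiple_antiperiod.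
  have pQF : period F Q by apply: period_dvd pF => //; apply: dvdz_trans EQ.
  apply: hrs => //.
  - move=> g hg; apply: period_dvd pF => //; apply: dvdz_trans jE _.
    by apply: dvdz_trans Eg _; apply: list_gcd_dvd.
  - by rewrite addrC; apply: antiperiod_add => //; apply: antiperiodN.
  - apply: period_dvd pF => //; apply: dvdz_trans jE _.
    by rewrite dvdzE /= mulnA dvdn_mull.
  - by apply: fold_multiple_contains; rewrite dvdn_mulr.
have j0 : (0 < 2 ^ j)%N by rewrite expn_gt0.
have [rs [srs hrs]] := config_residual j0 hj.
exists (2 ^ j)%N%:Z, rs; split=> //.
by apply: fold_multiple_sub hrs => //; [exact: aI|exact: contains_multiples0].
Qed.

Lemma local_global3 gs q (Q : int) : locally_solvable gs q.+3 (- (2 * Q)) 2 ->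
  solvable_config gs q.+3 (- (2 * Q)).
Proof.
move=> [ks [rs [_ srs _ h]]].
have sumz0 : sumz (nseq q 0) = 0 by elim: (q) => //= n ->.
(* Exponent 0 contributes 2 and exponent 1 contributes t + 1. The submodule generated by 2 and t - 1
   contains every t^g - 1 and t^k + 1, so the single modulus 2 suffices. *)
exists [:: 0, 1, Q - 1 & nseq q 0], rs; split=> //=.
- by rewrite size_nseq.
- by rewrite sumz0; ring.
set I := lamp_span _ _; have sI : submodule I by apply: lamp_span_submodule.
have cI : contains_multiples I 2.
  apply: antiperiod_double (period0 sI) => //.
  by apply: lamp_span_antiperiod; rewrite mem_head.
have pI : period I 1.
  have aI : antiperiod I 1 by apply: lamp_span_antiperiod; rewrite !inE eqxx orbT.
  by move=> f; have := sI.1.2 _ _ (aI f) (cI f); congr I; zmod.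
have sF := fold_multiple_submodule A 1 false 2.
have pF s : period (@fold_multiple A 1 false 2) s.
  by apply: fold_multiple_period; apply: dvd1z.
have cF : contains_multiples (@fold_multiple A 1 false 2) 2.
  exact: fold_multiple_contains.
apply: (@fold_multiple_sub _ _ 1 false 2) => //; apply: h => // k _.
exact: double_antiperiod.
Qed.

Theorem local_global gs q S :
  (forall m, (0 < m)%N -> locally_solvable gs q S m) -> solvable_config gs q S.
Proof.
case: q => [|q] H; first exact: local_global0.
have [Q EQ] := locally_solvable_even (H 2%N isT); rewrite EQ in H *.
case: q H => [|[|q]] H; first exact: local_global1.
  exact: local_global2.
by apply: local_global3; apply: H.
Qed.

End LocalGlobal.

(** * Coefficient-free systems *)

Section CoefficientFree.

Local Open Scope ring_scope.

Definition exponent_sum (n : nat) (V : zmodType) (y : 'I_n -> V) (w : word 'I_n) : V :=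
  \sum_(l <- w) (if l.2 then - y l.1 else y l.1).

Definition solvable_mod (E : cf_system) (m : nat) :=
  exists y : 'I_(cf_nvars E) -> int,
    (forall w, w \in cf_eqns E -> (m%:Z %| exponent_sum y w)%Z) /\
    exists i, ~~ (m%:Z %| y i)%Z.

Lemma exponent_sum_cons n (V : zmodType) (y : 'I_n -> V) l w :
  exponent_sum y (l :: w) = (if l.2 then - y l.1 else y l.1) + exponent_sum y w.
Proof. by rewrite /exponent_sum big_cons. Qed.

Lemma exponent_sum_nil n (V : zmodType) (y : 'I_n -> V) : exponent_sum y [::] = 0.
Proof. by rewrite /exponent_sum big_nil. Qed.

Lemma exponent_sum_morph n (V V' : zmodType) (f : V -> V') (y : 'I_n -> V) w :
  f 0 = 0 -> (forall a b, f (a + b) = f a + f b) ->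
  f (exponent_sum y w) = exponent_sum (fun i => f (y i)) w.
Proof.
move=> f0 fD; have fN a : f (- a) = - f a.
  by apply/eqP; rewrite -addr_eq0 -fD addNr f0.
elim: w => [|l w IH]; first by rewrite !exponent_sum_nil.
by rewrite !exponent_sum_cons fD IH; case: l.2; rewrite ?fN.
Qed.

Lemma eq_exponent_sum n (V : zmodType) (y z : 'I_n -> V) w : y =1 z ->
  exponent_sum y w = exponent_sum z w.
Proof. by move=> E; apply: eq_bigr => l _; rewrite E. Qed.

Variable A : zmodType.

Lemma shift_word_val n (x : 'I_n -> wreathZ A) w :
  shift (word_val x w) = exponent_sum (fun i => shift (x i)) w.
Proof.
elim: w => [|l w IH]; first by rewrite word_val_nil exponent_sum_nil.
by rewrite word_val_cons exponent_sum_cons shiftM IH; case: l.2.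
Qed.

Lemma lamps_word_val n (x : 'I_n -> wreathZ A) w : (forall i, shift (x i) = 0) ->
  lamps (word_val x w) = exponent_sum (fun i => lamps (x i)) w.
Proof.
move=> s0; elim: w => [|l w IH]; first by rewrite word_val_nil exponent_sum_nil.
rewrite word_val_cons exponent_sum_cons lampsM IH; case: l.2.
  by rewrite lampsV shiftV s0 oppr0 !translate_id.
by rewrite s0 translate_id.
Qed.

(** For the converse direction, Z embeds as the shifts and Z/d as the multiples of one generator of
    A lit at the origin. *)
Lemma nontrivial_solution_mod ds (a : nat -> A) (E : cf_system) : diagonal ds a ->
  has_nontrivial_solution (wreathZ A) E <->
  exists m, m \in 0%N :: ds /\ solvable_mod E m.
Proof.
move=> [gen rel]; split.
  move=> [x sx [i xi]].
  have sw w : w \in cf_eqns E -> word_val x w = 1%g by apply: sx.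
  have [/forallP s0'|/forallPn[j sj]] := boolP [forall j, shift (x j) == 0]; last first.
    exists 0%N; rewrite mem_head; split=> //; exists (fun j => shift (x j)); split.
      by move=> w /sw h; rewrite -shift_word_val h dvdz0.
    by exists j; rewrite dvd0z.
  have s0 j : shift (x j) = 0 by apply/eqP.
  have [n nz] : exists n, lamps (x i) n != 0.
    apply: NNPP => h; apply: xi; apply: wreathZ_eq => [n|]; last exact: s0.
    by rewrite [RHS]lamps0; apply/eqP/negPn/negP => nz; apply: h; exists n.
  have /fin_all_exists[c Ec] : forall j, exists c, lamps (x j) n = comb a (size ds) c.
    by move=> j; apply: gen.
  have [k [ltk nd]] : exists k, (k < size ds)%N /\ ~~ ((nth 0%N ds k)%:Z %| c i k)%Z.
    apply: NNPP => h; case/eqP: nz; rewrite Ec; apply/rel => k ltk.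
    by apply/negPn/negP => nd; apply: h; exists k.
  exists (nth 0%N ds k); rewrite inE mem_nth ?orbT //; split=> //.
  exists (fun j => c j k); split=> [w /sw h|]; last by exists i.
  have : lamps (word_val x w) n = 0 by rewrite h lamps0.
  rewrite lamps_word_val // (@exponent_sum_morph _ _ _ (fun f : lampsType A => f n));
    [|exact: lamps0|by move=> f g; rewrite lampsD].
  rewrite (eq_exponent_sum _ Ec) => Ew; move: k ltk {nd}; apply/rel; rewrite -[RHS]Ew.
  elim: (w) => [|l v IH].
    by rewrite exponent_sum_nil /comb big1 // => k _; rewrite exponent_sum_nil mulr0z.
  rewrite exponent_sum_cons -IH /comb; under eq_bigr => k _ do rewrite exponent_sum_cons mulrzDr.
  rewrite big_split; congr (_ + _); case: l.2 => //.
  by rewrite -sumrN; apply: eq_bigr => k _; rewrite mulrNz.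
move=> [m [mds [y [sy [i yi]]]]].
have [m0|m0] := eqVneq m 0%N.
  exists (fun j => WreathZ 0 (y j)) => [w hw|]; last first.
    exists i => /(congr1 (@shift A)) /= yi0; move: yi; by rewrite yi0 dvdz0.
  have Ew : word_val (fun j => WreathZ (0 : lampsType A) (y j)) w = WreathZ 0 (exponent_sum y w).
    elim: (w) => [|l v IH]; first by rewrite word_val_nil exponent_sum_nil.
    rewrite word_val_cons exponent_sum_cons IH -shift_mul; congr (_ * _)%g.
    case: l.2 => //; apply: wreathZ_eq => // p.
    by rewrite lampsV translate0 oppr0.
  by rewrite Ew; have := sy w hw; rewrite m0 dvd0z => /eqP ->.
have [k ltk Ek] : exists2 k, (k < size ds)%N & nth 0%N ds k = m.
  move: mds; rewrite inE (negPf m0) /= => /(nthP 0%N)[k ltk Ek]; by exists k.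
have ak z : (a k *~ z == 0) = (m%:Z %| z)%Z.
  have E1 : a k *~ z = comb a (size ds) (fun j => if j == k then z else 0).
    rewrite /comb (bigD1 (Ordinal ltk)) //= eqxx big1 ?addr0 // => j.
    by rewrite -val_eqE /= => /negPf ->; rewrite mulr0z.
  apply/eqP/idP => [h|dv].
    by have := (rel _).1 (etrans (esym E1) h) k ltk; rewrite eqxx Ek.
  by rewrite E1; apply/rel => j ltj; case: eqP => [->|_]; rewrite ?Ek ?dvdz0.
exists (fun j => WreathZ (delta 0 (a k *~ y j)) 0) => [w hw|]; last first.
  exists i => /(congr1 (fun x : wreathZ A => lamps x 0)); rewrite /= deltaE eqxx.
  by rewrite [X in _ = X]lamps0 => /eqP; rewrite ak (negPf yi).
apply: wreathZ_eq => [p|]; last first.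
  rewrite shift_word_val /=; elim: (w) => [|l v IH]; first by rewrite exponent_sum_nil.
  by rewrite exponent_sum_cons IH addr0 oppr0 if_same.
rewrite lamps_word_val //= -(@exponent_sum_morph _ _ _ (fun z : int => delta 0 (a k *~ z))).
- by have := sy w hw; rewrite -ak => /eqP ->; rewrite delta0.
- by rewrite mulr0z delta0.
- by move=> b c; rewrite mulrzDr deltaD.
Qed.

(** Descent: as long as p divides all coordinates of an integer solution, they can be divided by p,
    and a non-zero one gets smaller. *)
Lemma solvable_mod0 E p : (1 < p)%N -> solvable_mod E 0 -> solvable_mod E p.
Proof.
move=> p1 [y [sy [i]]]; rewrite dvd0z => yi.
have {}sy w : w \in cf_eqns E -> exponent_sum y w = 0.
  by move=> hw; apply/eqP; rewrite -dvd0z; apply: sy.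
have [N] := ubnP (absz (y i)); elim: N y yi sy => // N IH y yi sy ltN.
have [[j nd]|all_d] := classic (exists j, ~~ (p%:Z %| y j)%Z).
  exists y; split=> [w hw|]; [by rewrite sy ?dvdz0|by exists j].
have dv j : y j = (y j %/ p%:Z)%Z * p%:Z.
  by rewrite divzK //; apply/negPn/negP => nd; apply: all_d; exists j.
have p0 : p%:Z != 0 by lia.
apply: (IH (fun j => (y j %/ p%:Z)%Z)).
- by apply: contraNneq yi => h; rewrite (dv i) h mul0r.
- move=> w hw; apply: (mulIf p0); rewrite mul0r -[RHS](sy w hw).
  rewrite (@exponent_sum_morph _ _ _ (fun z : int => z * p%:Z)) ?mul0r //; last first.
    by move=> b c; rewrite mulrDl.
  by apply: eq_exponent_sum => j; rewrite -dv.
have := dv i; move: yi ltN; set q := (_ %/ _)%Z => yi ltN Eq; nia.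
Qed.

Lemma map_intr_inj r c : injective (map_mx intr : 'M[int]_(r, c) -> 'M[rat]_(r, c)).
Proof.
move=> M M' E; apply/matrixP => i j; apply: (@intr_inj rat).
by have := congr1 (fun X : 'M[rat]_(r, c) => X i j) E; rewrite !mxE.
Qed.

Lemma clear_denominators r c (M : 'M[rat]_(r, c)) : exists (D : int) (M' : 'M[int]_(r, c)),
  D != 0 /\ map_mx intr M' = D%:~R *: M.
Proof.
pose D := \prod_i \prod_j denq (M i j).
have D0 : D != 0 by apply/prodf_neq0 => i _; apply/prodf_neq0 => j _; apply: denq_neq0.
have ex i j : exists z : int, z%:~R == (D%:~R * M i j : rat).
  exists ((\prod_(k | k != i) \prod_l denq (M k l)) *
    ((\prod_(l | l != j) denq (M i l)) * numq (M i j))).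
  have -> : D = denq (M i j) * \prod_(l | l != j) denq (M i l) *
      \prod_(k | k != i) \prod_l denq (M k l).
    by rewrite /D (bigD1 i) //= (bigD1 j).
  by rewrite !rmorphM /= numqE; apply/eqP; ring.
exists D, (\matrix_(i, j) xchoose (ex i j)); split=> //.
by apply/matrixP => i j; rewrite !mxE; apply/eqP; apply: (xchooseP (ex i j)).
Qed.

(** The coefficient matrix N is row free over the rationals, since a kernel vector with denominators
    cleared would be an integer solution. A right inverse with denominators cleared gives N B' = D
    for a non-zero integer D. *)
Lemma unsolvable_mod0 E : ~ solvable_mod E 0 -> exists2 p, (1 < p)%N & ~ solvable_mod E p.
Proof.
move=> nsol; set n := cf_nvars E; set eqs := cf_eqns E.
pose unit_vec (i j : 'I_n) : int := (i == j)%:Z.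
pose N : 'M[int]_(n, size eqs) :=
  \matrix_(i, j) exponent_sum (unit_vec i) (nth [::] eqs j).
have expE (y : 'I_n -> int) w : exponent_sum y w = \sum_i y i * exponent_sum (unit_vec i) w.
  elim: w => [|l w IH].
    by rewrite exponent_sum_nil big1 // => i _; rewrite exponent_sum_nil mulr0.
  rewrite exponent_sum_cons IH; under [RHS]eq_bigr => i _ do rewrite exponent_sum_cons mulrDr.
  rewrite big_split /=; congr (_ + _).
  rewrite (bigD1 l.1) //= big1 => [|i /negPf il]; rewrite /unit_vec ?eqxx ?il.
    by rewrite addr0; case: l.2; rewrite ?mulrN mulr1.
  by rewrite oppr0 if_same mulr0.
have rowE (y : 'rV[int]_n) j : (y *m N) 0 j = exponent_sum (fun i => y 0 i) (nth [::] eqs j).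
  by rewrite mxE expE; apply: eq_bigr => i _; rewrite mxE.
pose NQ : 'M[rat]_(n, size eqs) := map_mx intr N.
have [/row_freeP[B HB]|nfree] := boolP (row_free NQ).
  have [D [B' [D0 EB']]] := clear_denominators B.
  have EN : N *m B' = D%:M.
    by apply: map_intr_inj; rewrite map_mxM EB' -scalemxAr HB map_scalar_mx scalemx1.
  (* A prime beyond D does not divide it, so N stays injective modulo p. *)
  have [p ltp pp] := prime_above (absz D).
  exists p; first exact: prime_gt1.
  move=> [y [sy [i /negP[]]]]; pose v : 'rV[int]_n := \row_i y i.
  have : (p%:Z %| (v *m N *m B')%R ord0 i)%Z.
    rewrite mxE; apply: (big_ind (fun z : int => (p%:Z %| z)%Z)) => [||j _].
    - exact: dvdz0.
    - by move=> b c; apply: rpredD.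
    apply: dvdz_mulr; rewrite rowE (@eq_exponent_sum _ _ _ y) => [|k]; last by rewrite mxE.
    by apply: sy; apply: mem_nth.
  rewrite -mulmxA EN mul_mx_scalar !mxE !dvdzE abszM Euclid_dvdM //.
  case/orP => //.
  by move=> /dvdn_leq; rewrite absz_gt0 D0 leqNgt ltp => /(_ isT).
have : kermx NQ != 0 by rewrite kermx_eq0.
move=> /rowV0Pn[v /sub_kermxP vN v0].
have [D [y [D0 Ey]]] := clear_denominators v.
case: nsol; exists (fun i => y 0 i); split.
  move=> w /(nthP [::])[j ltj <-]; rewrite dvd0z -(rowE y (Ordinal ltj)).
  suff -> : y *m N = 0 by rewrite mxE.
  by apply: map_intr_inj; rewrite map_mxM Ey -scalemxAl vN scaler0 raddf0.
apply: NNPP => h; case/eqP: v0; apply/rowP => i; rewrite mxE.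
have yi0 : y 0 i = 0.
  by apply/eqP/negPn/negP => yi; apply: h; exists i; rewrite dvd0z.
have := congr1 (fun M : 'rV[rat]_n => M 0 i) Ey; rewrite !mxE yi0 => /esym/eqP.
by rewrite mulf_eq0 intr_eq0 (negPf D0) => /eqP.
Qed.

End CoefficientFree.

(** * The algorithms *)

Lemma mem_tuples (X : eqType) (s : seq X) n l :
  (l \in tuples s n) = (size l == n) && all (mem s) l.
Proof.
elim: n l => [|n IH] l; first by rewrite inE; case: l.
apply/flatten_mapP/andP => [[z zs /mapP[l' l'in ->]]|].
  by move: l'in; rewrite IH => /andP[/eqP <- al]; rewrite /= zs al eqxx.
case: l => [|z l] [//= /eqP[sl] /andP[zs al]].
by exists z => //; apply: map_f; rewrite IH sl eqxx.
Qed.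

Lemma decode_table tbl :
  map CodeSeq.decode (CodeSeq.decode (CodeSeq.code (map CodeSeq.code tbl))) = tbl.
Proof.
by rewrite CodeSeq.codeK -map_comp -[RHS]map_id; apply: eq_map => U; apply: CodeSeq.codeK.
Qed.

Lemma finite_table (X Y : Type) n (y0 : Y) (R : X -> Y -> Prop) (x : 'I_n -> X) (p : pred Y) :
  (forall i, exists y, p y /\ R (x i) y) ->
  exists tbl, [/\ size tbl = n, all p tbl & forall i : 'I_n, R (x i) (nth y0 tbl i)].
Proof.
move=> h; have /fin_all_exists[f hf] := h.
exists (map f (enum 'I_n)); split.
- by rewrite size_map size_enum_ord.
- by rewrite all_map; apply/allP => i _; case: (hf i).
by move=> i; rewrite (nth_map i) ?size_enum_ord // nth_ord_enum; case: (hf i).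
Qed.

(** * Deciding coefficient-free systems *)

Section CoefficientFreeAlgorithm.

Local Open Scope ring_scope.

Definition raw_cf_letter n (l : 'I_n * bool) : seq nat :=
  [:: nat_of_ord l.1; nat_of_bool l.2].

Definition raw_cf (E : cf_system) : nat * seq (seq (seq nat)) :=
  (cf_nvars E, map (map (@raw_cf_letter _)) (cf_eqns E)).

Lemma cf_system_codeE E : cf_system_code E = enc (raw_cf E).
Proof.
have encS (X : Type) (eX : encoded X) (s : seq X) : enc s = CodeSeq.code (map enc s).
  by [].
rewrite /cf_system_code /raw_cf.
suff -> : map (@cf_word_code _) (cf_eqns E) =
    map (@enc _ (enc_seq (enc_seq enc_nat)))
      (map (map (@raw_cf_letter _)) (cf_eqns E)) by [].
rewrite -map_comp; apply: eq_map => w /=; rewrite encS -map_comp; congr CodeSeq.code.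
Qed.

Variable A : zmodType.

Definition letters_shift (U : seq nat) : int := shift (letters_val (fun=> 0 : A) 0 U).

Lemma trivial_mod_shift m U : trivial_mod [::] m U = (m%:Z %| letters_shift U)%Z.
Proof.
rewrite /trivial_mod /= andbT /shift_ok eqmod_dvdz /letters_shift.
by rewrite (shift_letters (fun=> 0 : A) 0 m 0 U 0 0) subrr add0r.
Qed.

Lemma letters_shift_cat U V : letters_shift (U ++ V) = letters_shift U + letters_shift V.
Proof. by rewrite /letters_shift letters_val_cat. Qed.

Lemma letters_shift_nil : letters_shift [::] = 0.
Proof. by rewrite /letters_shift letters_val_nil. Qed.

Lemma letters_shift_nseq n l : letters_shift (nseq n l) = letters_shift [:: l] *~ n.
Proof.
elim: n => [|n IH]; first by rewrite letters_shift_nil mulr0z.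
by rewrite -[nseq _ _]/([:: l] ++ nseq n l) letters_shift_cat IH -add1n PoszD mulrzDr mulr1z.
Qed.

Lemma letters_shift1 : [/\ letters_shift [:: 0%N] = 1, letters_shift [:: 1%N] = -1 &
  letters_shift [:: 2%N] = 0].
Proof. by split; rewrite /letters_shift letters_val_cons letters_val_nil mulg1. Qed.

Lemma letters_shift_subst_cf tbl n (w : word 'I_n) :
  letters_shift (subst_cf tbl (map (@raw_cf_letter _) w)) =
  exponent_sum (fun i => letters_shift (nth [::] tbl i)) w.
Proof.
elim: w => [|[i b] w IH]; first by rewrite exponent_sum_nil letters_shift_nil.
rewrite /subst_cf /= letters_shift_cat exponent_sum_cons IH; congr (_ + _).
by case: b => //=; rewrite /letters_shift /signed_entry /= letters_val_inv.
Qed.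

Lemma cf_solP m E tbl : reflect
  (let y := fun i : 'I_(cf_nvars E) => letters_shift (nth [::] tbl i) in
   (forall w, w \in cf_eqns E -> (m%:Z %| exponent_sum y w)%Z) /\
   exists i, ~~ (m%:Z %| y i)%Z)
  (cf_sol m (raw_cf E) tbl).
Proof.
apply: (iffP andP) => [[/allP h1 /hasP[i]]|[h1 [i yi]]].
  rewrite mem_iota trivial_mod_shift => /= lti yi; split; last by exists (Ordinal lti).
  move=> w hw; have := h1 _ (map_f (map (@raw_cf_letter _)) hw).
  by rewrite trivial_mod_shift letters_shift_subst_cf.
split.
  apply/allP => _ /mapP[w hw ->].
  by rewrite trivial_mod_shift letters_shift_subst_cf; apply: h1.
by apply/hasP; exists (nat_of_ord i); rewrite ?mem_iota //= trivial_mod_shift.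
Qed.

Lemma cf_neg_unsolvable ds E t m : cf_neg ds (raw_cf E) t ->
  m \in t.+2 :: ds -> m != 0%N -> ~ solvable_mod E m.
Proof.
move=> /allP neg mds m0 [y [sy [i yi]]].
have m0' : m%:Z != 0 by rewrite eqz_nat.
have [e1 _ e2] := letters_shift1.
have [|tbl [stbl ptbl htbl]] := @finite_table int (seq nat) (cf_nvars E) [::]
    (fun z U => (m%:Z %| letters_shift U - z)%Z) y (fun U => U \in tuples (iota 0 4) m).
  move=> j; have [r Er] : exists r : nat, (y j %% m%:Z)%Z = r.
    by exists (absz (y j %% m%:Z)%Z); have := modz_ge0 (y j) m0'; lia.
  have ltr : (r < m)%N by rewrite -ltz_nat -Er ltz_pmod // ltz_nat lt0n.
  (* r shifts padded with blanks: letter 2 is trivial when A has no listed generators. *)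
  exists (nseq r 0%N ++ nseq (m - r) 2%N); split.
    rewrite mem_tuples size_cat !size_nseq subnKC ?eqxx ?(ltnW ltr) //=.
    by rewrite all_cat !all_nseq /= !orbT.
  rewrite letters_shift_cat !letters_shift_nseq e1 e2 mul0rz addr0.
  rewrite (divz_eq (y j) m%:Z) Er; set q := (_ %/ _)%Z.
  by rewrite (_ : _ - _ = - q * m%:Z) ?dvdz_mull // intz; ring.
have := neg m mds; rewrite (negPf m0) => /allP/(_ tbl).
rewrite mem_tuples stbl eqxx ptbl => /(_ isT)/negP; apply; apply/cf_solP.
have dvE w : (m%:Z %| exponent_sum (fun j : 'I_(cf_nvars E) => letters_shift (nth [::] tbl j)) w -
    exponent_sum y w)%Z.
  elim: w => [|l w IH]; first by rewrite !exponent_sum_nil.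
  rewrite !exponent_sum_cons opprD addrACA rpredD //; have := htbl l.1.
  by case: l.2 => //; rewrite -opprD rpredN.
split=> [w hw|]; first by have := rpredD (dvE w) (sy w hw); rewrite subrK.
exists i; apply: contra yi => h; have := rpredB h (htbl i).
by rewrite opprB addrC subrK.
Qed.

Lemma coefficient_free_decidable ds (a : nat -> A) : diagonal ds a ->
  decidable_on cf_system_code (fun=> True)
    (fun E => has_nontrivial_solution (wreathZ A) E).
Proof.
move=> diag; apply: (decidable_by_search cf_system_codeE
  (computable_cf_pos ds) (computable_cf_neg ds)) => [E t _|E t _|E _].
- move=> /hasP[m mds /cf_solP h]; apply/(nontrivial_solution_mod E diag).
  by exists m; split=> //; eexists; exact: h.
- move=> neg /(nontrivial_solution_mod E diag)[m [mds sol]].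
  have [m0|m0] := eqVneq m 0%N.
    apply: (cf_neg_unsolvable neg (mem_head _ _)) => //.
    by apply: solvable_mod0 => //; rewrite -m0.
  apply: (cf_neg_unsolvable neg _ m0 sol).
  by move: mds; rewrite !inE (negPf m0) /= => ->; rewrite orbT.
have [[m [mds [y sy]]]|none] := classic (exists m, m \in 0%N :: ds /\ solvable_mod E m).
  left; have [e1 e2 _] := letters_shift1.
  have [|tbl [_ _ htbl]] := @finite_table int (seq nat) (cf_nvars E) [::]
      (fun z U => letters_shift U = z) y predT.
    move=> i; case: (y i) => n.
      by exists (nseq n 0%N); rewrite letters_shift_nseq e1 intz.
    by exists (nseq n.+1 1%N); rewrite letters_shift_nseq e2 mulNrz intz NegzE.
  exists (CodeSeq.code (map CodeSeq.code tbl)); apply/hasP; exists m => //.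
  rewrite decode_table; apply/cf_solP; have [s1 [i yi]] := sy.
  split=> [w hw|]; last by exists i; rewrite htbl.
  by rewrite (eq_exponent_sum _ htbl); apply: s1.
right; have [|p p1 np] := @unsolvable_mod0 E.
  by move=> h; apply: none; exists 0%N; rewrite mem_head.
exists p.-2; apply/allP => m; rewrite (_ : p.-2.+2 = p); last by lia.
rewrite inE => mds; have [//|m0 /=] := eqVneq m 0%N; apply/allP => tbl _.
apply/negP => /cf_solP h.
have sm : solvable_mod E m by eexists; exact: h.
case/orP: mds => [/eqP mp|mds]; first by apply: np; rewrite -mp.
by apply: none; exists m; rewrite inE mds orbT.
Qed.

End CoefficientFreeAlgorithm.

(** * Deciding quadratic equations *)

Section QuadraticAlgorithm.

Local Open Scope ring_scope.

Variables (A : zmodType) (k : nat) (s : 'I_k -> wreathZ A).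

Definition raw_letter n (l : ('I_n + 'I_k) * bool) : seq nat :=
  match l.1 with
  | inl i => [:: 0%N; nat_of_ord i; nat_of_bool l.2]
  | inr j => [:: 1%N; nat_of_ord j; nat_of_bool l.2]
  end.

Definition raw_eqn (E : equation k) : nat * seq (seq nat) :=
  (eq_nvars E, map (@raw_letter _) (eq_word E)).

Lemma equation_codeE E : equation_code E = enc (raw_eqn E).
Proof.
rewrite /equation_code /raw_eqn.
suff -> : map (@letter_code _ k) (eq_word E) =
    map (@enc _ (enc_seq enc_nat)) (map (@raw_letter _) (eq_word E)).
  by [].
by rewrite -map_comp; apply: eq_map => -[[i|j] b].
Qed.

Variables (ds : seq nat) (a : nat -> A) (cst : seq (seq nat)).
Hypothesis diag : diagonal ds a.
Notation lval := (letters_val a (size ds)).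
Hypothesis cstE : forall j : 'I_k, lval (nth [::] cst j) = s j.

Lemma letters_val_subst_eqn tbl n (w : word ('I_n + 'I_k)) :
  lval (subst_eqn tbl cst (map (@raw_letter n) w)) =
  word_val (assignment (fun i : 'I_n => lval (nth [::] tbl i)) s) w.
Proof.
elim: w => [|[l b] w IH]; first by rewrite word_val_nil letters_val_nil.
rewrite /subst_eqn /= letters_val_cat word_val_cons IH; congr (_ * _)%g.
by case: l => [i|j]; rewrite /signed_entry /=; case: b => /=;
  rewrite ?letters_val_inv ?cstE.
Qed.

(** A solution modulo m gives an honest value v of the word, to which the normal form applies in the
    wreath product itself. As v is congruent to 1, its lamps vanish modulo t^m - 1 and m, which
    leaves a local solution of the configuration problem. *)
Lemma quadratic_local_global (E : equation k) (e : nat) : (0 < e)%N -> quadratic E ->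
  (forall t, exists x, congruent (e * t.+1) (word_val (assignment x s) (eq_word E)) 1%g) ->
  has_solution s E.
Proof.
move=> e0 qE H.
have qw : quadratic_word (eq_word E).
  move=> i; have := qE i; rewrite /= -/(occ i (eq_word E)).
  by case: eqP => //= o /(_ isT) ->.
have [l Hl] := quadratic_normal_form s qw.
have res (x : A) : (forall m, (0 < m)%N -> multiple m x) -> x = 0.
  exact: diagonal_residual diag.
have [|ks [rs [sk sr sh sp]]] := @local_global A res (atoms_consts l) (atoms_periods l)
    (atoms_squares l) (sumz (map (@shift A) (atoms_consts l))).
  move=> m m0; have [x] := H m.-1; rewrite prednK //; set v := word_val _ _ => cv.
  have : values s (eq_word E) v by exists x, 1%g; rewrite invg1 mul1g mulg1.
  move=> /Hl/atoms_setE[ks [rs [sk sr sh sp]]]; exists ks, rs; split=> //.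
    rewrite -sh; have := cv.1; rewrite shift1 subr0; apply: dvdz_trans.
    by rewrite dvdzE /= dvdn_mull.
  move=> M sM pM aM pm cm.
  have Mv : M (lamps v).
    apply: (congruent1_closed sM _ _ _ cv); first by rewrite muln_gt0 e0.
      by apply: (period_dvd sM _ pm); rewrite dvdzE /= dvdn_mull.
    exact: contains_multiples_dvd (dvdn_mull _ _) cm.
  have := sM.1.2 _ _ Mv (sp M sM pM aM); congr M; zmod.
have : atoms_set l 1%g.
  apply/atoms_setE; exists ks, rs; split=> //; rewrite lamps1 sub0r.
  exact: (subgroupN (@lamp_span_submodule _ _ _).1).
move=> /Hl[x [g Eg]]; exists x; apply: (mulgI (g^-1)%g); apply: (mulIg g).
by rewrite mulg1 mulVg -/(wval s x (eq_word E)) -Eg.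
Qed.

Lemma quadratic_decidable :
  decidable_on (@equation_code k) (@quadratic k) (fun E => has_solution s E).
Proof.
pose e := (\prod_(d <- ds | d != 0) d)%N.
have e0 : (0 < e)%N by rewrite prodn_cond_gt0 // => d; rewrite lt0n.
have de t d : d \in ds -> d != 0%N -> (d %| e * t.+1)%N.
  by move=> dds d0; apply: dvdn_mulr; rewrite /e (big_rem d) //= d0 dvdn_mulr.
have m0 t : (0 < e * t.+1)%N by rewrite muln_gt0 e0.
apply: (decidable_by_search equation_codeE
  (computable_eqn_pos cst ds) (computable_eqn_neg cst ds e)) => [E t _|E t _|E qE].
- move=> /(trivial_modP diag erefl _ (fun _ _ _ => dvdn0 _))/congruent0.
  by rewrite letters_val_subst_eqn => h; eexists; exact: h.
- move=> /allP neg [x sx].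
  have [|tbl [stbl ptbl htbl]] := @finite_table (wreathZ A) (seq nat) (eq_nvars E) [::]
    (fun x U => congruent (e * t.+1) (lval U) x) x
    (fun U => U \in tuples (iota 0 (size ds).+2.*2) (word_bound (size ds) (e * t.+1))).
    move=> i; have [U [sU lU cU]] := bounded_word (m0 t) diag.1 (x i).
    exists U; split=> //; rewrite mem_tuples sU eqxx.
    by apply: sub_all lU => j; rewrite inE mem_iota.
  have := neg tbl; rewrite mem_tuples stbl eqxx ptbl => /(_ isT)/negP; apply.
  apply/(trivial_modP diag erefl _ (de t)); rewrite letters_val_subst_eqn -[X in congruent _ _ X]sx.
  by apply: congruent_word => -[i|j] /=; [apply: htbl|apply: congruent_refl].
have [[x sx]|none] := classic (has_solution s E).
  left; have [|tbl [_ _ htbl]] := @finite_table (wreathZ A) (seq nat) (eq_nvars E) [::]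
      (fun x U => lval U = x) x predT.
    by move=> i; have [U EU] := letters_val_surj diag.1 (x i); exists U.
  exists (CodeSeq.code (map CodeSeq.code tbl)).
  apply/(trivial_modP diag erefl _ (fun _ _ _ => dvdn0 _)).
  rewrite decode_table letters_val_subst_eqn -sx.
  by apply: congruent_word => -[i|j] /=; rewrite ?htbl; apply: congruent_refl.
right; apply: NNPP => nneg; apply: none; apply: (quadratic_local_global e0 qE) => t.
have : ~~ eqn_neg cst ds e (raw_eqn E) t by apply/negP => h; apply: nneg; exists t.
move=> /allPn[tbl _ /negPn/(trivial_modP diag erefl _ (de t))].
by rewrite letters_val_subst_eqn => h; eexists; exact: h.
Qed.

End QuadraticAlgorithm.

Theorem theorem4 (A : zmodType) (fgA : fg_abelian A) :
  decidable_on cf_system_code (fun _ => True)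
    (fun E => has_nontrivial_solution (wreathZ A) E)
  /\
  (forall (k : nat) (s : 'I_k -> wreathZ A), generates s ->
     decidable_on (@equation_code k) (@quadratic k)
       (fun E => has_solution s E)).
Proof.
have [ds [a diag]] := fg_abelian_diagonal fgA.
split=> [|k s _]; first exact: coefficient_free_decidable diag.
(* The generators are rewritten once and for all as words in the standard ones; this finite table is
   built into the program. *)
have [|cst [_ _ hcst]] := @finite_table (wreathZ A) (seq nat) k [::]
  (fun x U => letters_val a (size ds) U = x) s predT.
  by move=> j; have [U EU] := letters_val_surj diag.1 (s j); exists U.
exact: (quadratic_decidable diag hcst).
Qed.
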